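(* Let $L$ be a second order differential operator acting on densities of weight $w_0$ on $M$. If $w_0\neq0,1,\tfrac12$, then there exists a unique canonical pencil $\Delta_w$ (of weight $\lambda=0$) passing through $L$, i.e. such that $L=\Delta_{w_0}$. Namely, if a volume form $\boldsymbol\rho=\rho\,Dx$ is chosen and $L=\Delta^{LB}_{w_0}+\mathcal L_Q+f$ is the corresponding decomposition of $L$, with a vector field $Q$ and a scalar function $f$, then $$\Delta_w=\Delta^{LB}_w+\frac{2w-1}{2w_0-1}\,\mathcal L_Q+\frac{w(w-1)}{w_0(w_0-1)}\,f .$$
   Context: Let $M$ be a supermanifold (an ordinary manifold is allowed) with local coordinates $x^a$ of parity $\tilde a$; $\partial_a=\partial/\partial x^a$; all Jacobians (Berezinians) of the atlas are positive. A density of weight $w\in\mathbb R$ is locally $\psi(x)(Dx)^w$; $\mathcal L_Q$ denotes the Lie derivative on $w$-densities along the vector field $Q$, $\mathcal L_Q=Q^a\partial_a+w\,\partial_aQ^a(-1)^{\tilde a(\tilde Q+1)}$. All operators have a fixed parity $\varepsilon$. A canonical pencil (of weight $0$) is a family of operators $\Delta_w$, $w\in\mathbb R$, on $w$-densities, locally of the form $$\Delta_w=\tfrac12\Bigl(S^{ab}\partial_b\partial_a+\bigl(\partial_bS^{ba}(-1)^{\tilde b(\varepsilon+1)}+(2w-1)\gamma^a\bigr)\partial_a+w\,\partial_a\gamma^a(-1)^{\tilde a(\varepsilon+1)}+w(w-1)\theta\Bigr),$$ with $w$-independent coefficients $S^{ab}=(-1)^{\tilde a\tilde b}S^{ba}$,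 $\gamma^a$, $\theta$ in each coordinate system (equivalently: an operator $\Delta$ of order $\le2$ and weight $0$ on the algebra of all densities $\mathfrak V(M)$ with $\Delta(1)=0$ that is self-adjoint for the scalar product $\langle\psi,\chi\rangle=\int_M\psi\chi\,Dx$ of densities of complementary weights $w,1-w$, i.e. $\Delta_w^*=\Delta_{1-w}$). A second order operator on $w_0$-densities has locally the form $L=\frac12S^{ab}\partial_b\partial_a+T^a\partial_a+R$. Fix a (nowhere vanishing) basis volume form $\boldsymbol\rho=\rho\,Dx$. The Laplace–Beltrami type pencil associated with $S^{ab}$ and $\boldsymbol\rho$ is $$\Delta^{LB}_w(\psi(Dx)^w)=\tfrac12\,\rho^{w-1}\partial_a\bigl(\rho\,S^{ab}\partial_b(\rho^{-w}\psi)\bigr)(-1)^{\tilde a(\varepsilon+1)}(Dx)^w .$$ Given $\boldsymbol\rho$, any such $L$ can be uniquely written as $L=\Delta^{LB}_{w_0}+\mathcal L_Q+f$, where $Q$ is the vector field $Q^a=\frac12\bigl(2T^a-\partial_bS^{ba}(-1)^{\tilde b(\varepsilon+1)}-(2w_0-1)\Gamma^a\bigr)$, $\Gamma^a=-S^{ab}\partial_b\log\rho$, and $f$ is a scalar function on $M$. *)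

(* Defs.v *)
From mathcomp Require Import all_boot all_order all_algebra.
From mathcomp Require Import all_classical all_reals all_analysis.
Set Implicit Arguments.
Unset Strict Implicit.
Unset Printing Implicit Defensive.
Import Order.TTheory GRing.Theory Num.Theory.
Import numFieldNormedType.Exports.
Local Open Scope classical_set_scope.
Local Open Scope ring_scope.

(* Supermanifolds are superringed spaces (M, X) locally isomorphic to a
   superdomain (V, C^oo(V) (x) /\(xi_1, .., xi_m)) with V open in R^n, and they
   come with an atlas of coordinate systems whose Berezinians are positive;
   m = 0 gives ordinary (oriented) manifolds.
   Parities are booleans: false is even, true is odd, (+) is their sum. *)

(* ** The Grassmann algebra on m odd generators *)

Section Grassmann.
Variables (R : realType) (m : nat).
Implicit Types (u v : {ffun {set 'I_m} -> R}) (w r : R) (K : {set 'I_m}).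

(* u K is the coefficient in u of the product of the xi_k, k in K, taken in
   increasing order. *)
Definition grassmann := {ffun {set 'I_m} -> R}.

(* xi_I xi_J = gsign I J * xi_(I u J) for disjoint I and J *)
Definition gsign (I J : {set 'I_m}) : R :=
  (-1) ^+ #|[set p : 'I_m * 'I_m | [&& p.1 \in I, p.2 \in J & (p.2 < p.1)%N]]%SET|.

Definition gmul u v : grassmann :=
  [ffun K : {set 'I_m} =>
     \sum_(I : {set 'I_m} | I \subset K)
        gsign I (K :\: I)%SET * u I * v (K :\: I)%SET].

Definition gcst r : grassmann :=
  [ffun K : {set 'I_m} => if K == finset.set0 then r else 0].

Definition ggen (j : 'I_m) : grassmann :=
  [ffun K : {set 'I_m} => (K == [set j]%SET)%:R].

Definition ghom (p : bool) u : Prop := forall K, odd #|K| != p -> u K = 0.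

Definition gbody u : R := u finset.set0.

Definition rbin w (k : nat) : R := (\prod_(j < k) (w - j%:R)) / k`!%:R.

(* |u|^w for u even with nonzero body, where |u| is u or -u, whichever has a
   positive body v0: this is the binomial series
     (v0 + N)^w = \sum_k rbin w k v0^(w - k) N^k,
   finite because the soul N is nilpotent. *)
Definition gpow u w : grassmann :=
  let v : grassmann := [ffun K => Num.sg (gbody u) * u K] in
  let N : grassmann := v - gcst (gbody v) in
  \sum_(k < m.+1)
     gmul (gcst (rbin w k * (gbody v `^ (w - k%:R)))) (iter k (gmul N) (gcst 1)).

End Grassmann.

(* ** Superdomains: smooth Grassmann-valued functions on opens of R^n.
   Indices a : 'I_(n + m) run over the n even, then the m odd, coordinates. *)

Section Superdomain.
Variables (R : realType) (n m : nat).

Definition ipar (a : 'I_(n + m)) : bool := (n <= a)%N.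

Fixpoint Ck (k : nat) (V : set 'rV[R]_n) (g : 'rV[R]_n -> R) : Prop :=
  (forall y, V y -> {for y, continuous g}) /\
  if k is k'.+1 then
    forall i : 'I_n,
      (forall y, V y -> derivable g y (delta_mx 0 i)) /\
      Ck k' V (fun y => 'D_(delta_mx 0 i) g y)
  else True.

Definition gsmooth (V : set 'rV[R]_n) (F : 'rV[R]_n -> grassmann R m) : Prop :=
  forall K k, Ck k V (fun y => F y K).

(* left partial derivatives *)
Definition gpartial (a : 'I_(n + m)) (F : 'rV[R]_n -> grassmann R m)
    (y : 'rV[R]_n) : grassmann R m :=
  match fintype.split a with
  | inl i => [ffun K => 'D_(delta_mx 0 i) (fun z => F z K) y]
  | inr j => [ffun K : {set 'I_m} =>
      if j \in K then 0
      else (-1) ^+ #|[set k in K | (k < j)%N]%SET| * F y (j |: K)%SET]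
  end.

Definition gcoord (a : 'I_(n + m)) (y : 'rV[R]_n) : grassmann R m :=
  match fintype.split a with
  | inl i => gcst m (y 0 i)
  | inr j => ggen R j
  end.

End Superdomain.

(* ** Superringed spaces *)

Record opens (M : topologicalType) :=
  Opens { oset :> set M; openP : open oset }.

Definition oI (M : topologicalType) (U V : opens M) : opens M :=
  Opens (openI (openP U) (openP V)).

Definition oT (M : topologicalType) : opens M := Opens (@openT M).

(* A sheaf of supercommutative R-superalgebras on M. The section ring over the
   empty set is zero, hence the pzRingType; [cst] is the structure map of the
   R-algebra. Restriction [res U V] is only constrained when V is included
   in U. *)
Record superspace (R : realType) (M : topologicalType) := Superspace {
  sec :> opens M -> pzRingType;
  cst : forall U, R -> sec U;
  spar : forall U, bool -> sec U -> Prop;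
  res : forall U V, sec U -> sec V;
  cstD : forall U r s, cst U (r + s) = cst U r + cst U s;
  cstM : forall U r s, cst U (r * s) = cst U r * cst U s;
  cst1 : forall U, cst U 1 = 1;
  spar_cst : forall U r, spar false (cst U r);
  spar0 : forall U p, spar p (0 : sec U);
  sparB : forall U p (f g : sec U), spar p f -> spar p g -> spar p (f - g);
  sparM : forall U p q (f g : sec U),
    spar p f -> spar q g -> spar (p (+) q) (f * g);
  spar_dec : forall U (f : sec U), exists g, spar false g /\ spar true (f - g);
  spar_dir : forall U (f : sec U), spar false f -> spar true f -> f = 0;
  supercomm : forall U p q (f g : sec U),
    spar p f -> spar q g -> f * g = (-1) ^+ (p && q) * (g * f);
  resB : forall (U V : opens M) (f g : sec U), V `<=` U ->
    res V (f - g) = res V f - res V g;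
  resM : forall (U V : opens M) (f g : sec U), V `<=` U ->
    res V (f * g) = res V f * res V g;
  res_cst : forall (U V : opens M) r, V `<=` U -> res V (cst U r) = cst V r;
  res_par : forall (U V : opens M) p (f : sec U), V `<=` U -> spar p f -> spar p (res V f);
  res_id : forall U (f : sec U), res U f = f;
  res_comp : forall (U V W : opens M) (f : sec U), V `<=` U -> W `<=` V ->
    res W (res V f) = res W f;
  locality : forall (U : opens M) (K : Type) (V : K -> opens M) (f g : sec U),
    (forall k, V k `<=` U) -> U `<=` \bigcup_k V k ->
    (forall k, res (V k) f = res (V k) g) -> f = g;
  gluing : forall (U : opens M) (K : Type) (V : K -> opens M) (s : forall k, sec (V k)),
    (forall k, V k `<=` U) -> U `<=` \bigcup_k V k ->
    (forall k l, res (oI (V k) (V l)) (s k) = res (oI (V k) (V l)) (s l)) ->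
    exists f : sec U, forall k, res (V k) f = s k
}.

Arguments cst {R M} _ {U}.
Arguments spar {R M} _ {U}.
Arguments res {R M _ U} V.

(* A coordinate system of dimension n|m: a homeomorphism [cmap] of the open set
   [cdom] onto an open set of R^n together with an isomorphism, over [cmap],
   from X restricted to [cdom] to the sheaf of superdomain functions. A section
   f over U is expressed in the coordinates by [crep f], whose values only
   matter on [cmap @` U]; [csec] is the inverse isomorphism. *)
Record chart (R : realType) (M : topologicalType) (X : superspace R M)
    (n m : nat) := Chart {
  cdom : opens M;
  cmap : M -> 'rV[R]_n;
  crep : forall U, X U -> 'rV[R]_n -> grassmann R m;
  csec : forall U, ('rV[R]_n -> grassmann R m) -> X U;
  cmap_inj : forall x x', oset cdom x -> oset cdom x' -> cmap x = cmap x' -> x = x';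
  cmap_cont : forall x, oset cdom x -> {for x, continuous cmap};
  cmap_open : forall U : opens M, U `<=` cdom -> open (cmap @` U);
  crep_smooth : forall (U : opens M) (f : X U), U `<=` cdom ->
    gsmooth (cmap @` U) (crep f);
  crepK : forall (U : opens M) (f : X U), U `<=` cdom -> csec U (crep f) = f;
  csecK : forall (U : opens M) F, U `<=` cdom -> gsmooth (cmap @` U) F ->
    forall y, (cmap @` U) y -> crep (csec U F) y = F y;
  crepB : forall (U : opens M) (f g : X U) y, U `<=` cdom ->
    (cmap @` U) y -> crep (f - g) y = crep f y - crep g y;
  crepM : forall (U : opens M) (f g : X U) y, U `<=` cdom ->
    (cmap @` U) y -> crep (f * g) y = gmul (crep f y) (crep g y);
  crep_cst : forall (U : opens M) r y, U `<=` cdom ->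
    (cmap @` U) y -> crep (cst X r : X U) y = gcst m r;
  crep_par : forall (U : opens M) p (f : X U), U `<=` cdom ->
    (spar X p f <-> forall y, (cmap @` U) y -> ghom p (crep f y));
  crep_res : forall (U V : opens M) (f : X U) y, U `<=` cdom -> V `<=` U ->
    (cmap @` V) y -> crep (res V f) y = crep f y
}.

Arguments csec {R M X n m} c U.

(* ** Calculus in a coordinate system *)

Section Calculus.
Variables (R : realType) (M : topologicalType) (X : superspace R M).
Variables (n m : nat) (c : chart X n m).

Definition coord (a : 'I_(n + m)) : X (cdom c) := csec c _ (gcoord a).

Definition pd (U : opens M) (a : 'I_(n + m)) (f : X U) : X U :=
  csec c U (gpartial a (crep c f)).

(* |f|^w for an even f with nowhere vanishing body *)
Definition spow (U : opens M) (f : X U) (w : R) : X U :=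
  csec c U (fun y => gpow (crep c f y) w).

Definition spositive (U : opens M) (f : X U) : Prop :=
  forall y, (cmap c @` U) y -> 0 < gbody (crep c f y).

Definition snonvanishing (U : opens M) (f : X U) : Prop :=
  forall y, (cmap c @` U) y -> gbody (crep c f y) != 0.

End Calculus.

Definition mxinv (A : pzRingType) (k : nat) (D : 'M[A]_k) : 'M[A]_k :=
  xget 0 [set E | E *m D = 1%:M /\ D *m E = 1%:M].

(* The Berezinian det (A - B D^-1 C) det(D)^-1 of an even supermatrix. All
   determinants are of matrices with even, hence commuting, entries. *)
Definition Ber (A : pzRingType) (n m : nat) (J : 'M[A]_(n + m)) : A :=
  \det (ulsubmx J - ursubmx J *m mxinv (drsubmx J) *m dlsubmx J)
  * \det (mxinv (drsubmx J)).

(* The Jacobian matrix d x'^b / d x^a (row a, column b) of the coordinates x'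
   of c' with respect to the coordinates x of c. *)
Definition jac (R : realType) (M : topologicalType) (X : superspace R M)
    (n m : nat) (c c' : chart X n m) (U : opens M) : 'M[X U]_(n + m) :=
  \matrix_(a, b) pd c a (res U (coord c' b)).

Record atlas (R : realType) (M : topologicalType) (X : superspace R M)
    (n m : nat) := Atlas {
  aidx : Type;
  ach :> aidx -> chart X n m;
  atlas_cover : forall x : M, exists i, oset (cdom (ach i)) x;
  atlas_pos : forall i j, spositive (ach i)
    (Ber (jac (ach i) (ach j) (oI (cdom (ach i)) (cdom (ach j)))))
}.

(* ** Densities and operators on them *)

Section Densities.
Variables (R : realType) (M : topologicalType) (X : superspace R M).
Variables (n m : nat) (A : atlas X n m).
Implicit Types (eps : bool) (w : R) (W : opens M) (i j : aidx A).

Definition dom i : opens M := cdom (A i).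

(* A density psi_i (Dx_i)^w of weight w over W: as
   Dx_j = Ber (d x_j / d x_i) Dx_i, its coefficients transform by
   psi_i = psi_j Ber (d x_j / d x_i)^w. *)
Record density w W := Density {
  dcoef :> forall i, X (oI W (dom i));
  density_change : forall i j,
    let V := oI W (oI (dom i) (dom j)) in
    res V (dcoef i) = res V (dcoef j) * spow (A i) (Ber (jac (A i) (A j) V)) w
}.

(* Operators act on the sheaf of densities of weight w; for those of the
   differential form below, compatibility with restrictions is automatic. *)
Definition operator w := forall W, density w W -> density w W.

Definition volume_form (rho : density 1 (oT M)) : Prop :=
  forall i, spar X false (rho i) /\ snonvanishing (A i) (rho i).

(* Coefficients, with respect to each coordinate system of the atlas. *)
Definition fun_coefs := forall i, X (dom i).
Definition vec_coefs := forall i, 'I_(n + m) -> X (dom i).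
Definition tens_coefs := forall i, 'I_(n + m) -> 'I_(n + m) -> X (dom i).

Definition par0 eps (F : fun_coefs) : Prop := forall i, spar X eps (F i).
Definition par1 eps (T : vec_coefs) : Prop :=
  forall i a, spar X (eps (+) ipar a) (T i a).

(* S^{ab} = (-1)^{ab} S^{ba}, of parity eps + a + b *)
Definition sym2 eps (S : tens_coefs) : Prop :=
  forall i a b, spar X (eps (+) ipar a (+) ipar b) (S i a b) /\
                S i a b = (-1) ^+ (ipar a && ipar b) * S i b a.

(* Q_j^b = Q_i^a d x_j^b / d x_i^a *)
Definition vector_field eps (Q : vec_coefs) : Prop :=
  par1 eps Q /\
  forall i j b, let V := oI (dom i) (dom j) in
    res V (Q j b) = \sum_a res V (Q i a) * jac (A i) (A j) V a b.

(* (-1)^{a(eps+1)} *)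
Definition sgn eps (a : 'I_(n + m)) (U : opens M) : X U :=
  (-1) ^+ (ipar a && ~~ eps).

(* 1/2 S^{ab} d_b d_a + T^a d_a + F *)
Definition op2 i U (S : 'I_(n + m) -> 'I_(n + m) -> X U)
    (T : 'I_(n + m) -> X U) (F psi : X U) : X U :=
  cst X (2^-1) * (\sum_a \sum_b S a b * pd (A i) b (pd (A i) a psi))
  + \sum_a T a * pd (A i) a psi + F * psi.

Definition second_order eps w0 (S : tens_coefs) (L : operator w0) : Prop :=
  sym2 eps S /\
  exists (T : vec_coefs) (F : fun_coefs), par1 eps T /\ par0 eps F /\
    forall i W (psi : density w0 W), let V := oI W (dom i) in
      L W psi i = op2 i (fun a b => res V (S i a b)) (fun a => res V (T i a))
                    (res V (F i)) (psi i).

Definition pencil_loc eps w i U (S : 'I_(n + m) -> 'I_(n + m) -> X U)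
    (gamma : 'I_(n + m) -> X U) (theta psi : X U) : X U :=
  cst X (2^-1) *
  (\sum_a \sum_b S a b * pd (A i) b (pd (A i) a psi)
   + \sum_a (\sum_b pd (A i) b (S b a) * sgn eps b U
             + cst X (2 * w - 1) * gamma a) * pd (A i) a psi
   + cst X w * (\sum_a pd (A i) a (gamma a) * sgn eps a U) * psi
   + cst X (w * (w - 1)) * theta * psi).

Definition canonical_pencil eps (D : forall w, operator w) : Prop :=
  exists (S : tens_coefs) (gamma : vec_coefs) (theta : fun_coefs),
    sym2 eps S /\ par1 eps gamma /\ par0 eps theta /\
    forall w i W (psi : density w W), let V := oI W (dom i) in
      D w W psi i =
        pencil_loc eps w i (fun a b => res V (S i a b))
          (fun a => res V (gamma i a)) (res V (theta i)) (psi i).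

(* Local expression of the Laplace-Beltrami pencil. The powers of rho are taken
   of |rho|: if rho is negative, the constant phases of rho^(w-1), rho and
   rho^-w cancel out. *)
Definition LB_loc eps w i U (S : 'I_(n + m) -> 'I_(n + m) -> X U)
    (rho psi : X U) : X U :=
  cst X (2^-1) *
  \sum_a spow (A i) rho (w - 1) *
    pd (A i) a (spow (A i) rho 1 *
                \sum_b S a b * pd (A i) b (spow (A i) rho (- w) * psi))
    * sgn eps a U.

(* Lie derivative of densities of weight w along Q of parity eps *)
Definition lie_loc eps w i U (Q : 'I_(n + m) -> X U) (psi : X U) : X U :=
  \sum_a Q a * pd (A i) a psi
  + cst X w * (\sum_a pd (A i) a (Q a) * sgn eps a U) * psi.

(* D = Delta^LB_w + s L_Q + t f on densities of weight w, where Delta^LB is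
   associated with S and rho *)
Definition is_LB_lie_fun eps w (s t : R) (S : tens_coefs) (rho : density 1 (oT M))
    (Q : vec_coefs) (f : X (oT M)) (D : operator w) : Prop :=
  forall i W (psi : density w W), let V := oI W (dom i) in
    D W psi i =
      LB_loc eps w i (fun a b => res V (S i a b)) (res V (rho i)) (psi i)
      + cst X s * lie_loc eps w i (fun a => res V (Q i a)) (psi i)
      + cst X t * res V f * psi i.

End Densities.

(* Main.v *)
From HB Require Import structures.
From Stdlib Require Ncring Ncring_tac.
From mathcomp Require Import all_boot all_order all_algebra.
From mathcomp Require Import ring lra zify perm.
From mathcomp Require Import all_classical all_reals all_analysis.
Require Import Defs.
Set Implicit Arguments.
Unset Strict Implicit.
Unset Printing Implicit Defensive.
Import Order.TTheory GRing.Theory Num.Theory.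
Import numFieldNormedType.Exports.
Local Open Scope classical_set_scope.
Local Open Scope ring_scope.

(** In one chart, comparing a second order operator S d d / 2 + T d + R with a
    member of a pencil leaves two linear equations,
    2T = div S + (2w0 - 1) gamma and 2R = w0 div gamma + w0(w0 - 1) theta. They
    have exactly one solution (gamma, theta) when w0 is not 0, 1 or 1/2
    (pencil_of), and an operator determines its coefficients (op2_inj), so the
    pencil through L is unique in each chart. It remains to see that the
    operators obtained in the charts agree on overlaps at every weight. For this,
    one shows that a pencil written in the coordinates of one chart is a pencil
    in the coordinates of any other, with coefficients which do not depend on the
    weight (pencil_change). At weight w0 the operators of the two charts are both
    L, hence the two sets of coefficients agree, and then the operators agree at
    all weights (form_change).

    The heart of pencil_change is that the operator
    S^{ab} d_b d_a + (div S)^a d_a changes by the contraction of S with the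
    logarithmic derivative of the Berezinian (lap_change), while conjugation by
    the w-th power of the Berezinian produces the factors 2w - 1 and w(w - 1)
    (lap_gauge). The same conjugation, with a volume form in place of the
    Berezinian, shows that the Laplace-Beltrami operators form a pencil
    (LB_pencil). The explicit formula follows: its right hand side has the
    local form of a pencil (LB_lie_pencil) and equals L at w0.

    These computations rest on calculus over superdomains, developed from the
    definitions. By Hadamard's lemma a derivation is determined by its values on
    the coordinates (lder_coord0), whence the chain rule and the supersymmetry of
    second derivatives. Real powers of even sections and the Berezinian are
    controlled by a uniqueness principle: a Grassmann-valued function which solves
    a first order linear system along the odd coordinates is determined by its
    body (odd_unique). The laws of powers reduce in this way to those of positive
    real numbers, and the cocycle property of the Berezinian (ber_cocycle) to the
    multiplicativity of determinants, once its logarithmic derivative is known to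
    be a divergence (pd_ber). The cocycle provides densities with prescribed
    coefficients in a chart (density_onto), on which operators are tested. *)

(** * Noncommutative ring identities *)

(** Sections only commute up to signs. Their identities are proved by
    noncommutative normalization, after the few commutations which hold have been
    made explicit. *)
Section NcRing.
Variable A : pzRingType.

#[global] Instance pzRing_ops : @Ncring.Ring_ops A 0 1 +%R *%R (fun x y => x - y) -%R eq := {}.

#[global] Instance pzRing_ring : Ncring.Ring (Ro := pzRing_ops).
Proof.
split; cbn.
- exact: RelationClasses.eq_equivalence.
- by move=> ? ? -> ? ? ->.
- by move=> ? ? -> ? ? ->.
- by move=> ? ? -> ? ? ->.
- by move=> ? ? ->.
- exact: add0r.
- exact: addrC.
- exact: addrA.
- exact: mul1r.
- exact: mulr1.
- exact: mulrA.
- exact: mulrDl.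
- by move=> x y z; exact: mulrDr.
- by [].
- exact: subrr.
Qed.
End NcRing.

Ltac nc_ring := Ncring_tac.non_commutative_ring.

(** * Functions of class C^k *)

Section CkTheory.
Variables (R : realType) (n : nat).
Implicit Types (V W : set 'rV[R]_n) (f g : 'rV[R]_n -> R) (y : 'rV[R]_n).

Lemma Ck_cont k V g y : Ck k V g -> V y -> {for y, continuous g}.
Proof. by case: k => [|k] [+ _]; apply. Qed.

Lemma Ck_derivable k V g y (i : 'I_n) :
  Ck k.+1 V g -> V y -> derivable g y (delta_mx 0 i).
Proof. by move=> [_ /(_ i)[+ _]]; apply. Qed.

Lemma Ck_derive k V g (i : 'I_n) :
  Ck k.+1 V g -> Ck k V (fun y => 'D_(delta_mx 0 i) g y).
Proof. by move=> [_ /(_ i)[]]. Qed.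

Lemma Ck_pred k V g : Ck k.+1 V g -> Ck k V g.
Proof.
elim: k g => [|k IH] g; first by move=> [].
move=> [cg dg]; split => // i; have [h1 h2] := dg i; split => //.
exact: IH.
Qed.

(** The class of a function is a local matter; this is what lets the sign of a
    nonvanishing function, which is only locally constant, be treated as smooth. *)
Lemma Ck_near k V g : open V ->
  (forall y, V y -> exists W h, [/\ open W, W y, Ck k W h &
      forall z, W z -> h z = g z]) ->
  Ck k V g.
Proof.
move=> oV; elim: k g => [|k IH] g H.
  split => // y /H[W [h [oW Wy [ch _] hg]]].
  have hgn : {near y, h =1 g} by apply: filterS (open_nbhs_nbhs (conj oW Wy)).
  move: (ch _ Wy); rewrite /prop_for /continuous_at -(hg _ Wy) => chy.
  exact: cvg_trans (near_eq_cvg hgn) chy.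
have nbd (y : 'rV[R]_n) W h : open W -> W y -> (forall z, W z -> h z = g z) -> {near y, h =1 g}.
  by move=> oW Wy hg; apply: filterS (open_nbhs_nbhs (conj oW Wy)).
split => [y /H[W [h [oW Wy ch hg]]]|i].
  have := Ck_cont ch Wy; rewrite /prop_for /continuous_at -(hg _ Wy) => chy.
  exact: cvg_trans (near_eq_cvg (nbd _ _ _ oW Wy hg)) chy.
split => [y /H[W [h [oW Wy ch hg]]]|].
  exact: near_eq_derivable (nbd _ _ _ oW Wy hg) (Ck_derivable ch Wy).
apply: IH => y /H[W [h [oW Wy ch hg]]].
exists W, (fun y => 'D_(delta_mx 0 i) h y); split => //; first exact: Ck_derive.
by move=> z Wz; exact: near_eq_derive (nbd _ _ _ oW Wz hg).
Qed.

Lemma Ck_ext k V f g : open V -> (forall y, V y -> f y = g y) ->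
  Ck k V f -> Ck k V g.
Proof. by move=> oV fg cf; apply: Ck_near => // y Vy; exists V, f. Qed.

Lemma Ck_cst k V (r : R) : Ck k V (fun=> r).
Proof.
elim: k r => [|k IH] r; (split; first by move=> y _; exact: cst_continuous) => //.
move=> i; split; first by move=> y _; exact: derivable_cst.
have -> : (fun y : 'rV[R]_n => 'D_(delta_mx 0 i) (fun=> r) y) = fun=> 0.
  by apply/funext => y; exact: derive_cst.
exact: IH.
Qed.

Lemma CkD k V f g : open V -> Ck k V f -> Ck k V g -> Ck k V (fun y => f y + g y).
Proof.
move=> oV; elim: k f g => [|k IH] f g cf cg.
  by split => // y Vy; exact: (cvgD (Ck_cont cf Vy) (Ck_cont cg Vy)).
split => [y Vy|i].
  by exact: (cvgD (Ck_cont cf Vy) (Ck_cont cg Vy)).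
split => [y Vy|].
  by apply: derivableD; [exact: (Ck_derivable cf Vy)|exact: (Ck_derivable cg Vy)].
apply: (Ck_ext oV _ (IH _ _ (Ck_derive i cf) (Ck_derive i cg))) => y Vy.
by rewrite deriveD //; [exact: (Ck_derivable cf Vy)|exact: (Ck_derivable cg Vy)].
Qed.

Lemma CkM k V f g : open V -> Ck k V f -> Ck k V g -> Ck k V (fun y => f y * g y).
Proof.
move=> oV; elim: k f g => [|k IH] f g cf cg.
  by split => // y Vy; exact: (cvgM (Ck_cont cf Vy) (Ck_cont cg Vy)).
split => [y Vy|i].
  by exact: (cvgM (Ck_cont cf Vy) (Ck_cont cg Vy)).
split => [y Vy|].
  by apply: derivableM; [exact: (Ck_derivable cf Vy)|exact: (Ck_derivable cg Vy)].
apply: (Ck_ext oV _ (CkD oV (IH _ _ (Ck_pred cf) (Ck_derive i cg))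
  (IH _ _ (Ck_pred cg) (Ck_derive i cf)))) => y Vy.
by rewrite deriveM //; [exact: (Ck_derivable cf Vy)|exact: (Ck_derivable cg Vy)].
Qed.

Lemma CkZ k V (r : R) f : open V -> Ck k V f -> Ck k V (fun y => r * f y).
Proof. by move=> oV cf; apply: CkM => //; exact: Ck_cst. Qed.

(** Directional derivatives are derivatives along a line, where the chain rule
    in one variable applies. *)
Lemma is_derive_line f y v (k : R) : derivable f (k *: v + y) v ->
  is_derive k 1 (fun h : R => f (h *: v + y)) ('D_v f (k *: v + y)).
Proof.
rewrite /derivable /derive; set g2 := fun h => h^-1 *: _ => df.
have E : (fun h : R => h^-1 *: (((fun h0 : R => f (h0 *: v + y)) \o shift k) (h *: 1)
    - f (k *: v + y))) = g2.
  by rewrite funeqE /g2 => h /=; rewrite [_%:A]mulr1 scalerDl addrA.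
by split; rewrite ?/derivable ?/derive E.
Qed.

Lemma derive1_line f y v : 'D_1 (fun h : R => f (h *: v + y)) (0 : R) = 'D_v f y.
Proof.
rewrite /derive; set g1 := fun h => h^-1 *: _; set g2 := fun h => h^-1 *: _.
suff -> : g1 = g2 by [].
by rewrite funeqE /g1 /g2 => h /=; rewrite addr0 scale0r add0r [_%:A]mulr1.
Qed.

Lemma derive_powR g (s : R) y v : 0 < g y -> derivable g y v ->
  is_derive y v (fun z => g z `^ s) (s * g y `^ (s - 1) * 'D_v g y).
Proof.
move=> gy0 dg.
have dg1 : is_derive (0 : R) 1 (fun h : R => g (h *: v + y)) ('D_v g y).
  split; first exact: ((derivable1P g y v).1 dg).
  exact: derive1_line.
have gy0' : 0 < g ((0 : R) *: v + y) by rewrite scale0r add0r.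
have [d2 E2] := is_derive1_comp (is_derive1_powR s gy0') dg1.
split; first exact: (derivable1P (fun z : 'rV[R]_n => g z `^ s) y v).2 d2.
by rewrite -derive1_line; move: E2; rewrite scale0r add0r => <-.
Qed.

(** The derivative of a power is again a power times a derivative, so the
    induction on k has to run over all exponents at once. *)
Lemma Ck_powR k V g (s : R) : open V -> (forall y, V y -> 0 < g y) ->
  Ck k V g -> Ck k V (fun y => g y `^ s).
Proof.
move=> oV g0.
have cont s' (y : 'rV[R]_n) : 0 < g y -> {for y, continuous g} ->
    {for y, continuous (fun y => g y `^ s')}.
  move=> gy cg; have [d _] := is_derive1_powR s' gy.
  have /derivable1_diffP/differentiable_continuous := d.
  exact: (@continuous_comp _ _ _ g (fun x : R => x `^ s') y cg).
elim: k s => [|k IH] s cg.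
  by split => // y Vy; apply: cont; [exact: g0|exact: (Ck_cont cg Vy)].
split => [y Vy|i].
  by apply: cont; [exact: g0|exact: (Ck_cont cg Vy)].
have D (y : 'rV[R]_n) (Vy : V y) :=
  derive_powR s (g0 _ Vy) (Ck_derivable (i := i) cg Vy).
split => [y Vy|]; first by have [] := D y Vy.
have H := CkM oV (CkZ s oV (IH (s - 1) (Ck_pred cg))) (Ck_derive i cg).
by apply: (Ck_ext oV _ H) => y Vy; have [_ ->] := D y Vy.
Qed.

Lemma is_derive_coord y (i l : 'I_n) :
  is_derive y (delta_mx 0 i) (fun z : 'rV[R]_n => z 0 l) (l == i)%:R.
Proof.
have E : (fun h : R => (h *: delta_mx 0 i + y) 0 l) =
    (fun h => (l == i)%:R *: h + y 0 l).
  by apply/funext => h; rewrite !mxE eqxx /= mulrC.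
have d : is_derive (0 : R) 1 (fun h : R => (h *: delta_mx 0 i + y) 0 l) (l == i)%:R.
  rewrite E; have := is_deriveD (is_deriveZ ((l == i)%:R : R) (is_derive_id (0 : R) 1))
    (is_derive_cst (y 0 l) (0 : R) 1).
  by rewrite addr0 [_%:A]mulr1.
have [d1 d2] := d; split; last by rewrite -derive1_line.
exact: (derivable1P (fun z : 'rV[R]_n => z 0 l) y _).2.
Qed.

Lemma Ck_coord k V (l : 'I_n) : open V -> Ck k V (fun z => z 0 l).
Proof.
move=> oV.
have c (y : 'rV[R]_n) : V y -> {for y, continuous (fun z : 'rV[R]_n => z 0 l)}.
  by move=> _; exact: coord_continuous.
case: k => [|k]; split=> // i; split; first by move=> y _; have [] := is_derive_coord y i l.
apply: (Ck_ext oV _ (Ck_cst k V (l == i)%:R)) => y _.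
by have [_ ->] := is_derive_coord y i l.
Qed.

End CkTheory.

(** * Hadamard's lemma *)

Section Hadamard.
Variables (R : realType) (n : nat) (y0 : 'rV[R]_n) (r : R).
Local Notation V := (ball y0 r).
Local Notation mu := (@lebesgue_measure R).
Local Notation I01 := (`[0, 1]%classic : set R).

Lemma ball_rowE (y z : 'rV[R]_n) (e : R) :
  ball y e z <-> (forall l, `|y 0 l - z 0 l| < e) /\ 0 < e.
Proof.
split => [h|[h e0]]; last by split=> // i l; rewrite ord1; exact: h.
by split; [move=> l; apply: h.2|case: h].
Qed.

Section Scaling.
Variable c : R -> 'I_n -> R.
Hypothesis cc : forall l, continuous (c^~ l).
Hypothesis c01 : forall t l, I01 t -> 0 <= c t l <= 1.

(** A scaling towards y0 with its own factor for each coordinate. *)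
Definition scal t (z : 'rV[R]_n) : 'rV[R]_n :=
  \row_l (y0 0 l + c t l * (z 0 l - y0 0 l)).

Lemma scal_ball t z : I01 t -> V z -> V (scal t z).
Proof.
move=> t01 /ball_rowE[zV r0]; apply/ball_rowE; split => // l; rewrite mxE.
have /andP[c0 c1] := c01 l t01.
rewrite opprD addrA subrr add0r normrN normrM ger0_norm //.
apply: le_lt_trans (zV l); rewrite distrC ler_piMl //.
Qed.

Lemma scal_cont t z :
  scal x.1 x.2 @[x --> (t, z)] --> scal t z.
Proof.
have Hl l : (fun x : R * 'rV[R]_n => (scal x.1 x.2) 0 l) x @[x --> (t, z)]
    --> (scal t z) 0 l.
  under eq_fun do rewrite mxE.
  rewrite mxE; apply: cvgD; first exact: cvg_cst.
  apply: cvgM.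
    by apply: (@continuous_comp _ _ _ fst (c^~ l) (t, z)); [exact: cvg_fst|exact: cc].
  apply: cvgB; last exact: cvg_cst.
  apply: (@continuous_comp _ _ _ snd (fun z : 'rV[R]_n => z 0 l) (t, z)).
    exact: cvg_snd.
  exact: coord_continuous.
apply/cvg_ballP => e e0.
have H l : \forall x \near (t, z), ball ((scal t z) 0 l) e ((scal x.1 x.2) 0 l).
  by move/cvg_ballP : (Hl l); exact.
have F : Filter (nbhs (t, z)) by exact: nbhs_filter.
by apply: filterS (filter_forall F H) => x {}H; apply/ball_rowE.
Qed.

Lemma scal_line t h i z :
  scal t (h *: delta_mx 0 i + z) = (c t i * h) *: delta_mx 0 i + scal t z.
Proof.
apply/rowP => l; rewrite !mxE eqxx /=; have [->|_] /= := eqVneq l i; rewrite ?mulr1n ?mulr0n; ring.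
Qed.

Section Integral.
Variable phi : R -> R.
Hypothesis phic : continuous phi.

(** The quotients in Hadamard's lemma are integrals of partial derivatives along
    scalings. The weight phi is there because differentiating under the integral
    sign produces the factors c t i, so that this family of integrals is closed
    under partial derivatives. *)
Definition scal_int (g : 'rV[R]_n -> R) (z : 'rV[R]_n) : R :=
  (\int[mu]_(t in I01) (phi t * g (scal t z)))%R.

Variable g : 'rV[R]_n -> R.
Hypothesis gc : forall y, V y -> {for y, continuous g}.

Lemma scal_cont2 t z : I01 t -> V z ->
  (fun x : R * 'rV[R]_n => phi x.1 * g (scal x.1 x.2)) x @[x --> (t, z)]
    --> phi t * g (scal t z).
Proof.
move=> t01 Vz; apply: cvgM.
  by apply: (@continuous_comp _ _ _ fst phi (t, z)); [exact: cvg_fst|exact: phic].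
apply: (@continuous_comp _ _ _ (fun x : R * 'rV[R]_n => scal x.1 x.2) g (t, z)).
  exact: scal_cont.
exact: gc (scal_ball t01 Vz).
Qed.

Lemma scal_cont1 t z : I01 t -> V z ->
  {for t, continuous (fun t => phi t * g (scal t z))}.
Proof.
move=> t01 Vz; apply: (@continuous_comp _ _ _ (fun t => (t, z))
  (fun x : R * 'rV[R]_n => phi x.1 * g (scal x.1 x.2)) t).
  exact: (cvg_pair (@cvg_id _ _) (@cvg_cst _ _ _ _ _)).
exact: scal_cont2.
Qed.

Lemma scal_integrable z : V z ->
  mu.-integrable I01 (EFin \o (fun t => phi t * g (scal t z))).
Proof.
move=> Vz; apply: continuous_compact_integrable; first exact: segment_compact.
apply: continuous_in_subspaceT => t /set_mem t01; exact: scal_cont1.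
Qed.

(** Uniformity in t comes from the compactness of the interval of integration. *)
Lemma scal_unif y e : V y -> 0 < e ->
  \forall z \near y, forall t, I01 t ->
    `|phi t * g (scal t z) - phi t * g (scal t y)| < e.
Proof.
move=> Vy e0.
have /compact_near_coveringP := @segment_compact R 0 1.
move=> /(_ 'rV[R]_n (nbhs y)
  (fun z t => `|phi t * g (scal t z) - phi t * g (scal t y)| < e)); apply.
move=> t t01.
have e20 : 0 < e / 2 by rewrite divr_gt0.
have /cvgrPdist_lt/(_ _ e20) H2 := scal_cont2 t01 Vy.
have /cvgrPdist_lt/(_ _ e20) H1 := scal_cont1 t01 Vy.
have H1' : \forall x \near (t, y),
    `|phi t * g (scal t y) - phi x.1 * g (scal x.1 y)| < e / 2.
  exact: (@cvg_fst _ _ (nbhs t) (nbhs y) _ _ H1).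
apply: filterS2 H2 H1' => -[t' z] /= H2 H1'.
rewrite (_ : _ - _ = (phi t * g (scal t y) - phi t' * g (scal t' y)) -
  (phi t * g (scal t y) - phi t' * g (scal t' z))); last by ring.
by apply: le_lt_trans (ler_normB _ _) _; rewrite [e]splitr ltrD.
Qed.

Lemma scal_int_cont y : V y -> {for y, continuous (scal_int g)}.
Proof.
move=> Vy; apply: (proj2 (@cvgrPdist_lt _ R^o _ (nbhs y) (nbhs_filter y) _ _)) => e e0.
have e20 : 0 < e / 2 by rewrite divr_gt0.
have nV : \forall z \near y, V z by apply: open_nbhs_nbhs; split=> //; exact: ball_open.
apply: filterS2 nV (scal_unif Vy e20) => z Vz H.
have intB : mu.-integrable I01
    (EFin \o (fun t => phi t * g (scal t y) - phi t * g (scal t z))).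
  by apply: (integrableB _ (scal_integrable Vy) (scal_integrable Vz)).
rewrite /scal_int -RintegralB //; [|exact: scal_integrable..].
apply: le_lt_trans (le_normr_Rintegral _ _) _ => //.
apply: (@le_lt_trans _ _ (\int[mu]_(t in I01) (e / 2))%R).
  apply: le_Rintegral => //.
  - exact: integrable_norm intB.
  - apply: continuous_compact_integrable; first exact: segment_compact.
    by apply: continuous_subspaceT => ?; exact: cvg_cst.
  - by move=> t t01; rewrite distrC ltW // H.
rewrite Rintegral_cst //= lebesgue_measure_itv /= lte01 oppr0 adde0 /= mulr1.
by rewrite ltr_pdivrMr // mulr2n mulrDr mulr1 ltrDr.
Qed.

End Integral.

(** Differentiation under the integral sign; the integrands of nearby points are
    dominated by the absolute value of the one at y plus 1. *)
Lemma scal_int_derive phi g i y : continuous phi -> V y ->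
  (forall y, V y -> {for y, continuous g}) ->
  (forall y, V y -> derivable g y (delta_mx 0 i)) ->
  (forall y, V y -> {for y, continuous (fun y => 'D_(delta_mx 0 i) g y)}) ->
  is_derive y (delta_mx 0 i) (scal_int phi g)
    (scal_int (fun t => phi t * c t i) (fun y => 'D_(delta_mx 0 i) g y) y).
Proof.
move=> phic Vy gc dg dgc; set e := delta_mx 0 i; set phi' := fun t => _.
have phic' : continuous phi' by move=> t; apply: cvgM; [exact: phic|exact: cc].
pose f h t := phi t * g (scal t (h *: e + y)).
have fd x t : I01 t -> V (x *: e + y) -> is_derive x (1 : R) (f ^~ t)
    (phi' t * 'D_e g (scal t (x *: e + y))).
  move=> t01 Vx; have Vs := scal_ball t01 Vx.
  have d1 := dg _ Vs; rewrite scal_line in d1.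
  have d2 := is_derive_line d1.
  have d3 : is_derive x (1 : R) (fun h : R => c t i * h) (c t i).
    have := is_deriveZ (c t i) (is_derive_id x (1 : R)).
    by rewrite [_%:A]mulr1.
  have d4 : is_derive (c t i * x) 1 (fun k : R => g (k *: e + scal t y))
      ('D_e g (scal t (x *: e + y))) by rewrite scal_line.
  have d5 := is_deriveZ (phi t)
    (@is_derive1_comp R (fun k => g (k *: e + scal t y)) (fun h => c t i * h) _ _ _ d4 d3).
  rewrite /f (_ : (fun h => _) =
      (fun h : R => phi t * g ((c t i * h) *: e + scal t y))); last first.
    by apply/funext => h; rewrite scal_line.
  rewrite (_ : phi' t * _ = phi t * ('D_e g (scal t (x *: e + y)) * c t i)) //.
  by rewrite /phi'; ring.
have line_cont : (fun h : R => h *: e + y) h @[h --> 0] --> y.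
  rewrite -[X in _ --> X]add0r -(scale0r e); apply: cvgD; last exact: cvg_cst.
  by apply: cvgZr_tmp; exact: cvg_id.
have nV : \forall z \near y, V z.
  by apply: open_nbhs_nbhs; split=> //; exact: ball_open.
have near0 : \forall h \near (0 : R), V (h *: e + y) /\ (forall t, I01 t ->
    `|phi' t * 'D_e g (scal t (h *: e + y)) - phi' t * 'D_e g (scal t y)| < 1).
  exact: line_cont _ (filterI nV (scal_unif phic' dgc Vy ltr01)).
have [d /= d0 Hd] := (nbhs_ballP _ _).1 near0.
have Hd' x : `]-d, d[%classic x -> ball (0 : R) d x.
  by move=> /=; rewrite in_itv /= -ltr_norml /ball /= sub0r normrN.
have I0 : `]-d, d[%classic (0 : R) by rewrite /= in_itv /= oppr_lt0 d0.
pose G t := `|phi' t * 'D_e g (scal t y)| + 1.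
have iG : mu.-integrable I01 (EFin \o G).
  have i1 : mu.-integrable I01 (EFin \o (fun=> 1)).
    apply: (@continuous_compact_integrable R (fun=> 1)); first exact: segment_compact.
    by apply: continuous_subspaceT => ?; exact: cvg_cst.
  exact: (integrableD _ (integrable_norm (scal_integrable phic' dgc Vy)) i1).
have intf x : `]-d, d[%classic x -> mu.-integrable I01 (EFin \o f x).
  by move=> /Hd'/Hd[Vx _]; exact: scal_integrable.
have derf x t : `]-d, d[%classic x -> I01 t -> derivable (f ^~ t) x 1.
  by move=> /Hd'/Hd[Vx _] t01; have [] := fd x t t01 Vx.
have G0 t : 0 <= G t by rewrite addr_ge0.
have Gub x t : `]-d, d[%classic x -> I01 t -> `|partial1of2 f x t| <= G t.
  move=> /Hd'/Hd[Vx Ux] t01; rewrite partial1of2E; have [_ ->] := fd x t t01 Vx.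
  rewrite -[X in `|X|](subrK (phi' t * 'D_e g (scal t y))).
  apply: le_trans (ler_normD _ _) _; rewrite addrC lerD2l; exact: ltW (Ux t t01).
have D1 := derivable_under_integral _ I0 intf derf G0 iG Gub.
have D2 := differentiation_under_integral _ I0 intf derf G0 iG Gub.
split.
  by apply: (derivable1P (scal_int phi g) y e).2; apply: D1.
rewrite -derive1_line -derive1E [LHS]D2 //.
apply: eq_Rintegral => t /set_mem t01; rewrite partial1of2E.
have V0 : V ((0 : R) *: e + y) by rewrite scale0r add0r.
by have [_ ->] := fd 0 t t01 V0; rewrite scale0r add0r.
Qed.

Lemma scal_int_Ck k phi g : continuous phi -> Ck k V g -> Ck k V (scal_int phi g).
Proof.
have oV : open V by exact: ball_open.
elim: k phi g => [|k IH] phi g phic cg.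
  by split=> // y Vy; apply: scal_int_cont => // z Vz; apply: (Ck_cont cg).
split=> [y Vy|i].
  by apply: scal_int_cont => // z Vz; apply: (Ck_cont cg).
have D (y : 'rV[R]_n) (Vy : V y) : is_derive y (delta_mx 0 i) (scal_int phi g)
    (scal_int (fun t => phi t * c t i) (fun y => 'D_(delta_mx 0 i) g y) y).
  apply: scal_int_derive => // z Vz; first exact: (Ck_cont cg).
    exact: (Ck_derivable cg).
  exact: (Ck_cont (Ck_derive i cg)).
split=> [y Vy|]; first by have [] := D y Vy.
have H : Ck k V (scal_int (fun t => phi t * c t i) (fun y => 'D_(delta_mx 0 i) g y)).
  apply: IH; last exact: Ck_derive.
  by move=> t; apply: cvgM; [exact: phic|exact: cc].
by apply: (Ck_ext oV _ H) => y Vy; have [_ ->] := D y Vy.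
Qed.

End Scaling.

(** The leg from y0 to y along the k-th axis: the earlier coordinates have
    reached y, the later ones are still those of y0. *)
Definition had_scale (k : nat) (t : R) (l : 'I_n) : R :=
  if (l < k)%N then 1 else if l == k :> nat then t else 0.

Lemma had_scale_cont k l : continuous (had_scale k ^~ l).
Proof.
rewrite /had_scale; case: (_ < _)%N; first by move=> t; exact: cvg_cst.
by case: (_ == _); move=> t; [exact: cvg_id|exact: cvg_cst].
Qed.

Lemma had_scale01 k t l : I01 t -> 0 <= had_scale k t l <= 1.
Proof.
rewrite /= in_itv /= /had_scale => t01; case: (_ < _)%N; first by rewrite ler01 lexx.
by case: (_ == _); rewrite ?ler01 ?lexx.
Qed.

Definition had_pt (k : nat) (y : 'rV[R]_n) : 'rV[R]_n :=
  \row_l if (l < k)%N then y 0 l else y0 0 l.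

Lemma had_scal_line (k : 'I_n) t y :
  scal (had_scale k) t y = (t * (y 0 k - y0 0 k)) *: delta_mx 0 k + had_pt k y.
Proof.
apply/rowP => l; rewrite !mxE eqxx /= /had_scale.
have [->|ne] := eqVneq l k.
  by rewrite ltnn eqxx /= ?mulr1n; ring.
have -> : (l == k :> nat) = false by apply/negbTE.
by case: ifP => _; rewrite /= ?mulr0n; ring.
Qed.

Lemma hadamard_step g (k : 'I_n) y : V y -> Ck 1 V g ->
  g (had_pt k.+1 y) - g (had_pt k y) = (y 0 k - y0 0 k) *
    scal_int (had_scale k) (fun=> 1) (fun y => 'D_(delta_mx 0 k) g y) y.
Proof.
move=> Vy cg; set e := delta_mx 0 k; set a := y 0 k - y0 0 k.
have cc := @had_scale_cont k; have c01 := @had_scale01 k.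
pose F t := g (scal (had_scale k) t y).
have gc (z : 'rV[R]_n) : V z -> {for z, continuous g} by move=> Vz; exact: (Ck_cont cg).
have dgc (z : 'rV[R]_n) : V z -> {for z, continuous (fun y => 'D_e g y)}.
  by move=> Vz; exact: (Ck_cont (Ck_derive k cg)).
have c1 : continuous (fun _ : R => 1 : R) by move=> t; exact: cvg_cst.
have Fd t : I01 t -> is_derive t (1 : R) F (a * 'D_e g (scal (had_scale k) t y)).
  move=> t01; have Vs := scal_ball c01 t01 Vy.
  have d1 : derivable g (scal (had_scale k) t y) e by exact: (Ck_derivable cg).
  rewrite had_scal_line in d1 *.
  have d2 := is_derive_line d1.
  have d3 : is_derive t (1 : R) (fun h : R => h * a) a.
    have := is_deriveZ a (is_derive_id t (1 : R)).
    rewrite [_%:A]mulr1; congr (is_derive _ _ _ _).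
    by apply/funext => h; rewrite /= mulrC.
  have := @is_derive1_comp R (fun h => g (h *: e + had_pt k y)) (fun h => h * a)
    _ _ _ d2 d3.
  rewrite mulrC; congr (is_derive _ _ _ _).
  by apply/funext => h; rewrite /F had_scal_line.
have Fc t : I01 t -> {for t, continuous F}.
  move=> t01; have [/derivable1_diffP/differentiable_continuous + _] := Fd t t01.
  exact.
have i1 := scal_integrable cc c01 c1 dgc Vy.
rewrite /scal_int -RintegralZl //.
have E : (\int[mu]_(t in I01) (a * 'D_e g (scal (had_scale k) t y))%:E =
    (F 1)%:E - (F 0)%:E)%E.
  apply: continuous_FTC2 => //.
  - apply: continuous_in_subspaceT => t /set_mem t01.
    have := scal_cont1 cc c01 (phi := fun=> a) _ dgc t01 Vy; apply.
    by move=> ?; exact: cvg_cst.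
  - split.
    + by move=> t t01; have [] // := Fd t; apply: subset_itv_oo_cc.
    + apply: cvg_at_right_filter; apply: Fc; by rewrite /= in_itv /= lexx ler01.
    + apply: cvg_at_left_filter; apply: Fc; by rewrite /= in_itv /= lexx ler01.
  - move=> t t01; rewrite derive1E; have [] // := Fd t; exact: subset_itv_oo_cc.
transitivity (F 1 - F 0).
  rewrite /F; congr (g _ - g _); apply/rowP => l; rewrite !mxE /had_scale.
    rewrite ltnS leq_eqVlt; case: ifP => [|/negbT]; last first.
      by rewrite negb_or => /andP[/negPf-> /negPf->]; ring.
    by case/orP => [/eqP->|->]; rewrite ?ltnn ?eqxx ?if_same; ring.
  by case: ifP => _; rewrite ?if_same; ring.
rewrite /Rintegral; under eq_integral do rewrite mul1r.
by rewrite E.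
Qed.

(** Walking from y0 to y along the coordinate axes avoids any notion of total
    differentiability: each leg is a one-variable integral, and the integral of
    a C^k function over a coordinatewise scaling is again C^k. *)
Lemma hadamard g : (forall k, Ck k V g) ->
  exists G : 'I_n -> 'rV[R]_n -> R, (forall i k, Ck k V (G i)) /\
    forall y, V y -> g y = g y0 + \sum_i (y 0 i - y0 0 i) * G i y.
Proof.
move=> cg.
exists (fun i : 'I_n => scal_int (had_scale i) (fun=> 1) (fun y => 'D_(delta_mx 0 i) g y)).
split=> [i k|y Vy].
  apply: (scal_int_Ck (@had_scale_cont i) (@had_scale01 i) _ (Ck_derive i (cg k.+1))).
  by move=> t; exact: cvg_cst.
rewrite (eq_bigr (fun i : 'I_n => g (had_pt i.+1 y) - g (had_pt i y))); last first.
  by move=> i _; rewrite (hadamard_step i Vy (cg 1%N)).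
rewrite -(big_mkord xpredT (fun k => g (had_pt k.+1 y) - g (had_pt k y))).
rewrite telescope_sumr //.
have -> : had_pt n y = y by apply/rowP => l; rewrite mxE ltn_ord.
have -> : had_pt 0 y = y0 by apply/rowP => l; rewrite mxE.
by rewrite addrC subrK.
Qed.

End Hadamard.

(** * The Grassmann algebra *)

Section GrassmannTheory.
Variables (R : realType) (m : nat).
Implicit Types (u v e : grassmann R m) (I J K : {set 'I_m}) (j : 'I_m).

Lemma gsignE I J :
  gsign R I J = \prod_(p in I) \prod_(q in J) (-1) ^+ (q < p)%N.
Proof.
rewrite pair_big_dep /= (bigID (fun p : 'I_m * 'I_m => (p.2 < p.1)%N)) /=.
rewrite [X in _ * X]big1 ?mulr1; last by move=> p /andP[_ /negPf->].
rewrite /gsign (eq_bigr (fun=> -1)); last by move=> p /andP[_ ->].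
rewrite -prodr_const; apply: eq_bigl => p; rewrite !inE andbA //.
Qed.

Lemma gsign_setU1l j I J : j \notin I ->
  gsign R (j |: I)%SET J = gsign R [set j]%SET J * gsign R I J.
Proof. by move=> jI; rewrite !gsignE big_setU1 //= big_set1. Qed.

Lemma gsign_setU1r j I J : j \notin J ->
  gsign R I (j |: J)%SET = gsign R I [set j]%SET * gsign R I J.
Proof.
move=> jJ; rewrite !gsignE -big_split /=; apply: eq_bigr => p _.
by rewrite big_setU1 //= big_set1.
Qed.

Lemma gsign0l J : gsign R finset.set0 J = 1.
Proof. by rewrite gsignE big_set0. Qed.

Lemma gsign0r I : gsign R I finset.set0 = 1.
Proof. by rewrite gsignE big1 // => p _; rewrite big_set0. Qed.

(** The sign of the left partial derivative along xi_j. *)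
Lemma gsign1l j K :
  gsign R [set j]%SET K = (-1) ^+ #|[set k in K | (k < j)%N]%SET|.
Proof.
rewrite gsignE big_set1 (bigID (fun q : 'I_m => (q < j)%N)) /=.
rewrite [X in _ * X]big1 ?mulr1; last by move=> p /andP[_ /negPf->].
rewrite (eq_bigr (fun=> -1)); last by move=> p /andP[_ ->].
by rewrite -prodr_const; apply: eq_bigl => p; rewrite !inE.
Qed.

Lemma gsign_swap1 j I : j \notin I ->
  gsign R I [set j]%SET * gsign R [set j]%SET I = (-1) ^+ #|I|.
Proof.
move=> jI; rewrite !gsignE big_set1 -big_split /= -prodr_const.
apply: eq_bigr => p pI; rewrite big_set1.
have : p != j by apply: contraNneq jI => <-.
by rewrite -(inj_eq val_inj) /= neq_ltn; case: ltngtP; rewrite // ?mul1r ?mulr1.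
Qed.

Lemma gsign1_sqr j I : gsign R [set j]%SET I * gsign R [set j]%SET I = 1.
Proof. by rewrite gsign1l -expr2 sqrr_sign. Qed.

(** The left partial derivative along xi_j. *)
Definition gder j u : grassmann R m :=
  [ffun K : {set 'I_m} => if j \in K then 0
     else gsign R [set j]%SET K * u (j |: K)%SET].

(** The filtration by powers of the ideal generated by the odd generators. *)
Definition gdeg k u := forall K, (#|K| < k)%N -> u K = 0.

Lemma gbodyM u v : gbody (gmul u v) = gbody u * gbody v.
Proof.
rewrite /gbody ffunE (big_pred1 finset.set0) => [|I]; last by rewrite finset.subset0.
by rewrite finset.setD0 gsign0l mul1r.
Qed.

Lemma gdeg1P u : gdeg 1 u <-> gbody u = 0.
Proof.
split=> [h|h K]; first by apply: h; rewrite cards0.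
by rewrite ltnS leqn0 cards_eq0 => /eqP->.
Qed.

Lemma gdegM p q u v : gdeg p u -> gdeg q v -> gdeg (p + q) (gmul u v).
Proof.
move=> hu hv K Kpq; rewrite ffunE big1 // => I IK.
have [Ip|Ip] := ltnP #|I| p; first by rewrite hu // mulr0 mul0r.
rewrite hv ?mulr0 //.
have := cardsID I K; rewrite (finset.setIidPr IK) => cK.
by move: Kpq; rewrite -cK; lia.
Qed.

Lemma gdeg_top u : gdeg m.+1 u -> u = 0.
Proof.
move=> h; apply/ffunP => K; rewrite ffunE h // ltnS.
by rewrite -[X in (_ <= X)%N](card_ord m) max_card.
Qed.

(** Multiplication by an element with nonzero body acts on the lowest degree
    part as a nonzero scalar, so it reflects the filtration. *)
Lemma gdeg_cancel k u v : gbody u != 0 -> gdeg k (gmul u v) -> gdeg k v.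
Proof.
move=> u0 huv; suff: forall l, (l <= k)%N -> gdeg l v by apply.
elim=> [|l IH] lk K //; rewrite ltnS leq_eqVlt => /orP[/eqP Kl|]; last first.
  by apply: IH; exact: ltnW.
have := huv K; rewrite Kl => /(_ lk); rewrite ffunE (bigD1 finset.set0) /=; last first.
  by rewrite finset.sub0set.
rewrite big1 ?addr0 => [|I /andP[IK I0]]; last first.
  rewrite [v _]IH ?mulr0 //; first exact: ltnW.
  rewrite -Kl; have := cardsID I K; rewrite (finset.setIidPr IK) => <-.
  have I1 : (0 < #|I|)%N by rewrite card_gt0.
  by lia.
rewrite finset.setD0 gsign0l mul1r => /eqP; rewrite mulf_eq0 => /orP[|/eqP//].
by move: u0; rewrite /gbody => /negPf ->.
Qed.

Lemma gder_deg k u : gdeg k.+1 u -> forall j, gdeg k (gder j u).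
Proof.
move=> h j K Kk; rewrite ffunE; case: ifP => // /negbT jK.
by rewrite h ?mulr0 // cardsU1 jK.
Qed.

Lemma gdeg_gder k u : gbody u = 0 -> (forall j, gdeg k (gder j u)) -> gdeg k.+1 u.
Proof.
move=> u0 h K Kk; have [->|[j jK]] := finset.set_0Vmem K; first exact: u0.
have := h j (K :\ j)%SET; rewrite ffunE !inE eqxx /= finset.setD1K //.
rewrite [#|K|](cardsD1 j) jK add1n ltnS in Kk => /(_ Kk)/eqP.
by rewrite gsign1l mulf_eq0 signr_eq0 => /eqP.
Qed.

(** A first order linear system along the odd directions alone determines an
    element of the Grassmann algebra from its body, since each derivative only
    sees the part of the next lower degree. *)
Lemma gder_unique u e (c : 'I_m -> grassmann R m) :
  gbody u != 0 -> (forall j, gbody (c j) = 0) -> gbody e = 0 ->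
  (forall j, gmul u (gder j e) = gmul (c j) e) -> e = 0.
Proof.
move=> u0 c0 e0 H; apply: gdeg_top.
suff: forall k, gdeg k.+1 e by apply.
elim=> [|k IH]; first exact: (gdeg1P e).2 e0.
apply: gdeg_gder => // j; apply: (gdeg_cancel u0); rewrite H -add1n.
exact: gdegM ((gdeg1P _).2 (c0 j)) (fun K Kk => IH K (ltnW Kk)).
Qed.

Lemma gcstM r u : gmul (gcst m r) u = [ffun K => r * u K].
Proof.
apply/ffunP => K; rewrite !ffunE (bigD1 finset.set0) ?finset.sub0set //= big1 ?addr0.
  by rewrite ffunE eqxx finset.setD0 gsign0l mul1r.
by move=> I /andP[_ /negPf I0]; rewrite ffunE I0 mulr0 mul0r.
Qed.

Definition gmono K (r : R) : grassmann R m :=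
  [ffun K' : {set 'I_m} => if K' == K then r else 0].

(** Generators are split off a monomial in increasing order, which produces no
    signs. *)
Lemma gmono_gen j K (r : R) : (forall k, k \in K -> (j < k)%N) ->
  gmul (ggen R j) (gmono K r) = gmono (j |: K)%SET r.
Proof.
move=> jK; have jnK : j \notin K by apply/negP => /jK; rewrite ltnn.
apply/ffunP => K'; rewrite !ffunE.
have [jK'|jK'] := boolP (j \in K'); last first.
  rewrite big1 => [|I IK']; last first.
    rewrite ffunE; case: eqP => [E|_]; last by rewrite mulr0 mul0r.
    by move: jK'; rewrite (fintype.subsetP IK') // E inE.
  by case: eqP => // E; move: jK'; rewrite E !inE eqxx.
rewrite (bigD1 [set j]%SET) ?finset.sub1set //= big1 ?addr0 => [|I /andP[_ /negPf IJ]]; last first.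
  by rewrite ffunE IJ mulr0 mul0r.
rewrite !ffunE eqxx mulr1.
have -> : (K' :\: [set j] == K)%SET = (K' == j |: K)%SET.
  apply/eqP/eqP => [<-|->]; first by rewrite finset.setD1K.
  by rewrite finset.setU1K.
case: eqP => [E|_]; last by rewrite mulr0.
rewrite gsign1l (_ : [set k in _ | _]%SET = finset.set0) ?cards0 ?mul1r //.
apply/finset.setP => k; rewrite !inE; apply/negP => /andP[]; rewrite E !inE.
by move=> /andP[/negPf-> /jK]; case: ltngtP.
Qed.

Lemma gder_hom p j u : ghom p u -> ghom (~~ p) (gder j u).
Proof.
move=> h K Kp; rewrite ffunE; case: ifP => // /negbT jK.
by rewrite h ?mulr0 // cardsU1 jK /=; case: (odd _) Kp; case: p {h}.
Qed.

Lemma sum_setU1 j K (F : {set 'I_m} -> R) : j \notin K ->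
  \sum_(I : {set 'I_m} | I \subset (j |: K)%SET) F I =
  \sum_(I : {set 'I_m} | I \subset K) (F I + F (j |: I)%SET).
Proof.
move=> jK; rewrite big_split /= (bigID (fun I : {set 'I_m} => j \in I)) /= addrC.
have jI I : I \subset K -> j \notin I.
  by move=> IK; apply: contra jK; exact: (fintype.subsetP IK).
congr (_ + _).
  apply: eq_bigl => I; apply/andP/idP => [[IjK jnI]|IK]; last first.
    by split; [exact: fintype.subset_trans IK (finset.subsetUr _ _)|exact: jI].
  apply/fintype.subsetP => k kI; have := fintype.subsetP IjK _ kI.
  by rewrite !inE => /orP[/eqP E|//]; rewrite -E kI in jnI.
rewrite (reindex_onto (fun I => j |: I)%SET (fun I => I :\ j)%SET) /=; last first.
  by move=> I /andP[_ ?]; rewrite finset.setD1K.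
apply: eq_bigl => I; apply/idP/idP => [/andP[/andP[IjK _] /eqP <-]|IK].
  apply/fintype.subsetP => k; rewrite !inE => /andP[kj] /orP[|kI]; first by rewrite (negPf kj).
  by have := fintype.subsetP IjK k; rewrite !inE kI orbT (negPf kj) /=; apply.
by rewrite finset.setUS // setU11 /= finset.setU1K // jI.
Qed.

(** For a given odd monomial, the summands are indexed by a subset I avoiding j
    and by the side to which xi_j goes. Moving xi_j across xi_I costs (-1)^#|I|,
    which is (-1)^p on the support of u. *)
Lemma gder_leibniz p j u v : ghom p u ->
  gder j (gmul u v) = gmul (gder j u) v + [ffun K => (-1) ^+ p * gmul u (gder j v) K].
Proof.
move=> hu; apply/ffunP => K; rewrite !ffunE.
pose s I J : R := gsign R I J.
have sD I J : s I J = gsign R I J by [].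
have hu' I : (-1) ^+ #|I| * u I = (-1) ^+ p * u I.
  have [<-|/hu ->] := eqVneq (odd #|I|) p; last by rewrite !mulr0.
  by rewrite signr_odd.
have [jK|jK] := boolP (j \in K); last first.
  rewrite sum_setU1 // mulr_sumr mulr_sumr -big_split /=; apply: eq_bigr => I IK.
  have jI : j \notin I by apply: contra jK; exact: (fintype.subsetP IK).
  have E1 : ((j |: K) :\: I = j |: (K :\: I))%SET.
    by apply/finset.setP => k; rewrite !inE; case: eqP => [->|//]; rewrite jI.
  have E2 : ((j |: K) :\: (j |: I) = K :\: I)%SET.
    apply/finset.setP => k; rewrite !inE; case: eqP => [->|//]; by rewrite (negPf jK) andbF.
  have jD : j \notin (K :\: I)%SET by rewrite !inE (negPf jK) andbF.
  have EK : s [set j]%SET K = s [set j]%SET I * s [set j]%SET (K :\: I)%SET.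
    rewrite !sD !gsign1l -exprD; congr (_ ^+ _).
    rewrite -cardsUI [X in (_ + X)%N](_ : _ = 0%N) ?addn0; last first.
      by apply/eqP; rewrite cards_eq0; apply/eqP/finset.setP => k; rewrite !inE;
         case: (k \in I); rewrite ?andbF.
    apply: eq_card => k; rewrite !inE.
    have [kI|kI] := boolP (k \in I); last by rewrite orFb.
    by rewrite (fintype.subsetP IK) //= orbF.
  rewrite !ffunE (negPf jI) (negPf jD) E1 E2 gsign_setU1l // gsign_setU1r // -!sD EK.
  have := gsign_swap1 jI; rewrite -!sD => sw.
  have := gsign1_sqr j (K :\: I); rewrite -!sD => sq.
  set sjD := s [set j]%SET (K :\: I)%SET; set sjI := s [set j]%SET I.
  transitivity ((sjD * sjD) * (sjI * s I (K :\: I)%SET * u (j |: I)%SET * v (K :\: I)%SET)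
     + (s I [set j]%SET * sjI * u I) * (s I (K :\: I)%SET * sjD * v (j |: K :\: I)%SET)).
    by ring.
  by rewrite sw sq hu'; ring.
rewrite -(finset.setD1K jK); set K' := (K :\ j)%SET.
have jK' : j \notin K' by rewrite !inE eqxx.
rewrite !sum_setU1 // mulr_sumr -big_split big1 //= => I IK.
have jI : j \notin I by apply: contra jK'; exact: (fintype.subsetP IK).
have E1 : ((j |: K') :\: I = j |: (K' :\: I))%SET.
  by apply/finset.setP => k; rewrite !inE; case: eqP => [->|//]; rewrite jI.
have E2 : ((j |: K') :\: (j |: I) = K' :\: I)%SET.
  apply/finset.setP => k; rewrite !inE; case: eqP => [->|//]; by rewrite andbF.
have jD : j \notin (K' :\: I)%SET by rewrite !inE eqxx andbF.
rewrite E1 E2 !ffunE (negPf jI) (negPf jD) !inE eqxx /= !(mulr0, mul0r) addr0 add0r.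
rewrite gsign_setU1r // gsign_setU1l // -!sD.
have hj : (-1) ^+ p * u (j |: I)%SET = - (-1) ^+ #|I| * u (j |: I)%SET.
  by rewrite -hu' cardsU1 jI exprS mulN1r.
have := gsign_swap1 jI; rewrite -!sD => sw.
have := gsign1_sqr j (K' :\: I); rewrite -!sD => sq.
transitivity (s I [set j]%SET * s [set j]%SET I * (u (j |: I)%SET *
     s I (K' :\: I)%SET * v (j |: K' :\: I)%SET) +
     (-1) ^+ p * u (j |: I)%SET * ((s [set j]%SET (K' :\: I)%SET * s [set j]%SET (K' :\: I)%SET)
       * s I (K' :\: I)%SET * v (j |: K' :\: I)%SET)).
  by ring.
by rewrite sw sq hj; ring.
Qed.

Lemma gbody_odd u : ghom true u -> gbody u = 0.
Proof. by move=> h; apply: h; rewrite cards0. Qed.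

End GrassmannTheory.

(** * Sections of a superspace *)

Section SuperspaceTheory.
Variables (R : realType) (M : topologicalType) (X : superspace R M).
Implicit Types (U V W : opens M) (p q : bool) (r : R).

Lemma cst0 U : cst X 0 = 0 :> X U.
Proof. by apply: (addIr (cst X 0)); rewrite -cstD !add0r. Qed.

Lemma cstN U r : cst X (- r) = - cst X r :> X U.
Proof. by apply/eqP; rewrite -subr_eq0 opprK -cstD addNr cst0. Qed.

Lemma sparN U p (f : X U) : spar X p f -> spar X p (- f).
Proof. by move=> h; rewrite -sub0r; apply: sparB => //; exact: spar0. Qed.

Lemma sparD U p (f g : X U) : spar X p f -> spar X p g -> spar X p (f + g).
Proof. by move=> hf hg; rewrite -[g]opprK; apply: sparB => //; exact: sparN. Qed.

Lemma spar_sum U p (I : Type) (s : seq I) (P : pred I) (F : I -> X U) :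
  (forall i, P i -> spar X p (F i)) -> spar X p (\sum_(i <- s | P i) F i).
Proof. by move=> h; elim/big_ind: _ => //; [exact: spar0|move=> *; exact: sparD]. Qed.

Lemma spar_sign U p (b : bool) (f : X U) : spar X p f -> spar X p ((-1) ^+ b * f).
Proof. by case: b; rewrite ?expr0 ?expr1 ?mul1r ?mulN1r //; exact: sparN. Qed.

Lemma spar1 U : spar X false (1 : X U).
Proof. by rewrite -cst1; exact: spar_cst. Qed.

Lemma sparM' U p q s (f g : X U) : spar X p f -> spar X q g -> s = p (+) q ->
  spar X s (f * g).
Proof. by move=> hf hg ->; exact: sparM. Qed.

Lemma sparMl U p (f g : X U) : spar X false f -> spar X p g -> spar X p (f * g).
Proof. exact: sparM. Qed.

Lemma spar_cstM U p r (f : X U) : spar X p f -> spar X p (cst X r * f).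
Proof. by apply: sparMl; exact: spar_cst. Qed.

Lemma even_comm U (e f : X U) : spar X false e -> e * f = f * e.
Proof.
move=> he; have [g [g0 g1]] := spar_dec f.
by rewrite -(subrK g f) mulrDl mulrDr !(supercomm he g0) !(supercomm he g1) /= !mul1r.
Qed.

Lemma cst_comm U r (f : X U) : cst X r * f = f * cst X r.
Proof. by apply: even_comm; exact: spar_cst. Qed.

Lemma signC U (b : bool) (f : X U) : (-1) ^+ b * f = f * (-1) ^+ b.
Proof. by case: b; rewrite ?expr0 ?expr1 ?mulr1 ?mul1r ?mulN1r ?mulrN1. Qed.

Section Res.
Variables (U V : opens M).
Hypothesis VU : V `<=` U.

Lemma res0 : res V (0 : X U) = 0.
Proof. by rewrite -[X in res _ X](subrr (0 : X U)) resB // subrr. Qed.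

Lemma resN (f : X U) : res V (- f) = - res V f.
Proof. by rewrite -sub0r resB // res0 sub0r. Qed.

Lemma resD (f g : X U) : res V (f + g) = res V f + res V g.
Proof. by rewrite -[g in LHS]opprK resB // resN opprK. Qed.

Lemma res_sum (I : Type) (s : seq I) (P : pred I) (F : I -> X U) :
  res V (\sum_(i <- s | P i) F i) = \sum_(i <- s | P i) res V (F i).
Proof. exact: (big_morph _ resD res0). Qed.

Lemma res1 : res V (1 : X U) = 1.
Proof. by rewrite -cst1 res_cst // cst1. Qed.

Lemma res_sign (b : bool) : res V ((-1) ^+ b : X U) = (-1) ^+ b.
Proof. by case: b; rewrite ?expr0 ?expr1 ?resN res1. Qed.

End Res.

End SuperspaceTheory.

(** * Calculus in a chart *)

Section SmoothTheory.
Variables (R : realType) (n m : nat).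

Lemma is_derive_bigsum (I : Type) (s : seq I) (P : pred I)
    (F : I -> 'rV[R]_n -> R) (y v : 'rV[R]_n) :
  (forall i, P i -> derivable (F i) y v) ->
  is_derive y v (fun z => \sum_(i <- s | P i) F i z) (\sum_(i <- s | P i) 'D_v (F i) y).
Proof.
move=> h; elim: s => [|i s IH].
  rewrite big_nil (_ : (fun _ => _) = fun=> 0); last first.
    by apply/funext => z; rewrite big_nil.
  exact: is_derive_cst.
rewrite big_cons (_ : (fun _ => _) = fun z => if P i then
    F i z + \sum_(i <- s | P i) F i z else \sum_(i <- s | P i) F i z); last first.
  by apply/funext => z; rewrite big_cons.
case: ifP => // Pi; apply: is_deriveD => //; exact/derivableP/h.
Qed.

Lemma gsmooth_partial (V : set 'rV[R]_n) (a : 'I_(n + m)) (F : 'rV[R]_n -> grassmann R m) :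
  open V -> gsmooth V F -> gsmooth V (gpartial a F).
Proof.
move=> oV hF K k; rewrite /gpartial; case: (fintype.split a) => [i|j].
  rewrite (_ : (fun y => _) = (fun y => 'D_(delta_mx 0 i) (fun z => F z K) y)).
    exact: Ck_derive (hF K k.+1).
  by apply/funext => y; rewrite ffunE.
have [jK|jK] := boolP (j \in K).
  apply: (Ck_ext oV _ (Ck_cst k V 0)) => y _; by rewrite ffunE jK.
apply: (Ck_ext oV _ (CkZ _ oV (hF (j |: K)%SET k))) => y _.
by rewrite ffunE (negPf jK).
Qed.

Lemma gsmooth_coord (V : set 'rV[R]_n) (a : 'I_(n + m)) :
  open V -> gsmooth V (gcoord a).
Proof.
move=> oV K k; rewrite /gcoord; case: (fintype.split a) => [i|j]; last exact: Ck_cst.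
have [->|K0] := eqVneq K finset.set0.
  by apply: (Ck_ext oV _ (Ck_coord k i oV)) => y _; rewrite ffunE eqxx.
by apply: (Ck_ext oV _ (Ck_cst k V 0)) => y _; rewrite ffunE (negPf K0).
Qed.

End SmoothTheory.

Section ChartTheory.
Variables (R : realType) (M : topologicalType) (X : superspace R M).
Variables (n m : nat) (c : chart X n m).
Implicit Types (U V W : opens M) (p q : bool) (a b : 'I_(n + m)).

Section OneOpen.
Variable U : opens M.
Hypothesis Uc : U `<=` cdom c.
Local Notation B := (cmap c @` U).
Implicit Types (f g : X U).

Lemma openB : open B. Proof. exact: cmap_open. Qed.

Lemma crep_inj f g : (forall y, B y -> crep c f y = crep c g y) -> f = g.
Proof.
move=> h; apply/eqP; rewrite -subr_eq0; apply/eqP.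
have H p : spar X p (f - g).
  apply/(crep_par p _ Uc) => y By K _.
  by rewrite (crepB (c := c)) // h // subrr ffunE.
exact: spar_dir.
Qed.

Lemma crep0 y : B y -> crep c (0 : X U) y = 0.
Proof. by move=> By; rewrite -(subrr (0 : X U)) (crepB (c := c)) // subrr. Qed.

Lemma crepN f y : B y -> crep c (- f) y = - crep c f y.
Proof. by move=> By; rewrite -sub0r (crepB (c := c)) // crep0 // sub0r. Qed.

Lemma crepD f g y : B y -> crep c (f + g) y = crep c f y + crep c g y.
Proof. by move=> By; rewrite -[g in LHS]opprK (crepB (c := c)) // crepN // opprK. Qed.

Lemma crep_sum (I : Type) (s : seq I) (P : pred I) (F : I -> X U) y : B y ->
  crep c (\sum_(i <- s | P i) F i) y = \sum_(i <- s | P i) crep c (F i) y.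
Proof.
by move=> By; apply: (big_morph (fun f => crep c f y) (fun f g => crepD f g By) (crep0 By)).
Qed.

Lemma crep_sign (b : bool) f y : B y ->
  crep c ((-1) ^+ b * f) y = [ffun K => (-1) ^+ b * crep c f y K].
Proof.
move=> By; apply/ffunP => K; rewrite ffunE; case: b; last by rewrite expr0 !mul1r.
by rewrite expr1 !mulN1r crepN // ffunE.
Qed.

Lemma crep_cstM r f y : B y -> crep c (cst X r * f) y = [ffun K => r * crep c f y K].
Proof. by move=> By; rewrite (crepM (c := c)) // (crep_cst (c := c)) // gcstM. Qed.

Lemma crep_pd a f y : B y -> crep c (pd c a f) y = gpartial a (crep c f) y.
Proof.
move=> By; rewrite csecK //; apply: gsmooth_partial; first exact: openB.
exact: crep_smooth.
Qed.

Lemma gpartial_eq a (F G : 'rV[R]_n -> grassmann R m) y : B y ->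
  (forall z, B z -> F z = G z) -> gpartial a F y = gpartial a G y.
Proof.
move=> By FG; rewrite /gpartial; case: (fintype.split a) => [i|j].
  apply/ffunP => K; rewrite !ffunE; apply: near_eq_derive.
  apply: filterS (open_nbhs_nbhs (conj openB By)) => z Bz; by rewrite FG.
by apply/ffunP => K; rewrite !ffunE FG.
Qed.

Lemma gpartial_odd a (F : 'rV[R]_n -> grassmann R m) y (j : 'I_m) :
  a = rshift n j -> gpartial a F y = gder j (F y).
Proof.
move=> ->; rewrite /gpartial -[rshift n j]/(unsplit (inr j)) (unsplitK (inr j)).
by apply/ffunP => K; rewrite !ffunE gsign1l.
Qed.

Lemma gpartial_even a (F : 'rV[R]_n -> grassmann R m) y (i : 'I_n) :
  a = lshift m i -> gpartial a F y = [ffun K => 'D_(delta_mx 0 i) (fun z => F z K) y].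
Proof. by move=> ->; rewrite /gpartial -[lshift m i]/(unsplit (inl i)) (unsplitK (inl i)). Qed.

Variant ipar_spec a : bool -> Type :=
  | IparEven (i : 'I_n) of a = lshift m i : ipar_spec a false
  | IparOdd (j : 'I_m) of a = rshift n j : ipar_spec a true.

Lemma iparP a : ipar_spec a (ipar a).
Proof.
rewrite -(splitK a); case: (fintype.split a) => [i|j] /=.
  rewrite (_ : ipar _ = false); first exact: (IparEven (i := i)).
  by rewrite /ipar /= leqNgt ltn_ord.
rewrite (_ : ipar _ = true); first exact: (IparOdd (j := j)).
by rewrite /ipar /= leq_addr.
Qed.

Lemma crep_derivable f y (i : 'I_n) K : B y ->
  derivable (fun z => crep c f z K) y (delta_mx 0 i).
Proof. by move=> By; exact: (Ck_derivable (crep_smooth f Uc K 1%N)). Qed.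

Lemma pd_par a p f : spar X p f -> spar X (p (+) ipar a) (pd c a f).
Proof.
move=> /(crep_par p _ Uc) h; apply/(crep_par _ _ Uc) => y By; rewrite crep_pd //.
case: (iparP a) => [i|j] E.
  rewrite (gpartial_even _ _ E) addbF => K Kp; rewrite ffunE.
  rewrite (near_eq_derive (g := fun=> 0)) ?derive_cst //.
  by apply: filterS (open_nbhs_nbhs (conj openB By)) => z Bz; exact: h.
by rewrite (gpartial_odd _ _ E) addbT; apply: gder_hom; exact: h.
Qed.

Lemma pdB a f g : pd c a (f - g) = pd c a f - pd c a g.
Proof.
apply: crep_inj => y By; rewrite (crepB (c := c)) // !crep_pd //.
rewrite (gpartial_eq _ (G := fun z => crep c f z - crep c g z)) //; last first.
  by move=> z Bz; rewrite (crepB (c := c)).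
case: (iparP a) => [i|j] E.
  rewrite !(gpartial_even _ _ E); apply/ffunP => K; rewrite !ffunE.
  rewrite (_ : (fun z => _) = (fun z => crep c f z K - crep c g z K)).
    by rewrite deriveB //; exact: crep_derivable.
  by apply/funext => z; rewrite !ffunE.
rewrite !(gpartial_odd _ _ E); apply/ffunP => K; rewrite !ffunE.
by case: ifP; rewrite ?subrr ?mulrBr.
Qed.

Lemma pd0 a : pd c a (0 : X U) = 0.
Proof. by rewrite -[X in pd _ _ X](subrr (0 : X U)) pdB subrr. Qed.

Lemma pdN a f : pd c a (- f) = - pd c a f.
Proof. by rewrite -sub0r pdB pd0 sub0r. Qed.

Lemma pdD a f g : pd c a (f + g) = pd c a f + pd c a g.
Proof. by rewrite -[g in LHS]opprK pdB pdN opprK. Qed.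

Lemma pd_sum a (I : Type) (s : seq I) (P : pred I) (F : I -> X U) :
  pd c a (\sum_(i <- s | P i) F i) = \sum_(i <- s | P i) pd c a (F i).
Proof. exact: (big_morph _ (pdD a) (pd0 a)). Qed.

Lemma pd_sign a (b : bool) f : pd c a ((-1) ^+ b * f) = (-1) ^+ b * pd c a f.
Proof. by case: b; rewrite ?expr0 ?expr1 ?mul1r ?mulN1r ?pdN. Qed.

(** Along an even coordinate this is the product rule for each pair of
    coefficients; along an odd one it is the Leibniz rule of the Grassmann
    algebra, applied pointwise. *)
Lemma pdM a p f g : spar X p f ->
  pd c a (f * g) = pd c a f * g + (-1) ^+ (ipar a && p) * (f * pd c a g).
Proof.
move=> /(crep_par p _ Uc) hf; apply: crep_inj => y By.
rewrite crepD // crep_sign // !(crepM (c := c)) // !crep_pd //.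
rewrite (gpartial_eq _ (G := fun z => gmul (crep c f z) (crep c g z))) //; last first.
  by move=> z Bz; rewrite (crepM (c := c)).
case: (iparP a) => [i|j] E; last first.
  by rewrite !(gpartial_odd _ _ E) (gder_leibniz _ _ (hf _ By)).
rewrite !(gpartial_even _ _ E); apply/ffunP => K; rewrite !ffunE expr0 mul1r.
rewrite (_ : (fun z => _) = (fun z => \sum_(I : {set 'I_m} | I \subset K)
    gsign R I (K :\: I)%SET * crep c f z I * crep c g z (K :\: I)%SET)); last first.
  by apply/funext => z; rewrite ffunE.
have df I := @crep_derivable f y i I By; have dg I := @crep_derivable g y i I By.
have dfZ I (r : R) : derivable (fun z => r * crep c f z I) y (delta_mx 0 i).
  exact: derivableZ.
have [_ ->] := @is_derive_bigsum R n _ (index_enum _) (fun I : {set 'I_m} => I \subset K)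
  (fun I z => gsign R I (K :\: I)%SET * crep c f z I * crep c g z (K :\: I)%SET)
  y (delta_mx 0 i) (fun I _ => derivableM (dfZ I _) (dg (K :\: I)%SET)).
rewrite -big_split /=; apply: eq_bigr => I _; rewrite !ffunE.
rewrite (deriveM (dfZ I _) (dg (K :\: I)%SET)) (deriveZ _ (df I)) addrC.
by rewrite /GRing.scale /=; ring.
Qed.

Lemma pd_cst a r : pd c a (cst X r : X U) = 0.
Proof.
apply: crep_inj => y By; rewrite crep_pd // crep0 //.
rewrite (gpartial_eq _ (G := fun=> gcst m r)) //; last first.
  by move=> z Bz; rewrite (crep_cst (c := c)).
case: (iparP a) => [i|j] E; apply/ffunP => K.
  by rewrite (gpartial_even _ _ E) !ffunE derive_cst.
rewrite (gpartial_odd _ _ E) !ffunE; case: ifP => // jK.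
rewrite (_ : (j |: K == finset.set0)%SET = false) ?mulr0 //.
by apply/negbTE/set0Pn; exists j; exact: setU11.
Qed.

End OneOpen.
End ChartTheory.

(** * Derivations are determined by the coordinates *)

Section Derivations.
Variables (R : realType) (M : topologicalType) (X : superspace R M).

(** Derivations are taken on all the opens inside U at once, compatibly with
    restriction, since their values at a point are computed on small balls
    around it. *)
Record local_der (p : bool) (U : opens M) (D : forall V : opens M, X V -> X V) : Prop :=
  LocalDer {
    lderD : forall (V : opens M) (f g : X V), V `<=` U -> D V (f + g) = D V f + D V g;
    lder_cst : forall (V : opens M) r, V `<=` U -> D V (cst X r) = 0;
    lderM : forall (V : opens M) q (f g : X V), V `<=` U -> spar X q f ->
      D V (f * g) = D V f * g + (-1) ^+ (p && q) * (f * D V g);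
    lder_res : forall (V W : opens M) (f : X V), V `<=` U -> W `<=` V ->
      D W (res W f) = res W (D V f)
  }.

Section Theory.
Variables (p : bool) (U : opens M) (D : forall V : opens M, X V -> X V).
Hypothesis dD : local_der p U D.

Lemma lder0 (V : opens M) : V `<=` U -> D (0 : X V) = 0.
Proof. by move=> VU; rewrite -[in LHS](cst0 X V) (lder_cst dD). Qed.

Lemma lderN (V : opens M) (f : X V) : V `<=` U -> D (- f) = - D f.
Proof.
move=> VU; apply/eqP; by rewrite -subr_eq0 opprK -(lderD dD) // addNr lder0 // eqxx.
Qed.

Lemma lderB (V : opens M) (f g : X V) : V `<=` U -> D (f - g) = D f - D g.
Proof. by move=> VU; rewrite (lderD dD) // lderN. Qed.

Lemma lder_sum (V : opens M) (I : Type) (s : seq I) (P : pred I) (F : I -> X V) :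
  V `<=` U -> D (\sum_(i <- s | P i) F i) = \sum_(i <- s | P i) D (F i).
Proof.
move=> VU; apply: (big_morph (@D V)); last exact: lder0.
by move=> f g; rewrite (lderD dD).
Qed.

End Theory.
End Derivations.

Section ChartDerivations.
Variables (R : realType) (M : topologicalType) (X : superspace R M).
Variables (n m : nat) (c : chart X n m).
Implicit Types (U V W : opens M) (a b : 'I_(n + m)).

Lemma pd_res U V a (f : X U) : U `<=` cdom c -> V `<=` U ->
  pd c a (res V f) = res V (pd c a f).
Proof.
move=> Uc VU; have Vc : V `<=` cdom c by apply: subset_trans Uc.
apply: (crep_inj Vc) => y By; have BUy : (cmap c @` U) y by case: By => x /VU ? <-; exists x.
rewrite (crep_pd Vc) // (crep_res (c := c)) // (crep_pd Uc) //.
apply: (gpartial_eq Vc) => // z Bz; exact: crep_res.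
Qed.

Lemma crep_coord U b y : U `<=` cdom c -> (cmap c @` U) y ->
  crep c (res U (coord c b)) y = gcoord b y.
Proof.
move=> Uc By; rewrite (crep_res (c := c)) //.
apply: csecK => //; last by case: By => x /Uc ? <-; exists x.
by apply: gsmooth_coord; exact: cmap_open.
Qed.

Lemma coord_par U b : U `<=` cdom c -> spar X (ipar b) (res U (coord c b)).
Proof.
move=> Uc; apply/(crep_par _ _ Uc) => y By; rewrite crep_coord // /gcoord.
case: (iparP b) => [i|j] E; rewrite E.
  rewrite -[lshift m i]/(unsplit (inl i)) (unsplitK (inl i)) => K.
  have [->|K0] := eqVneq K finset.set0; first by rewrite cards0.
  by rewrite ffunE (negPf K0).
rewrite -[rshift n j]/(unsplit (inr j)) (unsplitK (inr j)) => K.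
have [->|K0] := eqVneq K [set j]%SET; first by rewrite cards1.
by rewrite ffunE (negPf K0).
Qed.

Lemma pd_coord U a b : U `<=` cdom c -> pd c a (res U (coord c b)) = (a == b)%:R.
Proof.
move=> Uc; apply: (crep_inj Uc) => y By; rewrite (crep_pd Uc) //.
rewrite (gpartial_eq Uc _ By (G := gcoord b)); last by move=> z Bz; exact: crep_coord.
have -> : crep c ((a == b)%:R : X U) y = gcst m (a == b)%:R.
  rewrite -(crep_cst (c := c) (a == b)%:R Uc By); congr crep.
  by case: eqP; rewrite ?cst0 ?cst1.
case: (iparP a) => [i|j] Ea; case: (iparP b) => [i'|j'] Eb; apply/ffunP => K;
  rewrite ?(gpartial_even _ _ Ea) ?(gpartial_odd _ _ Ea) Ea Eb /gcoord
    -?[lshift m i']/(unsplit (inl i')) -?[rshift n j']/(unsplit (inr j'))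
    ?(unsplitK (inl i')) ?(unsplitK (inr j')) !ffunE.
- rewrite eq_lshift; have [->|K0] := eqVneq K finset.set0.
    rewrite (_ : (fun z => _) = (fun z : 'rV[R]_n => z 0 i')).
      by have [_ ->] := is_derive_coord y i i'; rewrite eq_sym.
    by apply/funext => z; rewrite ffunE eqxx.
  rewrite (_ : (fun z => _) = (fun z : 'rV[R]_n => 0)) ?derive_cst //.
  by apply/funext => z; rewrite ffunE (negPf K0).
- by rewrite eq_lrshift derive_cst; case: ifP.
- rewrite eq_rlshift !if_same; case: ifP => // jK.
  rewrite (_ : (j |: K == finset.set0)%SET = false) ?mulr0 //.
  by apply/negbTE/set0Pn; exists j; exact: setU11.
- rewrite eq_rshift; case: ifP => [jK|/negbT jK].
    by case: eqP => // K0; rewrite K0 inE in jK.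
  have [->|K0] := eqVneq K finset.set0.
    rewrite finset.setU0 gsign0r mul1r; congr (_ %:R).
    by congr nat_of_bool; apply/eqP/eqP => [/finset.set1_inj|->].
  rewrite (_ : (j |: K == [set j'])%SET = false) ?mulr0 //; apply/negbTE/eqP => E.
  have jj' : j = j' by apply/eqP; rewrite -finset.in_set1 -E setU11.
  have [k kK] : exists k, k \in K by apply/set0Pn.
  have : k \in (j |: K)%SET by rewrite !inE kK orbT.
  rewrite E finset.in_set1 -jj' => /eqP kj; by rewrite -kj kK in jK.
Qed.

(** A neighbourhood on which Hadamard's lemma applies. *)
Lemma chart_ball V x : V `<=` cdom c -> oset V x ->
  exists W r, [/\ 0 < r, W `<=` V, oset W x & cmap c @` W = ball (cmap c x) r].
Proof.
move=> Vc Vx; have oB := cmap_open Vc.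
have : nbhs (cmap c x) (cmap c @` V) by apply: open_nbhs_nbhs; split => //; exists x.
move=> /nbhs_ballP[r /= r0 rB].
have oW : open (V `&` cmap c @^-1` ball (cmap c x) r).
  rewrite openE => z [Vz bz]; apply: filterI.
    by apply: open_nbhs_nbhs; split => //; exact: openP.
  apply: (cmap_cont (Vc _ Vz)); apply: open_nbhs_nbhs; split=> //; exact: ball_open.
exists (Opens oW), r; split => //=.
- by split; [exact: Vx|exact: ballxx].
- apply/seteqP; split=> [y [z [Vz bz] <-] //|y by_].
  by have [z Vz E] := rB _ by_; exists z => //; split=> //=; rewrite E.
Qed.

Lemma csec_eq U (F : 'rV[R]_n -> grassmann R m) (f : X U) : U `<=` cdom c ->
  gsmooth (cmap c @` U) F -> (forall y, (cmap c @` U) y -> crep c f y = F y) ->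
  csec c U F = f.
Proof. by move=> Uc hF h; apply: (crep_inj Uc) => y By; rewrite csecK // h. Qed.

Lemma gsmooth_mono (V : set 'rV[R]_n) (K : {set 'I_m}) g : open V ->
  (forall k, Ck k V g) -> gsmooth V (fun y => gmono K (g y)).
Proof.
move=> oV cg K' k; have [->|nK] := eqVneq K' K.
  by apply: (Ck_ext oV _ (cg k)) => y _; rewrite ffunE eqxx.
by apply: (Ck_ext oV _ (Ck_cst k V 0)) => y _; rewrite ffunE (negPf nK).
Qed.

(** By Hadamard's lemma a section near a point is a constant plus a combination
    of coordinates vanishing at that point, so that a derivation killing the
    coordinates takes it to a section vanishing there. *)
Theorem lder_coord0 p U D : U `<=` cdom c -> @local_der R M X p U D ->
  (forall a, D U (res U (coord c a)) = 0) ->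
  forall V (f : X V), V `<=` U -> D V f = 0.
Proof.
move=> Uc dD Dx V f VU; have Vc : V `<=` cdom c by apply: subset_trans Uc.
apply: (crep_inj Vc) => _ [x Vx <-]; rewrite (crep0 Vc); last by exists x.
have [W [r [r0 WV Wx BW]]] := chart_ball Vc Vx.
have Wc : W `<=` cdom c by apply: subset_trans Vc.
have WU : W `<=` U by apply: subset_trans VU.
set y := cmap c x; have Wy : (cmap c @` W) y by exists x.
have oW := cmap_open Wc.
have DW a : D W (res W (coord c a)) = 0.
  by rewrite -(res_comp (V := U)) // (lder_res dD) // Dx res0.
rewrite -(crep_res (V := W)) // -(lder_res dD) //.
have sm (K' : {set 'I_m}) (g : 'rV[R]_n -> R) : (forall k, Ck k (ball y r) g) ->
  gsmooth (cmap c @` W) (fun z => gmono K' (g z)).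
  by move=> cg; apply: gsmooth_mono => // k; rewrite BW.
suff H K : forall g : 'rV[R]_n -> R, (forall k, Ck k (ball y r) g) ->
    crep c (D W (csec c W (fun z => gmono K (g z)))) y = 0.
  pose F K := csec c W (fun z => gmono K (crep c (res W f) z K)).
  have CF K k : Ck k (ball y r) (fun z => crep c (res W f) z K).
    by rewrite -BW; exact: crep_smooth.
  have -> : res W f = \sum_K F K.
    apply: (crep_inj Wc) => z Bz; rewrite (crep_sum Wc) //; apply/ffunP => K.
    have cF K' : crep c (F K') z = gmono K' (crep c (res W f) z K').
      by rewrite csecK //; apply: (sm K' (fun z => crep c (res W f) z K')).
    rewrite sum_ffunE (bigD1 K) //= cF ffunE eqxx big1 ?addr0 // => K' K'K.
    by rewrite cF ffunE eq_sym (negPf K'K).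
  rewrite (lder_sum dD) // (crep_sum Wc) // big1 // => K _; apply: H; exact: CF.
(* The section is now a single monomial g xi_K. For empty K this is Hadamard's
   lemma; otherwise xi_j is split off for the least j in K, and D kills xi_j. *)
move: {2}#|K| (leqnn #|K|) => N; elim: N K => [|N IH] K KN g cg.
  move: KN; rewrite leqn0 cards_eq0 => /eqP->.
  have [G [cG gE]] := hadamard cg.
  pose h i := csec c W (fun z => gmono finset.set0 (G i z)) : X W.
  have -> : csec c W (fun z => gmono finset.set0 (g z)) = cst X (g y) +
      \sum_i (res W (coord c (lshift m i)) - cst X (y 0 i)) * h i.
    apply: csec_eq => //; first exact: sm.
    move=> z Bz; rewrite (crepD Wc) // (crep_cst (c := c)) // (crep_sum Wc) //.
    apply/ffunP => K'; rewrite !ffunE sum_ffunE (gE z) -?BW //.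
    have E i : crep c ((res W (coord c (lshift m i)) - cst X (y 0 i)) * h i) z K' =
        if K' == finset.set0 then (z 0 i - y 0 i) * G i z else 0.
      rewrite (crepM (c := c)) // (crepB (c := c)) // crep_coord // (crep_cst (c := c)) //.
      rewrite csecK //; last exact: sm.
      rewrite /gcoord -[lshift m i]/(unsplit (inl i)) (unsplitK (inl i)).
      rewrite (_ : gcst m (z 0 i) - gcst m (y 0 i) = gcst m (z 0 i - y 0 i)).
        by rewrite gcstM !ffunE; case: ifP; rewrite ?mulr0.
      by apply/ffunP => K''; rewrite !ffunE; case: ifP; rewrite ?subrr.
    rewrite (eq_bigr _ (fun i _ => E i)).
    by case: ifP => // _; rewrite big1 ?addr0.
  rewrite (lderD dD) // (lder_cst dD) // add0r (lder_sum dD) // (crep_sum Wc) //.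
  rewrite big1 // => i _.
  have e1 : spar X false (res W (coord c (lshift m i)) - cst X (y 0 i)).
    apply: sparB; last exact: spar_cst.
    have := @coord_par W (lshift m i) Wc; rewrite (_ : ipar _ = false) //.
    by rewrite /ipar /= leqNgt ltn_ord.
  rewrite (lderM dD _ WU e1) (lderB dD) // DW (lder_cst dD) // subr0 mul0r add0r.
  rewrite andbF expr0 mul1r (crepM (c := c)) // (crepB (c := c)) // crep_coord //.
  rewrite (crep_cst (c := c)) // /gcoord -[lshift m i]/(unsplit (inl i)).
  rewrite (unsplitK (inl i)) subrr.
  by apply/ffunP => K'; rewrite !ffunE big1 // => I _; rewrite ffunE mulr0 mul0r.
have [K0|[j0 jK0]] := set_0Vmem K; first by apply: IH => //; rewrite K0 cards0.
have [j jK jmin] : exists2 j, j \in K & forall k, k \in (K :\ j)%SET -> (j < k)%N.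
  case: (@arg_minnP _ j0 (mem K) (fun k => val k) jK0) => j jK jmin; exists j => //.
  move=> k; rewrite !inE => /andP[kj kK]; rewrite ltn_neqAle jmin //.
  by rewrite andbT eq_sym; exact: kj.
pose xi := res W (coord c (rshift n j)).
have ixi : ipar (rshift n j) = true by rewrite /ipar /= leq_addr.
have exi z : (cmap c @` W) z -> crep c xi z = ggen R j.
  move=> Bz; rewrite crep_coord // /gcoord -[rshift n j]/(unsplit (inr j)).
  by rewrite (unsplitK (inr j)).
have -> : csec c W (fun z => gmono K (g z)) =
    xi * csec c W (fun z => gmono (K :\ j)%SET (g z)).
  apply: csec_eq => //; first exact: sm.
  move=> z Bz; rewrite (crepM (c := c)) // exi // csecK //; last exact: sm.
  by rewrite gmono_gen // finset.setD1K.
have oxi : spar X true xi by rewrite -ixi; exact: coord_par.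
rewrite (lderM dD _ WU oxi) DW mul0r add0r (crep_sign Wc) //.
rewrite (crepM (c := c)) // IH //; last first.
  by move: KN; rewrite (cardsD1 j) jK add1n ltnS.
by apply/ffunP => K'; rewrite !ffunE big1 ?mulr0 // => I _; rewrite ffunE mulr0.
Qed.

End ChartDerivations.

(** Evaluates the parity signs once the parities involved have been split into
    cases. *)
Ltac signs := rewrite ?(andbF, andbT, addbF, addbT) /= ?expr0 ?expr1.

Section ChartRules.
Variables (R : realType) (M : topologicalType) (X : superspace R M).
Variables (n m : nat) (c : chart X n m).
Implicit Types (U V W : opens M) (a b : 'I_(n + m)).

Lemma pd_cstM U a r (f : X U) : U `<=` cdom c ->
  pd c a (cst X r * f) = cst X r * pd c a f.
Proof.
by move=> Uc; rewrite (pdM Uc _ _ (spar_cst X U r)) pd_cst // mul0r add0r andbF expr0 mul1r.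
Qed.

(** The supercommutator of two coordinate derivations kills the coordinates. *)
Lemma pdC U a b (f : X U) : U `<=` cdom c ->
  pd c a (pd c b f) = (-1) ^+ (ipar a && ipar b) * pd c b (pd c a f).
Proof.
move=> Uc; apply/eqP; rewrite -subr_eq0; apply/eqP.
pose D V (f : X V) := pd c a (pd c b f) - (-1) ^+ (ipar a && ipar b) * pd c b (pd c a f).
suff dD : local_der (ipar a (+) ipar b) U D.
  apply: (lder_coord0 (c := c) Uc dD) => // k.
  rewrite /D !pd_coord //.
  have z k' l : pd c k' ((l == k)%:R : X U) = 0.
    by case: eqP => _; rewrite /= ?mulr1n ?mulr0n ?pd0 // -(cst1 X U) pd_cst.
  by rewrite !z mulr0 subrr.
have Vc V : V `<=` U -> V `<=` cdom c by move=> VU; exact: subset_trans Uc.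
split; rewrite /D.
- by move=> V g h VU; have := Vc V VU => {}VU; rewrite !pdD //; nc_ring.
- move=> V r VU; have := Vc V VU => {}VU.
  by rewrite !(pd_cst VU) !(pd0 VU) mulr0 subrr.
- move=> V q g h VU hg; have := Vc V VU => {}VU.
  rewrite !(pdM VU _ _ hg) !(pdD VU) !(pd_sign VU) !(pdM VU _ _ hg).
  rewrite (pdM VU _ _ (pd_par VU a hg)) (pdM VU _ _ (pd_par VU b hg)).
  by case: (ipar a); case: (ipar b); case: (q); signs; nc_ring.
- move=> V W g VU WV; have := Vc V VU => {}VU.
  by rewrite resB // resM // res_sign // !pd_res.
Qed.

End ChartRules.

Section ChainRule.
Variables (R : realType) (M : topologicalType) (X : superspace R M).
Variables (n m : nat) (c c' : chart X n m).
Implicit Types (U V W : opens M) (a b : 'I_(n + m)).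

Lemma jac_par U a b : U `<=` cdom c -> U `<=` cdom c' ->
  spar X (ipar a (+) ipar b) (jac c c' U a b).
Proof. by move=> Uc Uc'; rewrite mxE addbC; apply: pd_par => //; exact: coord_par. Qed.

Lemma res_jac U V a b : U `<=` cdom c -> U `<=` cdom c' -> V `<=` U ->
  res V (jac c c' U a b) = jac c c' V a b.
Proof. by move=> Uc Uc' VU; rewrite !mxE -pd_res // res_comp. Qed.

(** The difference of the two sides, as a function of f, is a derivation which
    kills the coordinates of the second chart. *)
Lemma chain_rule U a (f : X U) : U `<=` cdom c -> U `<=` cdom c' ->
  pd c a f = \sum_b jac c c' U a b * pd c' b f.
Proof.
move=> Uc Uc'; apply/eqP; rewrite -subr_eq0; apply/eqP.
pose D V (f : X V) := pd c a f - \sum_b jac c c' V a b * pd c' b f.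
suff dD : local_der (ipar a) U D.
  apply: (lder_coord0 (c := c') Uc' dD) => // k.
  rewrite /D (bigD1 k) //= big1 => [|b bk]; last by rewrite pd_coord // (negPf bk) mulr0.
  by rewrite pd_coord // eqxx mulr1 addr0 mxE subrr.
have Vc V : V `<=` U -> V `<=` cdom c by move=> VU; exact: subset_trans Uc.
have Vc' V : V `<=` U -> V `<=` cdom c' by move=> VU; exact: subset_trans Uc'.
split; rewrite /D.
- move=> V g h VU; rewrite pdD; last exact: Vc.
  under eq_bigr => b _ do rewrite (pdD (Vc' V VU)) mulrDr.
  by rewrite big_split /=; nc_ring.
- move=> V r VU; rewrite (pd_cst (Vc V VU)) big1 ?subrr // => b _.
  by rewrite (pd_cst (Vc' V VU)) mulr0.
- move=> V q g h VU hg; rewrite (pdM (Vc V VU) _ _ hg).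
  rewrite (eq_bigr (fun b => jac c c' V a b * pd c' b g * h +
      (-1) ^+ (ipar a && q) * (g * (jac c c' V a b * pd c' b h)))).
    by rewrite big_split /= -mulr_suml -!mulr_sumr; nc_ring.
  move=> b _; rewrite (pdM (Vc' V VU) _ _ hg) mulrDr -!mulrA; congr (_ + _).
  rewrite [g * (_ * _)]mulrA (supercomm hg (jac_par a b (Vc V VU) (Vc' V VU))).
  by case: (ipar a); case: (ipar b); case: (q); signs; nc_ring.
- move=> V W g VU WV; rewrite resB // res_sum // pd_res //; last exact: Vc.
  congr (_ - _); apply: eq_bigr => b _; rewrite resM // res_jac //; try exact: Vc.
    by rewrite pd_res //; exact: Vc'.
  exact: Vc'.
Qed.

Lemma jac_inv U : U `<=` cdom c -> U `<=` cdom c' -> jac c c' U *m jac c' c U = 1%:M.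
Proof.
move=> Uc Uc'; apply/matrixP => a b; rewrite !mxE -(pd_coord a b Uc) (chain_rule _ _ Uc Uc').
by apply: eq_bigr => k _; rewrite [X in _ * X = _]mxE.
Qed.

End ChainRule.

(** * Real powers of even sections *)

Section Rbin.
Variable R : realType.
Implicit Types (w : R) (k : nat).

Lemma rbin0 w : rbin w 0 = 1.
Proof. by rewrite /rbin big_ord0 fact0 divr1. Qed.

(** The two ways of lowering w in a binomial coefficient are what the derivative
    of the binomial series needs: one for the powers of the body, the other for
    those of the soul. *)
Lemma rbin_shift w k : rbin w k * (w - k%:R) = w * rbin (w - 1) k.
Proof.
rewrite /rbin mulrAC mulrA; congr (_ / _).
transitivity (\prod_(j < k.+1) (w - j%:R)); first by rewrite big_ord_recr.
rewrite big_ord_recl /= subr0; congr (_ * _); apply: eq_bigr => j _.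
by rewrite /bump /= natrD; ring.
Qed.

Lemma rbinS w k : rbin w k.+1 * k.+1%:R = w * rbin (w - 1) k.
Proof.
rewrite -rbin_shift /rbin factS natrM big_ord_recr /=.
have k0 : k.+1%:R != 0 :> R by rewrite pnatr_eq0.
have kf : k`!%:R != 0 :> R by rewrite pnatr_eq0 -lt0n fact_gt0.
by field; rewrite kf addrC natr1.
Qed.

Lemma rbin_pascal w k : rbin w k.+1 = rbin (w - 1) k.+1 + rbin (w - 1) k.
Proof.
have k0 : k.+1%:R != 0 :> R by rewrite pnatr_eq0.
apply: (mulIf k0); rewrite mulrDl !rbinS.
by have := rbin_shift (w - 1) k => <-; rewrite -natr1; ring.
Qed.

Lemma rbin00 k : rbin (0 : R) k.+1 = 0.
Proof. by rewrite /rbin big_ord_recl subr0 mul0r mul0r. Qed.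

Lemma rbin1S k : rbin (1 : R) k.+2 = 0.
Proof. by rewrite /rbin !big_ord_recl /= /bump /= subrr !(mul0r, mulr0). Qed.

Lemma rbin11 : rbin (1 : R) 1 = 1.
Proof. by rewrite /rbin big_ord_recl big_ord0 subr0 mulr1 divr1. Qed.

End Rbin.

Section Powers.
Variables (R : realType) (M : topologicalType) (X : superspace R M).
Variables (n m : nat) (c : chart X n m).
Variable U : opens M.
Hypothesis Uc : U `<=` cdom c.
Local Notation B := (cmap c @` U).

Lemma csec_crep (F : 'rV[R]_n -> grassmann R m) (f : X U) :
  (forall y, B y -> F y = crep c f y) -> csec c U F = f.
Proof.
move=> Ff; apply: csec_eq => // [K k|y By]; last by rewrite Ff.
apply: (Ck_ext (cmap_open Uc) _ (crep_smooth f Uc K k)) => y By; by rewrite Ff.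
Qed.

Lemma crepX (f : X U) k y : B y -> crep c (f ^+ k) y = iter k (gmul (crep c f y)) (gcst m 1).
Proof.
move=> By; elim: k => [|k IH]; last by rewrite exprS (crepM (c := c)) // IH.
by rewrite expr0 -(cst1 X U) (crep_cst (c := c)).
Qed.

Lemma sparX (f : X U) k : spar X false f -> spar X false (f ^+ k).
Proof.
move=> hf; elim: k => [|k IH]; first by rewrite expr0; exact: spar1.
by rewrite exprS; apply: sparMl.
Qed.

Lemma gbody_smooth (f : X U) k : Ck k B (fun y => gbody (crep c f y)).
Proof. exact: (crep_smooth f Uc). Qed.

(** An identity between solutions of linear equations along the odd
    coordinates can be checked on bodies. *)
Lemma odd_unique (f p q : X U) (h : 'I_(n + m) -> X U) :
  snonvanishing c f ->
  (forall a, ipar a -> spar X true (h a)) ->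
  (forall a, ipar a -> f * pd c a p = h a * p) ->
  (forall a, ipar a -> f * pd c a q = h a * q) ->
  (forall y, B y -> gbody (crep c p y) = gbody (crep c q y)) -> p = q.
Proof.
move=> f0 ho Hp Hq bpq; apply/eqP; rewrite -subr_eq0; apply/eqP.
apply: (crep_inj Uc) => y By; rewrite (crep0 Uc) //.
have ij (j : 'I_m) : ipar (rshift n j) by rewrite /ipar /= leq_addr.
apply: (@gder_unique R m (crep c f y) _ (fun j => crep c (h (rshift n j)) y)).
- exact: f0.
- by move=> j; apply: gbody_odd; exact: (crep_par _ _ Uc).1 (ho _ (ij j)) _ By.
- rewrite (crepB (c := c)) // /gbody !ffunE.
  by move: (bpq _ By); rewrite /gbody => ->; rewrite subrr.
- move=> j; rewrite -(gpartial_odd (crep c (p - q)) y (erefl (rshift n j))).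
  rewrite -crep_pd // -!(crepM (c := c)) //; congr crep.
  by rewrite pdB // !mulrBr Hp ?ij // Hq ?ij.
Qed.

Section OnePower.
Variable f : X U.
Hypotheses (fe : spar X false f) (f0 : snonvanishing c f).

Let v y := Num.sg (gbody (crep c f y)) * gbody (crep c f y).

Let v_norm y : v y = `|gbody (crep c f y)|.
Proof. by rewrite /v -normrEsg. Qed.

Let v_gt0 y : B y -> 0 < v y.
Proof. by move=> By; rewrite v_norm normr_gt0 f0. Qed.

Let oB : open B := cmap_open Uc.

(** By continuity the sign of a nowhere vanishing body is locally constant. *)
Lemma Ck_sg k : Ck k B (fun y => Num.sg (gbody (crep c f y))).
Proof.
apply: Ck_near => // y By; have := f0 By; rewrite /gbody => fy0.
have cf := Ck_cont (crep_smooth f Uc finset.set0 0) By.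
have [lt0|gt0|/eqP] := ltgtP (crep c f y finset.set0) 0; last by rewrite (negPf fy0).
  have N : nbhs y [set z | crep c f z finset.set0 < 0] := cvgr_lt _ cf _ lt0.
  have [r /= r0 WB] := (nbhs_ballP _ _).1 (N (nbhs_filter y)).
  exists (ball y r), (fun=> -1).
split; [exact: ball_open|exact: ballxx|exact: Ck_cst|].
  by move=> z Wz; rewrite /gbody ltr0_sg //; exact: WB.
have N : nbhs y [set z | 0 < crep c f z finset.set0] := cvgr_gt _ cf _ gt0.
have [r /= r0 WB] := (nbhs_ballP _ _).1 (N (nbhs_filter y)).
exists (ball y r), (fun=> 1).
split; [exact: ball_open|exact: ballxx|exact: Ck_cst|].
by move=> z Wz; rewrite /gbody gtr0_sg //; exact: WB.
Qed.

Let Ck_v k : Ck k B v.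
Proof. by apply: CkM => //; [exact: Ck_sg|exact: gbody_smooth]. Qed.

(** The binomial series of |f|^w is expanded in the powers of the soul of |f|, with
    real powers of its body as coefficients. *)
Definition sabs : X U :=
  csec c U (fun y => [ffun K => Num.sg (gbody (crep c f y)) * crep c f y K]).
Definition sbpow (s : R) : X U := csec c U (fun y => gcst m (v y `^ s)).
Definition ssoul : X U := sabs - sbpow 1.

Lemma crep_sabs y : B y ->
  crep c sabs y = [ffun K => Num.sg (gbody (crep c f y)) * crep c f y K].
Proof.
move=> By; rewrite csecK // => K k.
apply: (Ck_ext oB _ (CkM oB (Ck_sg k) (crep_smooth f Uc K k))) => z _.
by rewrite ffunE.
Qed.

Lemma crep_sbpow s y : B y -> crep c (sbpow s) y = gcst m (v y `^ s).
Proof.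
move=> By; rewrite csecK // => K k; have [->|K0] := eqVneq K finset.set0.
  by apply: (Ck_ext oB _ (Ck_powR s oB v_gt0 (Ck_v k))) => z _; rewrite ffunE eqxx.
by apply: (Ck_ext oB _ (Ck_cst k B 0)) => z _; rewrite ffunE (negPf K0).
Qed.

Lemma sabs_par : spar X false sabs.
Proof.
apply/(crep_par _ _ Uc) => y By K Ko; rewrite crep_sabs // ffunE.
by rewrite ((crep_par _ _ Uc).1 fe y By) // mulr0.
Qed.

Lemma sbpow_par s : spar X false (sbpow s).
Proof.
apply/(crep_par _ _ Uc) => y By K Ko; rewrite crep_sbpow // ffunE.
have [K0|//] := eqVneq K finset.set0; by rewrite K0 cards0 in Ko.
Qed.

Lemma ssoul_par : spar X false ssoul.
Proof. by apply: sparB; [exact: sabs_par|exact: sbpow_par]. Qed.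

Lemma crep_ssoul y : B y ->
  crep c ssoul y = [ffun K => Num.sg (gbody (crep c f y)) * crep c f y K] - gcst m (v y).
Proof.
by move=> By; rewrite (crepB (c := c)) // crep_sabs // crep_sbpow // powRr1 //; exact: ltW (v_gt0 By).
Qed.

Lemma sbpowD s t : sbpow s * sbpow t = sbpow (s + t).
Proof.
apply: (crep_inj Uc) => y By; rewrite (crepM (c := c)) // !crep_sbpow // gcstM.
apply/ffunP => K; rewrite !ffunE powRD; last by rewrite (gt_eqF (v_gt0 By)) implybT.
by case: ifP; rewrite ?mulr0.
Qed.

Lemma sbpow0 : sbpow 0 = 1.
Proof.
apply: (crep_inj Uc) => y By; rewrite crep_sbpow // powRr0.
by rewrite -(cst1 X U) (crep_cst (c := c)).
Qed.

Lemma pd_sbpow a s : pd c a (sbpow s) = cst X s * sbpow (s - 1) * pd c a (sbpow 1).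
Proof.
apply: (crep_inj Uc) => y By; rewrite -mulrA crep_cstM // (crepM (c := c)) //.
rewrite !crep_pd // crep_sbpow // gcstM.
rewrite (gpartial_eq Uc _ By (fun z Bz => crep_sbpow s Bz)).
rewrite (gpartial_eq Uc _ By (fun z Bz => crep_sbpow 1 Bz)).
case: (iparP a) => [i|j] E; apply/ffunP => K.
  rewrite !(gpartial_even _ _ E) !ffunE.
  have [->|K0] := eqVneq K finset.set0.
    have D t := derive_powR t (v_gt0 By) (Ck_derivable (i := i) (Ck_v 1) By).
    have D' t : 'D_(delta_mx 0 i) (fun z => gcst m (v z `^ t) finset.set0) y =
        t * v y `^ (t - 1) * 'D_(delta_mx 0 i) v y.
      rewrite (_ : (fun z => _) = (fun z => v z `^ t)); first by have [_ ->] := D t.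
      by apply/funext => z; rewrite ffunE eqxx.
    by rewrite !D' subrr powRr0; ring.
  have D' t : 'D_(delta_mx 0 i) (fun z => gcst m (v z `^ t) K) y = 0.
    rewrite (_ : (fun z => _) = (fun=> 0)) ?derive_cst //.
    by apply/funext => z; rewrite ffunE (negPf K0).
  by rewrite !D' !mulr0.
rewrite !(gpartial_odd _ _ E) !ffunE; case: ifP => _; rewrite ?mulr0 //.
rewrite (_ : (j |: K == finset.set0)%SET = false) ?mulr0 //.
by apply/negbTE/set0Pn; exists j; exact: setU11.
Qed.

(** The soul has no part of degree 0, being a soul, and none of degree 1, being
    even. *)
Lemma ssoul_deg y : B y -> gdeg 2 (crep c ssoul y).
Proof.
move=> By K K2; have [K0|K1] := posnP #|K|; last first.
  apply: ((crep_par _ _ Uc).1 ssoul_par y By); by have -> : #|K| = 1%N by lia.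
have /eqP := K0; rewrite cards_eq0 => /eqP ->.
by rewrite crep_ssoul // !ffunE eqxx /v /gbody subrr.
Qed.

Lemma ssoulX_deg k y : B y -> gdeg (2 * k) (crep c (ssoul ^+ k) y).
Proof.
move=> By; elim: k => [|k IH]; first by move=> K; rewrite ltn0.
by rewrite exprS (crepM (c := c)) // mulnS; apply: gdegM => //; exact: ssoul_deg.
Qed.

Lemma ssoulX_top : ssoul ^+ m.+1 = 0.
Proof.
apply: (crep_inj Uc) => y By; rewrite (crep0 Uc) //; apply: gdeg_top => K Km.
by apply: ssoulX_deg => //; lia.
Qed.

(** The derivative of the soul still has positive degree, so this product has
    degree at least 2m + 1. It is the term by which differentiation of the
    truncated series could have missed. *)
Lemma ssoulX_pd_top a : ssoul ^+ m * pd c a ssoul = 0.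
Proof.
apply: (crep_inj Uc) => y By; rewrite (crep0 Uc) //; apply: gdeg_top => K Km.
have d1 : gdeg 1 (crep c (pd c a ssoul) y).
  rewrite crep_pd //; case: (iparP a) => [i|j] E.
    move=> K' K1; rewrite (gpartial_even _ _ E) ffunE.
    rewrite (near_eq_derive (g := fun=> 0)) ?derive_cst //.
    apply: filterS (open_nbhs_nbhs (conj oB By)) => z Bz.
    by apply: ssoul_deg => //; lia.
  by rewrite (gpartial_odd _ _ E); apply: gder_deg; exact: ssoul_deg.
have H := gdegM (@ssoulX_deg m y By) d1.
by rewrite (crepM (c := c)) //; apply: H; lia.
Qed.

Lemma gpow_series w y : B y -> gpow (crep c f y) w =
  crep c (\sum_(k < m.+1) cst X (rbin w k) * sbpow (w - k%:R) * ssoul ^+ k) y.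
Proof.
move=> By; rewrite (crep_sum Uc) // /gpow.
have -> : gbody [ffun K => Num.sg (gbody (crep c f y)) * crep c f y K] = v y.
  by rewrite /gbody ffunE.
apply: eq_bigr => k _.
rewrite (crepM (c := c)) // (crepM (c := c)) // (crep_cst (c := c)) // crep_sbpow //.
rewrite crepX // crep_ssoul //.
suff -> : gmul (gcst m (rbin w k)) (gcst m (v y `^ (w - k%:R))) =
    gcst m (rbin w k * v y `^ (w - k%:R)) by [].
by rewrite gcstM; apply/ffunP => K; rewrite !ffunE; case: ifP; rewrite ?mulr0.
Qed.

Lemma spow_series w : spow c f w =
  \sum_(k < m.+1) cst X (rbin w k) * sbpow (w - k%:R) * ssoul ^+ k.
Proof. by apply: csec_crep => y; exact: gpow_series. Qed.

Lemma crep_spow w y : B y -> crep c (spow c f w) y = gpow (crep c f y) w.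
Proof. by move=> By; rewrite spow_series gpow_series. Qed.

Lemma spow_par w : spar X false (spow c f w).
Proof.
rewrite spow_series; apply: spar_sum => k _.
by apply: sparMl (sparX _ ssoul_par); apply: spar_cstM; exact: sbpow_par.
Qed.

Lemma spow0 : spow c f 0 = 1.
Proof.
rewrite spow_series big_ord_recl /= rbin0 cst1 subr0 sbpow0 !mul1r.
by rewrite big1 ?addr0 // => k _; rewrite rbin00 cst0 !mul0r.
Qed.

Lemma spow1 : spow c f 1 = sabs.
Proof.
rewrite spow_series big_ord_recl /= rbin0 cst1 subr0 mul1r mulr1 -[RHS](subrK (sbpow 1)).
rewrite -/ssoul addrC; congr (_ + _).
have := ssoulX_top; case: (m) => [|m'].
  by rewrite big_ord0 expr1.
move=> _; rewrite big_ord_recl big1 ?addr0 /= => [|k _].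
  by rewrite /bump /= rbin11 cst1 subrr sbpow0 !mul1r expr1.
by rewrite rbin1S cst0 !mul0r.
Qed.

Lemma gbody_spow w y : B y -> gbody (crep c (spow c f w) y) = `|gbody (crep c f y)| `^ w.
Proof.
move=> By; rewrite spow_series big_ord_recl (crepD Uc) // /gbody ffunE.
rewrite /= rbin0 cst1 subr0 mul1r mulr1 crep_sbpow // ffunE eqxx v_norm /gbody.
rewrite (crep_sum Uc) // sum_ffunE big1 ?addr0 // => k _.
rewrite exprS mulrA -/(gbody _) !(crepM (c := c)) // !gbodyM.
have -> : gbody (crep c ssoul y) = 0.
  by apply/gdeg1P => K K1; apply: ssoul_deg => //; exact: ltnW.
by rewrite mulr0 mul0r.
Qed.

(** Pascal's rule for the binomial series, with |f| split into body and soul;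
    the term lost by truncation is a vanishing power of the soul. *)
Lemma sabs_spow w : sabs * spow c f (w - 1) = spow c f w.
Proof.
have E1 r s k : sbpow 1 * (cst X r * sbpow s * ssoul ^+ k) =
    cst X r * sbpow (1 + s) * ssoul ^+ k.
  by rewrite -sbpowD !mulrA -(cst_comm r (sbpow 1)).
have E2 r s k : ssoul * (cst X r * sbpow s * ssoul ^+ k) =
    cst X r * sbpow s * ssoul ^+ k.+1.
  by rewrite (even_comm _ ssoul_par) -mulrA -exprSr.
have -> : sabs = sbpow 1 + ssoul by rewrite addrC subrK.
rewrite mulrDl !spow_series !mulr_sumr (eq_bigr _ (fun _ _ => E1 _ _ _)).
rewrite (eq_bigr _ (fun _ _ => E2 _ _ _)) [X in _ + X]big_ord_recr /= ssoulX_top mulr0 addr0.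
rewrite !big_ord_recl -addrA -big_split /=; congr (_ + _).
  by rewrite !rbin0; congr (_ * sbpow _ * _); ring.
apply: eq_bigr => k _; rewrite /bump /= add1n (rbin_pascal w) cstD !mulrDl.
by congr (_ * sbpow _ * _ + _ * sbpow _ * _); rewrite -?natr1; ring.
Qed.

(** The binomial series is differentiated termwise. The derivative of the powers
    of the body and that of the powers of the soul produce the same series of
    exponent w - 1. *)
Lemma pd_spow a w : pd c a (spow c f w) = cst X w * spow c f (w - 1) * pd c a sabs.
Proof.
have pdX k : pd c a (ssoul ^+ k.+1) = cst X k.+1%:R * ssoul ^+ k * pd c a ssoul.
  elim: k => [|k IH]; first by rewrite expr1 expr0 cst1 !mul1r.
  rewrite exprS (pdM Uc _ _ ssoul_par) IH andbF expr0 mul1r -(natr1 k.+1) cstD cst1.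
  rewrite -(even_comm (pd c a ssoul) (sparX k.+1 ssoul_par)) !mulrA.
  by rewrite -(cst_comm _ ssoul) -[cst X _ * _ * _]mulrA -exprS; nc_ring.
have sC k (g : X U) : ssoul ^+ k * g = g * ssoul ^+ k by apply: even_comm; exact: sparX ssoul_par.
rewrite !spow_series (pd_sum Uc).
rewrite (eq_bigr (fun k : 'I_m.+1 =>
    cst X w * (cst X (rbin (w - 1) k) * sbpow (w - 1 - k%:R) * ssoul ^+ k) * pd c a (sbpow 1)
  + cst X (rbin w k) * sbpow (w - k%:R) * pd c a (ssoul ^+ k))); last first.
  move=> k _; rewrite (pdM Uc _ _ (spar_cstM _ (sbpow_par _))) pd_cstM // pd_sbpow.
  rewrite andbF expr0 mul1r; congr (_ + _).
  rewrite !mulrA -cstM rbin_shift cstM -!mulrA -sC; congr (_ * (_ * (_ * _))).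
  by congr sbpow; ring.
rewrite big_split /= -mulr_suml -mulr_sumr.
have -> : pd c a sabs = pd c a (sbpow 1) + pd c a ssoul.
  by rewrite -pdD // /ssoul addrC subrK.
rewrite mulrDr; congr (_ + _).
rewrite big_ord_recl /= expr0 (_ : pd c a 1 = 0); last by rewrite -(cst1 X U) pd_cst.
rewrite mulr0 add0r.
rewrite mulr_sumr mulr_suml [RHS]big_ord_recr /=.
rewrite [X in _ = _ + X](_ : _ = 0) ?addr0; last first.
  by rewrite -!mulrA ssoulX_pd_top !mulr0.
apply: eq_bigr => k _; rewrite /bump /= add1n pdX.
rewrite !mulrA -[_ * sbpow _ * cst X _]mulrA -cst_comm !mulrA -cstM rbinS cstM.
by congr (_ * _ * sbpow _ * _ * _); rewrite -natr1; ring.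
Qed.

(** The differential equation of a power, in the form to which odd_unique
    applies. *)
Lemma spow_log a w : sabs * pd c a (spow c f w) = (cst X w * pd c a sabs) * spow c f w.
Proof.
rewrite pd_spow -(sabs_spow w) !mulrA -(cst_comm _ sabs).
have se := sabs_par; have we := spow_par (w - 1).
by rewrite -!mulrA; congr (_ * _); rewrite mulrA (even_comm (pd c a sabs) (sparMl se we)).
Qed.

Lemma sabs_nonvanishing : snonvanishing c sabs.
Proof.
move=> y By; rewrite -spow1 gbody_spow // powRr1 // normr_eq0; exact: f0.
Qed.

Lemma sabs_log_par a w : ipar a -> spar X true (cst X w * pd c a sabs).
Proof.
by move=> ha; apply: spar_cstM; have := pd_par Uc a sabs_par; rewrite ha.
Qed.

Lemma sabs_sqr : sabs * sabs = f * f.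
Proof.
apply: (crep_inj Uc) => y By; rewrite !(crepM (c := c)) // !crep_sabs //.
apply/ffunP => K; rewrite !ffunE; apply: eq_bigr => I _; rewrite !ffunE.
rewrite [LHS](_ : _ = (Num.sg (gbody (crep c f y)) ^+ 2) *
  (gsign R I (K :\: I)%SET * crep c f y I * crep c f y (K :\: I)%SET)); last by ring.
by rewrite sqr_sg (f0 By) mul1r.
Qed.

Lemma sabs_pos : spositive c f -> sabs = f.
Proof.
move=> fpos; apply: (crep_inj Uc) => y By; rewrite crep_sabs // gtr0_sg; last exact: fpos.
by apply/ffunP => K; rewrite ffunE mul1r.
Qed.

End OnePower.
End Powers.

Section Bodies.
Variables (R : realType) (M : topologicalType) (X : superspace R M).
Variables (n m : nat).
Implicit Types (c : chart X n m) (U V W : opens M).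

Definition sbody c U (f : X U) x : R := gbody (crep c f (cmap c x)).

Section OneChart.
Variables (c : chart X n m) (U : opens M) (x : M).
Hypotheses (Uc : U `<=` cdom c) (Ux : oset U x).
Implicit Types f g : X U.

Let By : (cmap c @` U) (cmap c x).
Proof. by exists x. Qed.

Lemma sbodyB f g : sbody c (f - g) x = sbody c f x - sbody c g x.
Proof. by rewrite /sbody (crepB (c := c)) // /gbody !ffunE. Qed.

Lemma sbodyM f g : sbody c (f * g) x = sbody c f x * sbody c g x.
Proof. by rewrite /sbody (crepM (c := c)) // gbodyM. Qed.

Lemma sbody_cst r : sbody c (cst X r : X U) x = r.
Proof. by rewrite /sbody (crep_cst (c := c)) // /gbody ffunE eqxx. Qed.

Lemma sbody_odd f : spar X true f -> sbody c f x = 0.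
Proof. by move=> fo; apply: gbody_odd; exact: (crep_par _ _ Uc).1 fo _ By. Qed.

Lemma sbody_res V f : V `<=` U -> oset V x -> sbody c (res V f) x = sbody c f x.
Proof. by move=> VU Vx; rewrite /sbody (crep_res (c := c)) //; exists x. Qed.

End OneChart.

Lemma snonvanishingP c U (f : X U) :
  snonvanishing c f <-> forall x, oset U x -> sbody c f x != 0.
Proof. by split=> [h x Ux|h _ [x Ux <-]]; [apply: h; exists x|exact: h]. Qed.

Lemma spositiveP c U (f : X U) :
  spositive c f <-> forall x, oset U x -> 0 < sbody c f x.
Proof. by split=> [h x Ux|h _ [x Ux <-]]; [apply: h; exists x|exact: h]. Qed.

Lemma spositive_nonvanishing c U (f : X U) : spositive c f -> snonvanishing c f.
Proof. by move=> h y By; rewrite gt_eqF // h. Qed.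

Lemma sbody_locus c U (f : X U) : U `<=` cdom c ->
  open [set x | oset U x /\ sbody c f x != 0].
Proof.
move=> Uc; rewrite openE => x [Ux fx]; apply: filterI.
  by apply: open_nbhs_nbhs; split => //; exact: openP.
have cf := Ck_cont (gbody_smooth Uc f 0) (imageP (cmap c) Ux).
have N : nbhs (cmap c x) [set y | gbody (crep c f y) != 0].
  exact: (cvgr_neq0 (F := nbhs (cmap c x)) _ cf fx).
exact: (cmap_cont (Uc _ Ux)) _ N.
Qed.

(** The body of a section at a point is the only real number whose difference
    with the section is not invertible near that point, hence it does not depend
    on the chart. *)
Lemma sbody_chart c c' U (f : X U) x : U `<=` cdom c -> U `<=` cdom c' ->
  oset U x -> sbody c f x = sbody c' f x.
Proof.
move=> Uc Uc' Ux.
suff H (g : X U) : spar X false g -> sbody c g x = sbody c' g x.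
  have [g [ge go]] := spar_dec f; have := H g ge.
  have := sbody_odd Uc Ux go; have := sbody_odd Uc' Ux go; rewrite !sbodyB //.
  by move=> /eqP; rewrite subr_eq0 => /eqP -> /eqP; rewrite subr_eq0 => /eqP -> ->.
move=> ge; set r := sbody c g x; pose h := g - cst X r.
have he : spar X false h by apply: sparB => //; exact: spar_cst.
have h0 : sbody c h x = 0 by rewrite /h sbodyB // sbody_cst // subrr.
suff : sbody c' h x == 0 by rewrite /h sbodyB // sbody_cst // subr_eq0 => /eqP.
apply/negPn/negP => hx.
pose W := Opens (sbody_locus h Uc').
have WU : W `<=` U by move=> z [].
have Wx : oset W x by [].
have Wc : W `<=` cdom c by exact: subset_trans WU Uc.
have Wc' : W `<=` cdom c' by exact: subset_trans WU Uc'.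
have hWe : spar X false (res W h) by exact: res_par.
have hW0 : snonvanishing c' (res W h).
  by apply/snonvanishingP => z Wz; rewrite sbody_res //; case: Wz.
(* Where the body of h in the chart c' does not vanish, |h| |h|^(-1) = 1 and
   |h|^2 = h^2, which is impossible at x, where the body of h in the chart c
   vanishes. *)
have := sabs_spow Wc' hWe hW0 0; rewrite spow0 // => E.
have sq := sabs_sqr Wc' hW0.
have := congr1 (fun u => sbody c u x) E; rewrite sbodyM // -(cst1 X W) sbody_cst //.
have := congr1 (fun u => sbody c u x) sq; rewrite !sbodyM // sbody_res // h0 mul0r.
move=> /eqP; rewrite mulf_eq0 orbb => /eqP ->; rewrite mul0r => /eqP.
by rewrite eq_sym oner_eq0.
Qed.

Section PowerLaws.
Variables (c : chart X n m) (U : opens M).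
Hypothesis Uc : U `<=` cdom c.
Implicit Types f g : X U.

Lemma sbody_spow f w x : spar X false f -> snonvanishing c f -> oset U x ->
  sbody c (spow c f w) x = `|sbody c f x| `^ w.
Proof. by move=> fe f0 Ux; rewrite /sbody gbody_spow //; exists x. Qed.

Lemma spow_res V f w : V `<=` U -> spar X false f -> snonvanishing c f ->
  res V (spow c f w) = spow c (res V f) w.
Proof.
move=> VU fe f0; have Vc : V `<=` cdom c by apply: subset_trans Uc.
have fV0 : snonvanishing c (res V f).
  apply/snonvanishingP => x Vx; rewrite sbody_res //.
  by apply: (snonvanishingP _ _).1 f0 _ _; exact: VU.
apply: (crep_inj Vc) => y By; have BUy : (cmap c @` U) y by case: By => x /VU ? <-; exists x.
rewrite (crep_res (c := c)) // (crep_spow Uc) // (crep_spow Vc) //.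
  by rewrite (crep_res (c := c)).
Qed.

(** Both sides solve the same first order equations, hence they agree as soon as
    their bodies do; the other laws of powers are obtained in the same way. *)
Lemma spowD f v w : spar X false f -> snonvanishing c f ->
  spow c f v * spow c f w = spow c f (v + w).
Proof.
move=> fe f0; pose s := sabs c f.
have se : spar X false s by exact: sabs_par.
have ve := spow_par Uc fe f0 v.
apply: (@odd_unique R M X n m c U Uc s _ _ (fun a => cst X (v + w) * pd c a s)).
- exact: sabs_nonvanishing.
- by move=> a ha; exact: sabs_log_par.
- move=> a _; have L t : s * pd c a (spow c f t) = cst X t * pd c a s * spow c f t.
    exact: spow_log.
  rewrite (pdM Uc _ _ ve) andbF expr0 mul1r mulrDr mulrA L.
  rewrite [s * (_ * _)]mulrA -(even_comm s ve) -[_ * s * _]mulrA L cstD.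
  rewrite [spow c f v * _]mulrA [spow c f v * _](even_comm _ ve).
  by nc_ring.
- by move=> a _; exact: spow_log.
- move=> _ [x Ux <-]; rewrite -!/(sbody _ _ _) sbodyM // !sbody_spow // powRD //.
  by apply/implyP => _; rewrite normr_eq0; exact: (snonvanishingP _ _).1 f0 _ Ux.
Qed.

Lemma spowNr f w : spar X false f -> snonvanishing c f ->
  spow c f w * spow c f (- w) = 1.
Proof. by move=> fe f0; rewrite spowD // subrr spow0. Qed.

Lemma spowM f g w : spar X false f -> spar X false g ->
  spositive c f -> spositive c g -> spow c (f * g) w = spow c f w * spow c g w.
Proof.
move=> fe ge fpos gpos.
have f0 := spositive_nonvanishing fpos; have g0 := spositive_nonvanishing gpos.
have fgpos : spositive c (f * g).
  apply/spositiveP => x Ux; rewrite sbodyM // mulr_gt0 //.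
    exact: (spositiveP _ _).1 fpos _ Ux.
  exact: (spositiveP _ _).1 gpos _ Ux.
have fge : spar X false (f * g) by exact: sparMl.
have fg0 := spositive_nonvanishing fgpos.
have fwe := spow_par Uc fe f0 w; have gwe := spow_par Uc ge g0 w.
have Lf a := spow_log Uc fe f0 a w; have Lg a := spow_log Uc ge g0 a w.
have Lfg a := spow_log Uc fge fg0 a w.
rewrite (sabs_pos Uc fg0 fgpos) in Lfg; rewrite (sabs_pos Uc f0 fpos) in Lf.
rewrite (sabs_pos Uc g0 gpos) in Lg.
apply: (@odd_unique R M X n m c U Uc (f * g) _ _ (fun a => cst X w * pd c a (f * g))) => //.
- by move=> a ha; apply: spar_cstM; have := pd_par Uc a fge; rewrite ha.
- move=> a _; rewrite (pdM Uc _ _ fwe) (pdM Uc _ _ fe) !andbF !expr0 !mul1r.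
  have {}Lf := Lf a; have {}Lg := Lg a.
  set P := spow c f w in fwe Lf *; set Q := spow c g w in Lg *.
  have C1 : f * g = g * f := even_comm g fe.
  have C2 : g * P = P * g := even_comm P ge.
  have C3 u : P * u = u * P := even_comm u fwe.
  have C4 u : g * u = u * g := even_comm u ge.
  have C5 u : g * cst X w = cst X w * g by rewrite cst_comm.
  transitivity (g * (f * pd c a P) * Q + f * (g * P) * pd c a Q).
    by rewrite mulrDr {1}C1; nc_ring.
  rewrite C2 Lf.
  transitivity (g * (cst X w * pd c a f * P) * Q + f * P * (g * pd c a Q)); first by nc_ring.
  rewrite Lg C4.
  transitivity (cst X w * pd c a f * (P * g) * Q + f * (P * (cst X w * pd c a g)) * Q).
    by nc_ring.
  rewrite (C3 g) (C3 (cst X w * _)).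
  transitivity (cst X w * pd c a f * g * P * Q + (f * cst X w) * pd c a g * P * Q).
    by nc_ring.
  by rewrite -(cst_comm _ f); nc_ring.
- move=> _ [x Ux <-]; rewrite -!/(sbody _ _ _) sbodyM // !sbody_spow // sbodyM //.
  by rewrite normrM powRM.
Qed.

End PowerLaws.

Lemma spositive_chart c c' U (f : X U) : U `<=` cdom c -> U `<=` cdom c' ->
  spositive c f -> spositive c' f.
Proof.
move=> Uc Uc' /spositiveP fpos; apply/spositiveP => x Ux.
by rewrite -(sbody_chart _ Uc Uc') //; exact: fpos.
Qed.

(** By the chain rule the equations characterizing a power in one chart are
    linear combinations of those in the other. *)
Lemma spow_chart c c' U (f : X U) w : U `<=` cdom c -> U `<=` cdom c' ->
  spar X false f -> spositive c f -> spow c f w = spow c' f w.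
Proof.
move=> Uc Uc' fe fpos; have fpos' := spositive_chart Uc Uc' fpos.
have f0 := spositive_nonvanishing fpos; have f0' := spositive_nonvanishing fpos'.
have L a := spow_log Uc fe f0 a w; have L' a := spow_log Uc' fe f0' a w.
rewrite (sabs_pos Uc f0 fpos) in L; rewrite (sabs_pos Uc' f0' fpos') in L'.
apply: (@odd_unique R M X n m c U Uc f _ _ (fun a => cst X w * pd c a f)) => //.
- by move=> a ha; apply: spar_cstM; have := pd_par Uc a fe; rewrite ha.
- move=> a _; rewrite !(chain_rule (c' := c') a _ Uc Uc') mulr_sumr mulr_sumr mulr_suml.
  apply: eq_bigr => b _; rewrite mulrA (even_comm _ fe) -mulrA L'.
  by rewrite !mulrA -(cst_comm _ (jac _ _ _ _ _)).
- move=> _ [x Ux <-]; rewrite -!/(sbody _ _ _) (sbody_chart (spow c' f w) Uc Uc') //.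
  by rewrite !sbody_spow // (sbody_chart f Uc Uc').
Qed.

End Bodies.

(** * The logarithmic derivative of the Berezinian *)

Section EvenSubring.
Variables (R : realType) (M : topologicalType) (X : superspace R M) (U : opens M).

Definition seven : {pred X U} := fun f => `[< spar X false f >].

Lemma sevenP (f : X U) : reflect (spar X false f) (f \in seven).
Proof. exact: asboolP. Qed.

Fact seven_subring : GRing.subring_closed seven.
Proof.
split=> [|f g /sevenP hf /sevenP hg|f g /sevenP hf /sevenP hg]; apply/sevenP.
- exact: spar1.
- exact: sparB.
- exact: sparMl.
Qed.

(** The even sections form a commutative ring, to which the theory of
    determinants applies. *)
Record even_section := EvenSection {
  even_val :> X U; even_valP : even_val \in seven }.

HB.instance Definition _ := [isSub for even_val].
HB.instance Definition _ := [Choice of even_section by <:].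
HB.instance Definition _ := 
  GRing.SubChoice_isSubPzRing.Build (X U) seven even_section seven_subring.

Fact even_sectionC : commutative (@GRing.mul even_section).
Proof.
by move=> f g; apply: val_inj => /=; apply: even_comm; apply/sevenP; exact: valP.
Qed.
HB.instance Definition _ := GRing.PzRing_hasCommutativeMul.Build even_section even_sectionC.

Lemma even_section_par (f : even_section) : spar X false (val f).
Proof. by apply/sevenP; exact: valP. Qed.

Lemma even_lift k l (D : 'M[X U]_(k, l)) : (forall i j, spar X false (D i j)) ->
  exists D' : 'M[even_section]_(k, l), D = map_mx val D'.
Proof.
move=> h; exists (\matrix_(i, j) EvenSection (introT (sevenP _) (h i j))).
by apply/matrixP => i j; rewrite !mxE.
Qed.

End EvenSubring.

Section SuperDerivation.
Variables (R : realType) (M : topologicalType) (X : superspace R M) (U : opens M).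
Local Notation val := (val : even_section X U -> X U).

(** Derivations of the ring of sections over a single open, the setting of
    Jacobi's formula. *)
Record superder (p : bool) (d : X U -> X U) : Prop := SuperDer {
  sderD : {morph d : f g / f + g};
  sderM : forall q f g, spar X q f -> d (f * g) = d f * g + (-1) ^+ (p && q) * (f * d g);
  sder_par : forall q f, spar X q f -> spar X (q (+) p) (d f)
}.

Definition mx_par k l (q : bool) (A : 'M[X U]_(k, l)) := forall i j, spar X q (A i j).

Lemma mx_parM k l r p q (A : 'M[X U]_(k, l)) (B : 'M[X U]_(l, r)) :
  mx_par p A -> mx_par q B -> mx_par (p (+) q) (A *m B).
Proof. by move=> hA hB i j; rewrite mxE; apply: spar_sum => x _; exact: sparM. Qed.

Lemma mx_parN k l p (A : 'M[X U]_(k, l)) : mx_par p A -> mx_par p (- A).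
Proof. by move=> hA i j; rewrite mxE; exact: sparN. Qed.

Lemma mx_parD k l p (A B : 'M[X U]_(k, l)) : mx_par p A -> mx_par p B -> mx_par p (A + B).
Proof. by move=> hA hB i j; rewrite mxE; exact: sparD. Qed.

(** The cyclic property of the trace, with its sign, turns the derivative of the
    Berezinian into a supertrace. *)
Lemma mxtrace_superC k l p q (A : 'M[X U]_(k, l)) (B : 'M[X U]_(l, k)) :
  mx_par p A -> mx_par q B -> \tr (A *m B) = (-1) ^+ (p && q) * \tr (B *m A).
Proof.
move=> hA hB; rewrite /mxtrace mulr_sumr.
under eq_bigr => i _ do rewrite mxE.
rewrite exchange_big; apply: eq_bigr => j _; rewrite mxE mulr_sumr.
by apply: eq_bigr => i _; rewrite (supercomm (hA _ _) (hB _ _)).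
Qed.

Lemma det_par k (A : 'M[X U]_k) : mx_par false A -> spar X false (\det A).
Proof.
move=> hA; have [A' ->] := even_lift hA; rewrite det_map_mx.
exact: even_section_par.
Qed.

Lemma ber_par n m (J : 'M[X U]_(n + m)) :
  (forall a b, spar X (ipar a (+) ipar b) (J a b)) ->
  mx_par false (mxinv (drsubmx J)) -> spar X false (Ber J).
Proof.
move=> Jp Dp; apply: sparMl; last exact: det_par.
have ipl (i : 'I_n) : ipar (lshift m i) = false by rewrite /ipar /= leqNgt ltn_ord.
have ipr (i : 'I_m) : ipar (rshift n i) = true by rewrite /ipar /= leq_addr.
apply: det_par; apply: mx_parD.
  by move=> i j; rewrite !mxE; have := Jp (lshift m i) (lshift m j); rewrite !ipl.
have Bp : mx_par true (ursubmx J).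
  by move=> i j; rewrite !mxE; have := Jp (lshift m i) (rshift n j); rewrite ipl ipr.
have Cp : mx_par true (dlsubmx J).
  by move=> i j; rewrite !mxE; have := Jp (rshift n i) (lshift m j); rewrite ipl ipr.
apply: mx_parN; exact: (mx_parM (p := true) (q := true) (mx_parM (q := false) Bp Dp) Cp).
Qed.

Section Der.
Variables (p : bool) (d : X U -> X U).
Hypothesis dd : superder p d.

Lemma sder0 : d 0 = 0.
Proof. by apply: (addIr (d 0)); rewrite -(sderD dd) !add0r. Qed.

Lemma sderN f : d (- f) = - d f.
Proof. by apply/eqP; rewrite -subr_eq0 opprK -(sderD dd) addNr sder0. Qed.

Lemma sderB f g : d (f - g) = d f - d g.
Proof. by rewrite (sderD dd) sderN. Qed.

Lemma sder_sum (I : Type) (s : seq I) (P : pred I) (F : I -> X U) :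
  d (\sum_(i <- s | P i) F i) = \sum_(i <- s | P i) d (F i).
Proof. exact: (big_morph d (sderD dd) sder0). Qed.

Lemma sderMe f g : spar X false f -> d (f * g) = d f * g + f * d g.
Proof. by move=> fe; rewrite (sderM dd _ fe) andbF expr0 mul1r. Qed.

Lemma sder1 : d 1 = 0.
Proof.
have := sderMe 1 (spar1 X U); rewrite !mulr1 mul1r => /eqP.
by rewrite -subr_eq0 opprD addrA subrr sub0r oppr_eq0 => /eqP.
Qed.

Lemma sder_mulmx k l r q (A : 'M[X U]_(k, l)) (B : 'M[X U]_(l, r)) : mx_par q A ->
  map_mx d (A *m B) = map_mx d A *m B + (-1) ^+ (p && q) *: (A *m map_mx d B).
Proof.
move=> hA; apply/matrixP => i j; rewrite !mxE sder_sum mulr_sumr -big_split /=.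
by apply: eq_bigr => x _; rewrite !mxE (sderM dd _ (hA _ _)).
Qed.

Lemma sder_prod (I : eqType) (s : seq I) (F : I -> even_section X U) : uniq s ->
  d (val (\prod_(i <- s) F i)) =
  \sum_(i <- s) val (\prod_(j <- s | j != i) F j) * d (val (F i)).
Proof.
elim: s => [|i s IH] /=; first by rewrite !big_nil sder1.
move=> /andP[is_ us]; rewrite !big_cons /= sderMe; last exact: even_section_par.
rewrite IH // eqxx /= -(even_comm (d (val (F i))) (even_section_par _)).
have -> : \prod_(j <- s | j != i) F j = \prod_(j <- s) F j.
  rewrite big_seq_cond [RHS]big_seq; apply: eq_bigl => j; case: (boolP (j \in s)) => //= js.
  by apply: contraNneq is_ => <-.
congr (_ + _).
rewrite mulr_sumr !big_seq; apply: eq_bigr => j js.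
rewrite big_cons ifT /= ?mulrA //; by apply: contraNneq is_ => ->.
Qed.

(** Jacobi's formula. The entries are even, so that a derivation of any parity
    obeys the usual product rule on each term of the determinant. *)
Lemma sder_det k (A : 'M[even_section X U]_k) :
  d (val (\det A)) = \sum_i \sum_j val (cofactor A i j) * d (val (A i j)).
Proof.
rewrite /determinant rmorph_sum sder_sum.
under eq_bigr => s _.
  rewrite rmorphM rmorph_sign.
  have -> f : d ((-1) ^+ perm.odd_perm s * f) = (-1) ^+ perm.odd_perm s * d f.
    by case: (perm.odd_perm s); rewrite ?expr0 ?expr1 ?mul1r ?mulN1r ?sderN.
  rewrite sder_prod ?index_enum_uniq // mulr_sumr.
  over.
rewrite exchange_big; apply: eq_bigr => i _.
rewrite (partition_big (fun s : 'S_k => s i) xpredT) //; apply: eq_bigr => j _.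
rewrite expand_cofactor rmorph_sum mulr_suml; apply: eq_bigr => s /eqP <-.
by rewrite rmorphM rmorph_sign mulrA; congr (_ * val _ * _); apply: eq_bigl => l; rewrite eq_sym.
Qed.

(** For an invertible matrix the cofactors are the entries of the inverse times
    the determinant. *)
Lemma sder_det_inv k (A : 'M[X U]_k) (B : 'M[X U]_k) : mx_par false A -> mx_par false B ->
  A *m B = 1%:M -> B *m A = 1%:M -> d (\det A) = \det A * \tr (B *m map_mx d A).
Proof.
move=> hA hB AB BA.
have [A' EA] := even_lift hA; have [B' EB] := even_lift hB.
have BA' : B' *m A' = 1%:M.
  have inj : injective (map_mx val : 'M[even_section X U]_k -> 'M[X U]_k).
    move=> P Q /matrixP PQ; apply/matrixP => i j; apply: val_inj.
    by have := PQ i j; rewrite !mxE.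
  apply: inj; rewrite map_mxM -EA -EB BA map_mx1 //.
have dE : \det A = val (\det A') by rewrite EA det_map_mx.
have cE i j : cofactor A' i j = \det A' * B' j i.
  have := mul_mx_adj A' => /(congr1 (fun P => B' *m P)).
  rewrite mulmxA BA' mul1mx mul_mx_scalar => /matrixP/(_ j i).
  by rewrite !mxE => ->.
rewrite dE sder_det /mxtrace mulr_sumr exchange_big; apply: eq_bigr => j _.
rewrite mxE mulr_sumr; apply: eq_bigr => i _.
by rewrite cE rmorphM -mulrA !mxE EA EB !mxE.
Qed.

Section Berezinian.
Variables (n m : nat) (J K : 'M[X U]_(n + m)).
Hypotheses (JK : J *m K = 1%:M) (KJ : K *m J = 1%:M).
Hypothesis Jp : forall a b, spar X (ipar a (+) ipar b) (J a b).
Hypothesis Kp : forall a b, spar X (ipar a (+) ipar b) (K a b).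
Hypothesis Dinv : exists E, E *m drsubmx J = 1%:M /\ drsubmx J *m E = 1%:M.
Hypothesis Dp : mx_par false (mxinv (drsubmx J)).

Let A := ulsubmx J.
Let B := ursubmx J.
Let C := dlsubmx J.
Let D := drsubmx J.
Let D' := mxinv D.
Let E := A - B *m D' *m C.

Let ipl (i : 'I_n) : ipar (lshift m i) = false.
Proof. by rewrite /ipar /= leqNgt ltn_ord. Qed.
Let ipr (i : 'I_m) : ipar (rshift n i) = true.
Proof. by rewrite /ipar /= leq_addr. Qed.

Let Ap : mx_par false A.
Proof. by move=> i j; rewrite !mxE; have := Jp (lshift m i) (lshift m j); rewrite !ipl. Qed.
Let Bp : mx_par true B.
Proof. by move=> i j; rewrite !mxE; have := Jp (lshift m i) (rshift n j); rewrite ipl ipr. Qed.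
Let Cp : mx_par true C.
Proof. by move=> i j; rewrite !mxE; have := Jp (rshift n i) (lshift m j); rewrite ipl ipr. Qed.
Let Dp0 : mx_par false D.
Proof. by move=> i j; rewrite !mxE; have := Jp (rshift n i) (rshift n j); rewrite !ipr. Qed.

Lemma mxinvP : D' *m D = 1%:M /\ D *m D' = 1%:M.
Proof. by rewrite /D' /mxinv; case: xgetP => [P -> //|/=]; case: Dinv => P hP /(_ P). Qed.

Let Ep : mx_par false E.
Proof.
apply: mx_parD => //; apply: mx_parN.
exact: (mx_parM (p := true) (q := true) (mx_parM (q := false) Bp Dp) Cp).
Qed.

Let K11 := ulsubmx K.
Let K12 := ursubmx K.
Let K21 := dlsubmx K.
Let K22 := drsubmx K.

Let blockJ : J = block_mx A B C D. Proof. by rewrite submxK. Qed.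
Let blockK : K = block_mx K11 K12 K21 K22. Proof. by rewrite submxK. Qed.

Let eqJK : [/\ A *m K11 + B *m K21 = 1%:M, A *m K12 + B *m K22 = 0,
  C *m K11 + D *m K21 = 0 & C *m K12 + D *m K22 = 1%:M].
Proof.
have := JK; rewrite blockJ blockK mulmx_block (@scalar_mx_block _ n m 1).
by move/eq_block_mx.
Qed.

Let eqKJ : [/\ K11 *m A + K12 *m C = 1%:M, K11 *m B + K12 *m D = 0,
  K21 *m A + K22 *m C = 0 & K21 *m B + K22 *m D = 1%:M].
Proof.
have := KJ; rewrite blockJ blockK mulmx_block (@scalar_mx_block _ n m 1).
by move/eq_block_mx.
Qed.

Let K21E : K21 = - (D' *m C *m K11).
Proof.
have [_ _ h _] := eqJK; have [DD _] := mxinvP.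
move/(congr1 (mulmx D')): h; rewrite mulmxDr !mulmxA DD mul1mx mulmx0.
by move=> /eqP; rewrite addrC addr_eq0 => /eqP.
Qed.

Let K12E : K12 = - (K11 *m B *m D').
Proof.
have [_ h _ _] := eqKJ; have [_ DD] := mxinvP.
move/(congr1 (mulmxr D')): h; rewrite /= mulmxDl -!mulmxA DD mulmx1 mul0mx.
by move=> /eqP; rewrite addrC addr_eq0 => /eqP.
Qed.

Let K22E : K22 = D' + D' *m C *m K11 *m B *m D'.
Proof.
have [_ _ _ h] := eqJK; have [DD _] := mxinvP.
move/(congr1 (mulmx D')): h; rewrite mulmxDr !mulmxA DD mul1mx mulmx1 => h'.
by rewrite -[LHS](addKr (D' *m C *m K12)) h' K12E mulmxN !mulmxA opprK addrC.
Qed.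

Let EK : E *m K11 = 1%:M.
Proof.
have [h _ _ _] := eqJK; rewrite -h K21E /E mulmxBl mulmxN !mulmxA //.
Qed.

Let KE : K11 *m E = 1%:M.
Proof.
have [h _ _ _] := eqKJ; rewrite -h K12E /E mulmxBr mulNmx !mulmxA //.
Qed.

Let K11p : mx_par false K11.
Proof. by move=> i j; rewrite !mxE; have := Kp (lshift m i) (lshift m j); rewrite !ipl. Qed.

(** The Berezinian is the product of the determinants of the Schur complement E
    and of D^-1, and the inverse of E is the upper left block of K. The
    remaining blocks of K are expressed through it, and collect the terms of the
    derivatives of E and D^-1 after cyclic permutations. *)
Lemma sder_ber_block : d (Ber J) = Ber J *
  (\tr (K11 *m map_mx d A) - (-1) ^+ p * \tr (K21 *m map_mx d B)
   + (-1) ^+ p * \tr (K12 *m map_mx d C) - \tr (K22 *m map_mx d D)).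
Proof.
have [DD DD'] := mxinvP.
have dE := sder_det_inv Ep K11p EK KE.
have dD := sder_det_inv Dp Dp0 DD DD'.
have eE := det_par Ep; have eD := det_par Dp.
have dp k l q (P : 'M[X U]_(k, l)) : mx_par q P -> mx_par (q (+) p) (map_mx d P).
  by move=> hP i j; rewrite mxE; apply: (sder_par dd).
have dD' : map_mx d D' = - (D' *m map_mx d D *m D').
  have := sder_mulmx D' Dp0; rewrite DD' andbF expr0 scale1r.
  have -> : map_mx d (1%:M : 'M[X U]_m) = 0.
    by apply/matrixP => i j; rewrite !mxE; case: eqP => _; rewrite ?sder1 ?sder0.
  move=> /(congr1 (mulmx D')); rewrite mulmx0 mulmxDr !mulmxA DD mul1mx => /eqP.
  by rewrite eq_sym addrC addr_eq0 => /eqP.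
have BDp : mx_par true (B *m D') by exact: (mx_parM (p := true) (q := false) Bp Dp).
have DCp : mx_par true (D' *m C) by exact: (mx_parM (p := false) (q := true) Dp Cp).
have dEE : map_mx d E = map_mx d A - (map_mx d B *m D' *m C
    - (-1) ^+ p *: (B *m D' *m map_mx d D *m D' *m C)
    + (-1) ^+ p *: (B *m D' *m map_mx d C)).
  rewrite /E.
  have -> : map_mx d (A - B *m D' *m C) = map_mx d A - map_mx d (B *m D' *m C).
    by apply/matrixP => i j; rewrite !mxE sderB.
  rewrite (sder_mulmx C BDp) (sder_mulmx D' Bp) andbT dD' mulmxN scalerN mulmxBl.
  by rewrite -scalemxAl !mulmxA.
have T1 : \tr (K11 *m map_mx d B *m D' *m C) =
    (-1) ^+ (~~ p) * \tr (D' *m C *m K11 *m map_mx d B).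
  rewrite -2!mulmxA mulmxA.
  rewrite (mxtrace_superC (mx_parM K11p (dp _ _ _ _ Bp)) DCp) !mulmxA andbT.
  by rewrite addFb addTb.
have T3 : \tr (K11 *m B *m D' *m map_mx d D *m D' *m C) =
    (-1) ^+ (~~ p) * \tr (D' *m C *m K11 *m B *m D' *m map_mx d D).
  rewrite -[_ *m D' *m C]mulmxA -[K11 *m B *m D']mulmxA.
  rewrite (mxtrace_superC (mx_parM (mx_parM K11p BDp) (dp _ _ _ _ Dp0)) DCp) !mulmxA andbT.
  by rewrite addFb addFb addTb.
have T5 : \tr (D *m map_mx d D') = - \tr (D' *m map_mx d D).
  rewrite dD' mulmxN raddfN /= !mulmxA DD' mul1mx.
  by rewrite (mxtrace_superC (dp _ _ _ _ Dp0) Dp) andbF expr0 mul1r.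
rewrite /Ber -/A -/B -/C -/D -/D' -/E sderMe // dE dD T5 dEE.
rewrite -(even_comm _ eD) -(even_comm _ eD) !mulrA -(even_comm (\det E) eD) -mulrDr.
congr (_ * _).
have trZ k (P : 'M[X U]_k) : \tr ((-1) ^+ p *: P) = (-1) ^+ p * \tr P.
  by case: (p); rewrite ?expr0 ?expr1 ?scale1r ?scaleN1r ?mul1r ?mulN1r ?raddfN.
have mulZ k l r (P : 'M[X U]_(k, l)) (Q : 'M[X U]_(l, r)) :
    P *m ((-1) ^+ p *: Q) = (-1) ^+ p *: (P *m Q).
  by case: (p); rewrite ?expr0 ?expr1 ?scale1r ?scaleN1r ?mulmxN.
rewrite mulmxBr mulmxDr mulmxBr !mulZ raddfB raddfD raddfB /= !trZ !mulmxA T1 T3.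
rewrite K21E K12E K22E !mulNmx !raddfN /= mulmxDl mxtraceD ?mulmxA.
by case: (p) => /=; rewrite ?expr0 ?expr1; nc_ring.
Qed.

Lemma sder_ber : d (Ber J) = Ber J *
  \sum_b \sum_a (-1) ^+ (ipar b (+) (p && (ipar a (+) ipar b))) * (K b a * d (J a b)).
Proof.
rewrite sder_ber_block; congr (_ * _).
have trE k l (P : 'M[X U]_(k, l)) (Q : 'M[X U]_(l, k)) :
  \tr (P *m map_mx d Q) = \sum_i \sum_j P i j * d (Q j i).
  by apply: eq_bigr => i _; rewrite mxE; apply: eq_bigr => j _; rewrite mxE.
rewrite big_split_ord /= !trE.
under [X in _ = X + _]eq_bigr => i _ do rewrite big_split_ord.
under [X in _ = _ + X]eq_bigr => i _ do rewrite big_split_ord.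
rewrite !big_split /=.
have E1 k l (sg : bool) (F : 'I_k -> 'I_l -> X U) (G : 'I_k -> 'I_l -> bool) :
    (forall i j, G i j = sg) ->
    \sum_i \sum_j (-1) ^+ G i j * F i j = (-1) ^+ sg * \sum_i \sum_j F i j.
  move=> hG; rewrite mulr_sumr; apply: eq_bigr => i _; rewrite mulr_sumr.
  by apply: eq_bigr => j _; rewrite hG.
rewrite (E1 _ _ false); last by move=> i j; rewrite !ipl andbF.
rewrite (E1 _ _ p); last by move=> i j; rewrite ipl ipr /= andbT.
rewrite (E1 _ _ (~~ p)); last by move=> i j; rewrite ipl ipr /= andbT.
rewrite (E1 _ _ true); last by move=> i j; rewrite !ipr /= andbF.
under [\sum_i \sum_j K11 i j * _]eq_bigr => i _ do under eq_bigr => j _ do rewrite !mxE.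
under [\sum_i \sum_j K21 i j * _]eq_bigr => i _ do under eq_bigr => j _ do rewrite !mxE.
under [\sum_i \sum_j K12 i j * _]eq_bigr => i _ do under eq_bigr => j _ do rewrite !mxE.
under [\sum_i \sum_j K22 i j * _]eq_bigr => i _ do under eq_bigr => j _ do rewrite !mxE.
by case: (p) => /=; rewrite ?expr0 ?expr1; nc_ring.
Qed.

End Berezinian.
End Der.
End SuperDerivation.

Section BerMorphism.

Lemma rmorph_pack (A B : pzRingType) (f : A -> B) :
  (forall x y, f (x - y) = f x - f y) -> (forall x y, f (x * y) = f x * f y) -> f 1 = 1 ->
  exists g : {rmorphism A -> B}, g =1 f.
Proof.
move=> fB fM f1.
pose g : {rmorphism A -> B} := HB.pack f (GRing.isZmodMorphism.Build A B f fB)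
  (GRing.isMonoidMorphism.Build A B f (conj f1 fM)).
by exists g.
Qed.

Lemma mxinv_uniq (A : pzRingType) k (D E : 'M[A]_k) :
  E *m D = 1%:M -> D *m E = 1%:M -> mxinv D = E.
Proof.
move=> ED DE; rewrite /mxinv; case: xgetP => [P _ [PD DP]|/(_ E)]; last by case.
by rewrite -[P]mulmx1 -DE mulmxA PD mul1mx.
Qed.

(** The inverse of the lower right block is a chosen one, with a default value:
    a morphism is only known to respect it where an inverse exists. *)
Lemma Ber_map (A B : pzRingType) (f : {rmorphism A -> B}) n m (J : 'M[A]_(n + m)) :
  (exists E, E *m drsubmx J = 1%:M /\ drsubmx J *m E = 1%:M) ->
  f (Ber J) = Ber (map_mx f J).
Proof.
case=> E [ED DE]; rewrite /Ber rmorphM -!det_map_mx.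
have -> : mxinv (drsubmx (map_mx f J)) = map_mx f (mxinv (drsubmx J)).
  rewrite (mxinv_uniq ED DE); apply: mxinv_uniq.
    by rewrite -map_drsubmx -map_mxM ED map_mx1.
  by rewrite -map_drsubmx -map_mxM DE map_mx1.
by rewrite map_mxB !map_mxM -map_ulsubmx -map_ursubmx -map_dlsubmx.
Qed.

End BerMorphism.

(** * Divergences and the Berezinian cocycle *)

Section Divergence.
Variables (R : realType) (M : topologicalType) (X : superspace R M).
Variables (n m : nat).
Implicit Types (c : chart X n m) (U V W : opens M) (a b : 'I_(n + m)).

(** The divergence, in the coordinates of c, of a vector field of parity e. *)
Definition sdiv c e U (V : 'I_(n + m) -> X U) : X U :=
  \sum_a (-1) ^+ (ipar a && ~~ e) * pd c a (V a).

(** The divergence in the chart c' of the coordinate field a of the chart c; by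
    pd_ber below it is the logarithmic derivative of the Berezinian. *)
Definition dlog c c' U a : X U := sdiv c' (ipar a) (jac c c' U a).

Section OneChart.
Variables (c : chart X n m) (U : opens M).
Hypothesis Uc : U `<=` cdom c.

Lemma sdiv_res e V (F : 'I_(n + m) -> X U) : V `<=` U ->
  sdiv c e (fun a => res V (F a)) = res V (sdiv c e F).
Proof.
move=> VU; rewrite res_sum //; apply: eq_bigr => a _.
by rewrite resM // res_sign // pd_res.
Qed.

Lemma sdiv_par e (F : 'I_(n + m) -> X U) : (forall a, spar X (e (+) ipar a) (F a)) ->
  spar X e (sdiv c e F).
Proof.
move=> hF; apply: spar_sum => a _; apply: spar_sign.
by have := pd_par Uc a (hF a); rewrite -addbA addbb addbF.
Qed.

Lemma sdivD e (F G : 'I_(n + m) -> X U) :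
  sdiv c e (fun a => F a + G a) = sdiv c e F + sdiv c e G.
Proof. by rewrite -big_split; apply: eq_bigr => a _; rewrite pdD // mulrDr. Qed.

Lemma sdivZ e r (F : 'I_(n + m) -> X U) :
  sdiv c e (fun a => cst X r * F a) = cst X r * sdiv c e F.
Proof.
rewrite mulr_sumr; apply: eq_bigr => a _; rewrite pd_cstM // !mulrA.
by rewrite signC.
Qed.

Lemma superder_pd a : superder (ipar a) (@pd R M X n m c U a).
Proof.
split; [by move=> f g; exact: pdD|by move=> q f g hf; exact: pdM|].
by move=> q f; exact: pd_par.
Qed.

End OneChart.

Section TwoCharts.
Variables (c c' : chart X n m) (U : opens M).
Hypotheses (Uc : U `<=` cdom c) (Uc' : U `<=` cdom c').
Local Notation J := (jac c c' U).

Lemma dlog_par a : spar X (ipar a) (dlog c c' U a).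
Proof. by apply: sdiv_par => // b; exact: jac_par. Qed.

(** By the Leibniz rule the divergence changes by that of the coordinate
    fields; the remaining terms are regrouped by the chain rule. *)
Lemma sdiv_change e (F : 'I_(n + m) -> X U) : (forall a, spar X (e (+) ipar a) (F a)) ->
  sdiv c' e (fun b => \sum_a F a * J a b) = sdiv c e F + \sum_a F a * dlog c c' U a.
Proof.
move=> hF; rewrite /sdiv.
under eq_bigr => b _ do rewrite (pd_sum Uc') mulr_sumr.
rewrite exchange_big -big_split /=; apply: eq_bigr => a _.
rewrite (chain_rule (c := c) (c' := c') a (F a) Uc Uc') mulr_sumr /dlog /sdiv mulr_sumr -big_split.
apply: eq_bigr => b _ /=; rewrite (pdM Uc' _ _ (hF a)).
rewrite (supercomm (pd_par Uc' b (hF a)) (jac_par a b Uc Uc')).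
rewrite [F a * (_ * _)]mulrA -(signC _ (F a)).
by case: (e); case: (ipar a); case: (ipar b); signs; nc_ring.
Qed.

(** Without an inverse of the lower right block, its default value 0 makes the
    Berezinian vanish, unless the block is empty and thus invertible. Positivity
    then leaves only empty U, over which all sections are equal. *)
Lemma drsub_jac_inv_pos : spositive c (Ber J) ->
  exists E, E *m drsubmx J = 1%:M /\ drsubmx J *m E = 1%:M.
Proof.
move=> pos; have [E|nE] := pselect (exists E, E *m drsubmx J = 1%:M /\ drsubmx J *m E = 1%:M).
  exact: E.
have D0 : mxinv (drsubmx J) = 0.
  rewrite /mxinv; case: xgetP => [P _ hP|//].
  by case: nE; exists P.
have [m0|m_gt0] := posnP m.
  exists 0; split; apply/matrixP => i j; suff: false by [];
    by have := leq_ltn_trans (leq0n i) (ltn_ord i); rewrite m0.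
have B0 : Ber J = 0.
  rewrite /Ber D0 [X in _ * X](_ : _ = 0) ?mulr0 //.
  have -> : (0 : 'M[X U]_m) = map_mx (val : even_section X U -> X U) 0.
    by apply/matrixP => i j; rewrite !mxE.
  rewrite det_map_mx /determinant big1 // => s _.
  by rewrite (bigD1 (Ordinal m_gt0)) //= mxE mul0r mulr0.
case: nE; exists 0.
suff t (f g : X U) : f = g by split; apply/matrixP => i j; exact: t.
apply: (crep_inj Uc) => y By; have := pos y By; rewrite B0 (crep0 Uc) //.
by rewrite /gbody ffunE ltxx.
Qed.

Hypothesis Jpos : spositive c (Ber J).

Let Dinv := drsub_jac_inv_pos Jpos.

(** An even matrix times the odd part of its inverse is the odd part of 1, that
    is, 0. *)
Lemma drsub_jac_inv_par : mx_par false (mxinv (drsubmx J)).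
Proof.
have [E [ED DE]] := Dinv; rewrite (mxinv_uniq ED DE).
have Dp : mx_par false (drsubmx J).
  move=> i j; rewrite 2!mxE; have := jac_par (rshift n i) (rshift n j) Uc Uc'.
  by rewrite /ipar /= !leq_addr addbb.
have /choice[E0 hE0] : forall ij : 'I_m * 'I_m, exists g : X U,
    spar X false g /\ spar X true (E ij.1 ij.2 - g) by move=> ij; exact: spar_dec.
pose P : 'M[X U]_m := \matrix_(i, j) E0 (i, j).
have P0 : mx_par false P by move=> i j; rewrite mxE; have [] := hE0 (i, j).
have P1 : mx_par true (E - P) by move=> i j; rewrite !mxE; have [] := hE0 (i, j).
have DP1 : drsubmx J *m (E - P) = 0.
  apply/matrixP => i j; rewrite [RHS]mxE; apply: spar_dir; last exact: (mx_parM Dp P1).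
  rewrite mulmxBr DE mxE [X in _ + X]mxE; apply: sparB; last exact: (mx_parM Dp P0).
  by rewrite mxE; case: eqP => _; [exact: spar1|exact: spar0].
have : E - P = 0 by rewrite -[E - P]mul1mx -ED -mulmxA DP1 mulmx0.
by move/eqP; rewrite subr_eq0 => /eqP ->.
Qed.

Lemma jac_ber_par : spar X false (Ber J).
Proof.
apply: ber_par; last exact: drsub_jac_inv_par.
by move=> a b; exact: jac_par.
Qed.

(** The change of variables formula in infinitesimal form: the second
    derivatives of the new coordinates are symmetric, which turns the logarithmic
    derivative of the Berezinian into a divergence. *)
Theorem pd_ber a : pd c a (Ber J) = Ber J * dlog c c' U a.
Proof.
rewrite (@sder_ber R M X U (ipar a) _ (superder_pd Uc a) n m J (jac c' c U)).
- congr (_ * _); apply: eq_bigr => b _.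
  rewrite (chain_rule (c := c') (c' := c) b _ Uc' Uc) mulr_sumr; apply: eq_bigr => k _.
  rewrite !mxE (pdC a k _ Uc).
  by case: (ipar a); case: (ipar b); case: (ipar k); signs; nc_ring.
- exact: jac_inv.
- exact: jac_inv.
- by move=> k b; exact: jac_par.
- by move=> k b; exact: jac_par.
- exact: Dinv.
- exact: drsub_jac_inv_par.
Qed.

Lemma res_ber V : V `<=` U -> res V (Ber J) = Ber (jac c c' V).
Proof.
move=> VU; have [g Eg] := rmorph_pack (fun f h => resB f h VU) (fun f h => resM f h VU)
  (res1 X VU).
rewrite -Eg (Ber_map g Dinv); congr Ber; apply/matrixP => a b.
by rewrite [LHS]mxE Eg res_jac.
Qed.

(** Taking bodies is a ring morphism which kills the odd blocks. *)
Lemma sbody_ber x : oset U x -> sbody c (Ber J) x =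
  \det (\matrix_(i, j) sbody c (J (lshift m i) (lshift m j)) x) /
  \det (\matrix_(i, j) sbody c (J (rshift n i) (rshift n j)) x).
Proof.
move=> Ux.
have b1 : sbody c (1 : X U) x = 1 by rewrite -(cst1 X U) sbody_cst.
have [g Eg] := rmorph_pack (fun f h => sbodyB Uc Ux f h) (fun f h => sbodyM Uc Ux f h) b1.
rewrite -Eg (Ber_map g Dinv) /Ber.
have ipl (i : 'I_n) : ipar (lshift m i) = false by rewrite /ipar /= leqNgt ltn_ord.
have ipr (i : 'I_m) : ipar (rshift n i) = true by rewrite /ipar /= leq_addr.
have -> : ursubmx (map_mx g J) = 0.
  apply/matrixP => i j; rewrite !mxE Eg sbody_odd //.
  by have := jac_par (lshift m i) (rshift n j) Uc Uc'; rewrite ipl ipr mxE.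
rewrite !mul0mx subr0.
set D := drsubmx _; have [E [ED DE]] := Dinv.
have DED : map_mx g E *m D = 1%:M by rewrite /D -map_drsubmx -map_mxM ED map_mx1.
have DDE : D *m map_mx g E = 1%:M by rewrite /D -map_drsubmx -map_mxM DE map_mx1.
rewrite (mxinv_uniq DED DDE).
have -> : \det (map_mx g E) = (\det D)^-1.
  have := congr1 determinant DED; rewrite det_mulmx det1 => ED1.
  have D0 : \det D != 0.
    by apply/eqP => D0; move: ED1; rewrite D0 mulr0 => /eqP; rewrite eq_sym oner_eq0.
  by apply: (mulIf D0); rewrite ED1 mulVf.
have -> : ulsubmx (map_mx g J) = \matrix_(i, j) sbody c (J (lshift m i) (lshift m j)) x.
  by apply/matrixP => i j; rewrite !mxE Eg ?mxE.
have -> // : D = \matrix_(i, j) sbody c (J (rshift n i) (rshift n j)) x.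
by apply/matrixP => i j; rewrite !mxE Eg ?mxE.
Qed.

End TwoCharts.

(** Both sides solve the same first order equations, hence only their bodies have
    to be compared, and there the odd blocks vanish. *)
Theorem ber_cocycle (c1 c2 c3 : chart X n m) U :
  U `<=` cdom c1 -> U `<=` cdom c2 -> U `<=` cdom c3 ->
  spositive c1 (Ber (jac c1 c2 U)) -> spositive c2 (Ber (jac c2 c3 U)) ->
  spositive c1 (Ber (jac c1 c3 U)) ->
  Ber (jac c1 c3 U) = Ber (jac c1 c2 U) * Ber (jac c2 c3 U).
Proof.
move=> U1 U2 U3 p12 p23 p13.
have e12 := jac_ber_par U1 U2 p12; have e23 := jac_ber_par U2 U3 p23.
have e13 := jac_ber_par U1 U3 p13.
have JJ : jac c1 c3 U = jac c1 c2 U *m jac c2 c3 U.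
  apply/matrixP => a b; rewrite [LHS]mxE (chain_rule a _ U1 U2) mxE.
  by apply: eq_bigr => k _; rewrite [X in _ * X = _]/pd [X in _ = _ * X]mxE.
apply: (@odd_unique R M X n m c1 U U1 1 _ _ (dlog c1 c3 U)).
- move=> y By; rewrite -(cst1 X U) (crep_cst (c := c1)) //.
  by rewrite /gbody ffunE eqxx oner_neq0.
- by move=> a ha; have := dlog_par U1 U3 a; rewrite ha.
- by move=> a _; rewrite mul1r (pd_ber U1 U3 p13); exact: even_comm.
- move=> a _; rewrite mul1r (pdM U1 _ _ e12) andbF expr0 mul1r (pd_ber U1 U2 p12).
  rewrite (chain_rule a _ U1 U2).
  rewrite (eq_bigr (fun b => Ber (jac c2 c3 U) * (jac c1 c2 U a b * dlog c2 c3 U b))).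
    have -> : dlog c1 c3 U a = dlog c1 c2 U a + \sum_b jac c1 c2 U a b * dlog c2 c3 U b.
      rewrite -(sdiv_change U2 U3); last by move=> b; exact: jac_par.
      by apply: eq_bigr => b _; rewrite JJ mxE.
    rewrite -mulr_sumr.
    have gen (u v h s : X U) : spar X false u -> spar X false v ->
        u * h * v + u * (v * s) = (h + s) * (u * v).
      move=> ue ve; rewrite -(even_comm (h + s) (sparMl ue ve)) -mulrA.
      by rewrite -(even_comm h ve); nc_ring.
    exact: gen.
  move=> b _; rewrite (pd_ber U2 U3 p23) mulrA -(even_comm _ e23).
  by rewrite mulrA.
- move=> _ [x Ux <-]; rewrite -!/(sbody _ _ _) (sbodyM U1 Ux).
  rewrite (sbody_chart (Ber (jac c2 c3 U)) U1 U2 Ux) !sbody_ber //.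
  have mulE (f g : X U) : sbody c1 (f * g) x = sbody c1 f x * sbody c2 g x.
    by rewrite (sbodyM U1 Ux) (sbody_chart g U1 U2 Ux).
  have b1 : sbody c1 (1 : X U) x = 1 by rewrite -(cst1 X U) sbody_cst.
  have [g Eg] := rmorph_pack (fun f h => sbodyB U1 Ux f h) (fun f h => sbodyM U1 Ux f h) b1.
  have ipl (i : 'I_n) : ipar (lshift m i) = false by rewrite /ipar /= leqNgt ltn_ord.
  have ipr (i : 'I_m) : ipar (rshift n i) = true by rewrite /ipar /= leq_addr.
  have -> : \matrix_(i, j) sbody c1 (jac c1 c3 U (lshift m i) (lshift m j)) x =
     (\matrix_(i, j) sbody c1 (jac c1 c2 U (lshift m i) (lshift m j)) x : 'M[R]_n) *m
     \matrix_(i, j) sbody c2 (jac c2 c3 U (lshift m i) (lshift m j)) x.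
    apply/matrixP => i j; rewrite JJ [LHS]mxE mxE -Eg rmorph_sum big_split_ord /=.
    rewrite [X in _ + X]big1 ?addr0 => [|k _]; last first.
      rewrite Eg mulE sbody_odd ?mul0r //.
      by have := jac_par (lshift m i) (rshift n k) U1 U2; rewrite ipl ipr.
    by rewrite [RHS]mxE; apply: eq_bigr => k _; rewrite Eg mulE !mxE.
  have -> : \matrix_(i, j) sbody c1 (jac c1 c3 U (rshift n i) (rshift n j)) x =
     (\matrix_(i, j) sbody c1 (jac c1 c2 U (rshift n i) (rshift n j)) x : 'M[R]_m) *m
     \matrix_(i, j) sbody c2 (jac c2 c3 U (rshift n i) (rshift n j)) x.
    apply/matrixP => i j; rewrite JJ [LHS]mxE mxE -Eg rmorph_sum big_split_ord /=.
    rewrite big1 ?add0r => [|k _]; last first.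
      rewrite Eg mulE sbody_odd ?mul0r //.
      by have := jac_par (rshift n i) (lshift m k) U1 U2; rewrite ipl ipr.
    by rewrite [RHS]mxE; apply: eq_bigr => k _; rewrite Eg mulE !mxE.
  by rewrite !det_mulmx invfM; ring.
Qed.

End Divergence.

(** * Second order operators in one chart *)

Section Operators.
Variables (R : realType) (M : topologicalType) (X : superspace R M).
Variables (n m : nat).
Implicit Types (c : chart X n m) (U V W : opens M) (a b : 'I_(n + m)).

Section Forms.
Variables (c : chart X n m) (eps : bool) (U : opens M).
Implicit Types (S : 'I_(n + m) -> 'I_(n + m) -> X U) (T gamma : 'I_(n + m) -> X U).
Implicit Types (F theta psi : X U).

Definition sec_part S psi := \sum_a \sum_b S a b * pd c b (pd c a psi).
Definition vec_part T psi := \sum_a T a * pd c a psi.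

Definition op2c S T F psi : X U :=
  cst X (2^-1) * sec_part S psi + vec_part T psi + F * psi.

(** The second order part S^{ab} d_b d_a is completed by the divergence of S to
    an operator whose change under coordinate transformations is simply the
    contraction of S with the logarithmic derivative of the Berezinian. *)
Definition tdiv S a : X U := sdiv c eps (fun b => S b a).
Definition lap S psi := sec_part S psi + vec_part (tdiv S) psi.

(** The local expression of the members of a pencil: all the dependence on the
    weight is explicit, for fixed S, gamma and theta. *)
Definition pencilc w S gamma theta psi : X U :=
  cst X (2^-1) * (lap S psi + cst X (2 * w - 1) * vec_part gamma psi
    + cst X w * sdiv c eps gamma * psi + cst X (w * (w - 1)) * theta * psi).

Definition ssym S := forall a b, spar X (eps (+) ipar a (+) ipar b) (S a b) /\
  S a b = (-1) ^+ (ipar a && ipar b) * S b a.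
Definition spar_vec gamma := forall a, spar X (eps (+) ipar a) (gamma a).

Definition tapply S (beta : 'I_(n + m) -> X U) a := \sum_b S a b * beta b.

End Forms.

Section OneChart.
Variables (c : chart X n m) (eps : bool) (U : opens M).
Hypothesis Uc : U `<=` cdom c.
Implicit Types (S : 'I_(n + m) -> 'I_(n + m) -> X U) (T gamma : 'I_(n + m) -> X U).
Implicit Types (F theta psi : X U).

Lemma vec_partD T T' psi : vec_part c (fun a => T a + T' a) psi =
  vec_part c T psi + vec_part c T' psi.
Proof. by rewrite -big_split; apply: eq_bigr => a _; rewrite mulrDl. Qed.

Lemma vec_partZ r T psi : vec_part c (fun a => cst X r * T a) psi = cst X r * vec_part c T psi.
Proof. by rewrite mulr_sumr; apply: eq_bigr => a _; rewrite mulrA. Qed.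

Lemma pencil_op2 w S gamma theta psi : pencilc c eps w S gamma theta psi =
  op2c c S (fun a => cst X (2^-1) * (tdiv c eps S a + cst X (2 * w - 1) * gamma a))
    (cst X (2^-1) * (cst X w * sdiv c eps gamma + cst X (w * (w - 1)) * theta)) psi.
Proof.
by rewrite /pencilc /op2c /lap vec_partZ vec_partD vec_partZ; nc_ring.
Qed.

(** The coefficients are recovered by testing on 1, then on the coordinates and
    finally on their products. *)
Lemma op2_inj S S' T T' F F' : ssym eps S -> ssym eps S' ->
  (forall psi, op2c c S T F psi = op2c c S' T' F' psi) ->
  [/\ forall a b, S a b = S' a b, forall a, T a = T' a & F = F'].
Proof.
move=> symS symS' H.
pose x a := res U (coord c a).
have pdx a b : pd c a (x b) = (a == b)%:R by exact: pd_coord.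
have pdd a (l : bool) : pd c a (l%:R : X U) = 0.
  by case: l; rewrite /= ?mulr1n ?mulr0n ?pd0 // -(cst1 X U) pd_cst.
have pd1 a : pd c a (1 : X U) = 0 by rewrite -(cst1 X U) pd_cst.
have FF : F = F'.
  have E S0 T0 F0 : op2c c S0 T0 F0 1 = F0.
    rewrite /op2c /sec_part /vec_part big1 => [|a _]; last first.
      by rewrite big1 // => b _; rewrite pd1 pd0 // mulr0.
    rewrite mulr0 add0r big1 => [|a _]; last by rewrite pd1 mulr0.
    by rewrite add0r mulr1.
  by have := H 1; rewrite !E.
have TT k : T k = T' k.
  have E S0 T0 F0 : op2c c S0 T0 F0 (x k) = T0 k + F0 * x k.
    rewrite /op2c /sec_part /vec_part big1 => [|a _]; last first.
      by rewrite big1 // => b _; rewrite pdx pdd // mulr0.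
    rewrite mulr0 add0r (bigD1 k) //= big1 ?addr0 ?pdx ?eqxx ?mulr1 // => a ak.
    by rewrite pdx (negPf ak) mulr0.
  by have := H (x k); rewrite !E FF => /addIr.
split=> // k l.
have pk b : spar X (ipar b) (x b) by exact: coord_par.
have E S0 : ssym eps S0 -> sec_part c S0 (x k * x l) = S0 k l + S0 k l.
  move=> sym; transitivity (\sum_a \sum_b (S0 a b * ((a == k)%:R * (b == l)%:R)
      + (-1) ^+ (ipar a && ipar k) * (S0 a b * ((a == l)%:R * (b == k)%:R)))).
    apply: eq_bigr => a _; apply: eq_bigr => b _.
    rewrite (pdM Uc _ _ (pk k)) !pdx (pdD Uc) (pd_sign Uc) (pdM Uc _ _ (pk k)).
    have de (i j : 'I_(n + m)) : spar X false ((i == j)%:R : X U).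
      by case: eqP => _; [exact: spar1|exact: spar0].
    rewrite (pdM Uc _ _ (de a k)) !pdx !pdd !(mul0r, mulr0, addr0, add0r) andbF expr0 mul1r.
    by case: (ipar a && ipar k); rewrite ?expr0 ?expr1 (even_comm _ (de b k)); nc_ring.
  under eq_bigr => a _ do rewrite big_split /=.
  rewrite big_split /=; congr (_ + _).
    rewrite (bigD1 k) //= [X in _ + X]big1 ?addr0 => [|a ak]; last first.
      by apply: big1 => b _; rewrite (negPf ak) mul0r mulr0.
    rewrite (bigD1 l) //= big1 ?addr0 ?eqxx ?mulr1 // => b bl.
    by rewrite (negPf bl) !mulr0.
  rewrite (bigD1 l) //= [X in _ + X]big1 ?addr0 => [|a ak]; last first.
    by apply: big1 => b _; rewrite (negPf ak) mul0r !mulr0.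
  rewrite (bigD1 k) //= big1 ?addr0 ?eqxx ?mulr1 => [|b bl]; last first.
    by rewrite (negPf bl) !mulr0.
  by have [_ ->] := sym k l; rewrite andbC.
have := H (x k * x l); rewrite /op2c FF !E //.
rewrite (_ : vec_part c T _ = vec_part c T' (x k * x l)); last first.
  by apply: eq_bigr => a _; rewrite TT.
move=> /addIr/addIr; rewrite !mulrDr -!mulrDl -cstD.
by rewrite (_ : 2^-1 + 2^-1 = 1 :> R) ?cst1 ?mul1r //; lra.
Qed.

(** Conjugation by the power v = g^(-w), u = g^w of a density g with logarithmic
    derivative beta. Both the change of coordinates, with g the Berezinian, and
    the Laplace-Beltrami pencil, with g a volume form, are instances. *)
Section Gauge.
Variables (S : 'I_(n + m) -> 'I_(n + m) -> X U) (beta : 'I_(n + m) -> X U).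
Hypotheses (symS : ssym eps S) (hbeta : forall a, spar X (ipar a) (beta a)).
Variables (w : R) (u v : X U).
Hypotheses (ue : spar X false u) (ve : spar X false v) (uv : u * v = 1).
Hypothesis dv : forall a, pd c a v = cst X (- w) * beta a * v.
Local Notation b := (tapply S beta).
Local Notation t := (cst X w).

Lemma tapply_par : spar_vec eps b.
Proof.
move=> a; apply: spar_sum => k _; have [h _] := symS a k.
by apply: (sparM' h (hbeta k)); rewrite -!addbA addbb addbF.
Qed.

Lemma sdiv_tapply : sdiv c eps b =
  \sum_a \sum_k S a k * pd c k (beta a) + \sum_a tdiv c eps S a * beta a.
Proof.
rewrite /sdiv /tapply.
under eq_bigr => k _ do rewrite (pd_sum Uc) mulr_sumr.
rewrite exchange_big -big_split /=; apply: eq_bigr => a _.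
rewrite /tdiv /sdiv mulr_suml -big_split /=; apply: eq_bigr => k _.
have [h _] := symS k a; have [_ ->] := symS a k; rewrite (pdM Uc _ _ h).
by case: (eps); case: (ipar k); case: (ipar a); signs; nc_ring.
Qed.

Let nabla a psi := pd c a psi - t * beta a * psi.

Let pd_v a psi : pd c a (v * psi) = v * nabla a psi.
Proof.
rewrite (pdM Uc _ _ ve) andbF expr0 mul1r dv cstN /nabla.
by rewrite -(even_comm (- t * beta a) ve); nc_ring.
Qed.

Let uSv (s x : X U) : u * (s * (v * x)) = s * x.
Proof. by rewrite mulrA (even_comm s ue) -mulrA [u * _]mulrA uv mul1r. Qed.

Lemma vec_gauge T psi : u * vec_part c T (v * psi) =
  vec_part c T psi - t * ((\sum_a T a * beta a) * psi).
Proof.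
rewrite /vec_part mulr_sumr mulr_suml mulr_sumr -sumrB; apply: eq_bigr => a _.
by rewrite pd_v uSv /nabla mulrBr !mulrA (cst_comm _ (T a)).
Qed.

(** Conjugation replaces each d_a by d_a - w beta_a. The two cross terms in S
    agree by its supersymmetry, which gives the first order term. The terms free
    of derivatives of psi and beta occur with w^2 in the second order part and
    with -w in the contraction with S beta, hence with w(w - 1) in total. *)
Lemma lap_gauge psi :
  u * (lap c eps S (v * psi) + vec_part c b (v * psi)) =
  lap c eps S psi - cst X (2 * w - 1) * vec_part c b psi - t * sdiv c eps b * psi
  + cst X (w * (w - 1)) * (\sum_a b a * beta a) * psi.
Proof.
rewrite mulrDr vec_gauge /lap mulrDr vec_gauge sdiv_tapply.
have -> : u * sec_part c S (v * psi) = sec_part c S psi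
    - t * ((\sum_a \sum_k S a k * pd c k (beta a)) * psi) - t * vec_part c b psi
    - t * vec_part c b psi + t * t * ((\sum_a b a * beta a) * psi).
  have E1 : vec_part c b psi = \sum_a \sum_k S a k * beta k * pd c a psi.
    by apply: eq_bigr => a _; rewrite mulr_suml.
  have E2 : vec_part c b psi =
      \sum_a \sum_k (-1) ^+ (ipar a && ipar k) * (S a k * beta a * pd c k psi).
    rewrite E1 exchange_big; apply: eq_bigr => a _; apply: eq_bigr => k _.
    by have [_ ->] := symS k a; rewrite -!mulrA andbC.
  have E3 : (\sum_a b a * beta a) * psi = \sum_a \sum_k S a k * beta k * beta a * psi.
    rewrite mulr_suml; apply: eq_bigr => a _; rewrite /tapply !mulr_suml.
    by apply: eq_bigr => k _.
  have E4 : (\sum_a \sum_k S a k * pd c k (beta a)) * psi =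
      \sum_a \sum_k S a k * pd c k (beta a) * psi.
    by rewrite mulr_suml; apply: eq_bigr => a _; rewrite mulr_suml.
  have dblZ r (F : 'I_(n + m) -> 'I_(n + m) -> X U) :
      r * (\sum_a \sum_k F a k) = \sum_a \sum_k r * F a k.
    by rewrite mulr_sumr; apply: eq_bigr => a _; rewrite mulr_sumr.
  rewrite {1}E2 E1 E3 E4 /sec_part !dblZ -!sumrB -big_split /=; apply: eq_bigr => a _.
  rewrite -!sumrB -big_split /=; apply: eq_bigr => k _.
  rewrite pd_v pd_v uSv /nabla (pdB Uc) -mulrA pd_cstM // (pdM Uc _ _ (hbeta a)).
  set D := pd c k (pd c a psi); set Da := pd c a psi; set Dk := pd c k psi.
  set e := (-1) ^+ _.
  have eC : S a k * e = e * S a k by rewrite /e signC.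
  transitivity (S a k * D - (S a k * t) * (pd c k (beta a) * psi) -
    t * (e * (S a k * beta a * Dk)) - (S a k * t) * (beta k * Da)
    + (S a k * t) * (beta k * t) * (beta a * psi)).
    have -> : t * (e * (S a k * beta a * Dk)) = (S a k * t) * e * beta a * Dk.
      by rewrite -(cst_comm w (S a k)); rewrite -[t * S a k * e]mulrA eC; nc_ring.
    by nc_ring.
  rewrite -(cst_comm w (S a k)) -(cst_comm w (beta k)).
  rewrite (_ : t * S a k * (t * beta k) = t * t * (S a k * beta k)); last first.
    by rewrite -[t * S a k * _]mulrA [S a k * (t * _)]mulrA -(cst_comm w (S a k)); nc_ring.
  by rewrite /e andbC; nc_ring.
rewrite (_ : cst X (2 * w - 1) = t + t - 1); last by rewrite -cst1 -cstD -cstN -cstD; congr cst; ring.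
rewrite (_ : cst X (w * (w - 1)) = t * t - t); last by rewrite -cstM -cstN -cstD; congr cst; ring.
by nc_ring.
Qed.

End Gauge.
End OneChart.
End Operators.

(** * Canonical pencils are invariant under changes of coordinates *)

Section Change.
Variables (R : realType) (M : topologicalType) (X : superspace R M).
Variables (n m : nat) (c c' : chart X n m) (eps : bool) (U : opens M).
Hypotheses (Uc : U `<=` cdom c) (Uc' : U `<=` cdom c').
Local Notation J := (jac c c' U).
Local Notation K := (jac c' c U).
Local Notation h := (dlog c c' U).
Implicit Types (psi theta : X U).

Lemma jac_contrK T b : \sum_a (\sum_k T k * K k a) * J a b = T b.
Proof.
under eq_bigr => a _ do rewrite mulr_suml.
rewrite exchange_big (eq_bigr (fun k => T k * (k == b)%:R)) => [|k _].
  rewrite (bigD1 b) //= eqxx mulr1 big1 ?addr0 // => k /negPf kb.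
  by rewrite kb mulr0.
under eq_bigr => a _ do rewrite -mulrA.
rewrite -mulr_sumr; congr (_ * _).
by have /matrixP/(_ k b) := jac_inv Uc' Uc; rewrite mxE => ->; rewrite mxE.
Qed.

Section Tensor.
Variable S : 'I_(n + m) -> 'I_(n + m) -> X U.
Hypothesis symS : ssym eps S.

(** The tensor S is transformed one index at a time. After the first step the
    other index is still that of a vector field in the coordinates of c', whose
    divergence is known to change by sdiv_change. *)
Definition half_change k b : X U := (-1) ^+ (ipar b && ipar k) * \sum_a S b a * K a k.
Definition tens_change k l : X U := \sum_b half_change k b * K b l.

Lemma half_change_par k b : spar X (eps (+) ipar k (+) ipar b) (half_change k b).
Proof.
apply: spar_sign; apply: spar_sum => a _; have [hS _] := symS b a.
apply: (sparM' hS (jac_par a k Uc' Uc)).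
by case: (eps); case: (ipar a); case: (ipar b); case: (ipar k).
Qed.

Lemma tens_changeE k l : tens_change k l =
  \sum_a \sum_b (-1) ^+ (ipar b && (ipar a (+) ipar k)) * (S a b * K a k * K b l).
Proof.
rewrite exchange_big; apply: eq_bigr => b _; rewrite /half_change mulr_sumr mulr_suml.
apply: eq_bigr => a _; have [_ ->] := symS b a.
by case: (ipar a); case: (ipar b); case: (ipar k); signs; nc_ring.
Qed.

(** The supersymmetry of the transformed tensor makes up for the asymmetry of
    the transformation in two steps. *)
Lemma tens_change_sym : ssym eps tens_change.
Proof.
move=> k l; split.
  apply: spar_sum => b _; apply: (sparM' (half_change_par k b) (jac_par b l Uc' Uc)).
  by case: (eps); case: (ipar b); case: (ipar k); case: (ipar l).
rewrite [LHS]tens_changeE mulr_sumr; apply: eq_bigr => a _.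
rewrite /half_change mulr_sumr mulr_suml mulr_sumr; apply: eq_bigr => b _.
have := supercomm (jac_par a k Uc' Uc) (jac_par b l Uc' Uc).
rewrite -!mulrA => ->.
by case: (ipar a); case: (ipar b); case: (ipar k); case: (ipar l); signs; nc_ring.
Qed.

Lemma half_changeE k b : \sum_l tens_change k l * J l b = half_change k b.
Proof. exact: jac_contrK. Qed.

(** The inhomogeneous term of the second order part and the divergence of S
    together are the divergence of the half transformed tensor. *)
Lemma tdiv_change k :
  \sum_a \sum_b S a b * pd c' b (K a k) + \sum_a tdiv c' eps S a * K a k =
  tdiv c eps tens_change k + tapply tens_change h k.
Proof.
have := sdiv_change Uc Uc' (e := eps (+) ipar k) (F := tens_change k).
move=> /(_ (fun l => (tens_change_sym k l).1)).
have -> : sdiv c (eps (+) ipar k) (tens_change k) = tdiv c eps tens_change k.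
  apply: eq_bigr => l _; have [_ ->] := tens_change_sym k l.
  rewrite (pd_sign Uc) mulrA; congr (_ * _).
  by case: (eps); case: (ipar k); case: (ipar l); signs; nc_ring.
move=> <-.
have -> : sdiv c' (eps (+) ipar k) (fun b => \sum_l tens_change k l * J l b) =
    sdiv c' (eps (+) ipar k) (half_change k).
  by apply: eq_bigr => b _; rewrite half_changeE.
rewrite [sdiv c' _ _]/sdiv exchange_big.
have -> : \sum_a tdiv c' eps S a * K a k =
    \sum_b \sum_a (-1) ^+ (ipar b && ~~ eps) * (pd c' b (S b a) * K a k).
  rewrite exchange_big; apply: eq_bigr => a _; rewrite /tdiv /sdiv mulr_suml.
  by apply: eq_bigr => b _; rewrite mulrA.
rewrite -big_split /=; apply: eq_bigr => b _.
rewrite /half_change (pd_sign Uc') (pd_sum Uc') !mulr_sumr -big_split /=.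
apply: eq_bigr => a _; have [hS _] := symS b a; rewrite (pdM Uc' _ _ hS).
have [_ ->] := symS a b.
by case: (eps); case: (ipar a); case: (ipar b); case: (ipar k); signs; nc_ring.
Qed.

(** The chain rule applied twice; the inhomogeneous term comes from the
    derivatives of the Jacobian. *)
Lemma sec_change psi : sec_part c' S psi = sec_part c tens_change psi +
  \sum_k (\sum_a \sum_b S a b * pd c' b (K a k)) * pd c k psi.
Proof.
rewrite /sec_part.
transitivity (\sum_k (\sum_l \sum_a \sum_b
    (-1) ^+ (ipar b && (ipar a (+) ipar k)) * (S a b * K a k * K b l) * pd c l (pd c k psi)
    + \sum_a \sum_b S a b * pd c' b (K a k) * pd c k psi)).
  under [RHS]eq_bigr => k _ do rewrite exchange_big -big_split /=.
  rewrite [RHS]exchange_big; apply: eq_bigr => a _ /=.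
  under [RHS]eq_bigr => k _ do rewrite exchange_big -big_split /=.
  rewrite [RHS]exchange_big; apply: eq_bigr => b _ /=.
  rewrite (chain_rule a psi Uc' Uc) (pd_sum Uc') mulr_sumr; apply: eq_bigr => k _.
  rewrite (pdM Uc' _ _ (jac_par a k Uc' Uc)) (chain_rule b (pd c k psi) Uc' Uc).
  rewrite mulrDr addrC !mulrA; congr (_ + _).
  rewrite mulr_sumr; apply: eq_bigr => l _.
  by rewrite -(signC _ (S a b)); nc_ring.
rewrite big_split /=; congr (_ + _); apply: eq_bigr => k _.
  apply: eq_bigr => l _; rewrite tens_changeE mulr_suml; apply: eq_bigr => a _.
  by rewrite mulr_suml.
by rewrite mulr_suml; apply: eq_bigr => a _; rewrite mulr_suml.
Qed.

Lemma vec_change T psi :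
  vec_part c' T psi = vec_part c (fun k => \sum_a T a * K a k) psi.
Proof.
rewrite /vec_part; under [RHS]eq_bigr => k _ do rewrite mulr_suml.
rewrite exchange_big; apply: eq_bigr => a _ /=.
rewrite (chain_rule a psi Uc' Uc) mulr_sumr; apply: eq_bigr => k _.
by rewrite mulrA.
Qed.

Lemma lap_change psi : lap c' eps S psi =
  lap c eps tens_change psi + vec_part c (tapply tens_change h) psi.
Proof.
rewrite /lap sec_change vec_change -!addrA; congr (_ + _).
rewrite -vec_partD /vec_part -big_split /=.
by apply: eq_bigr => k _; rewrite -mulrDl tdiv_change.
Qed.

End Tensor.

(** The local form of a pencil is stable under changes of coordinates, with new
    coefficients that do not depend on the weight. The change of the second order
    part is a gradient term with the logarithmic derivative of the Berezinian, and
    conjugation by the w-th power of the Berezinian turns it into corrections of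
    gamma and theta with exactly the coefficients 2w - 1 and w(w - 1). *)
Lemma pencil_change S gamma theta : ssym eps S -> spar_vec eps gamma -> spar X eps theta ->
  spositive c (Ber J) ->
  exists S1 gamma1 theta1, [/\ ssym eps S1, spar_vec eps gamma1, spar X eps theta1 &
    forall w psi, pencilc c' eps w S gamma theta (spow c (Ber J) (- w) * psi)
      * spow c (Ber J) w = pencilc c eps w S1 gamma1 theta1 psi].
Proof.
move=> symS gp tp Jpos.
have Be := jac_ber_par Uc Uc' Jpos; have B0 := spositive_nonvanishing Jpos.
set S1 := tens_change S; have symS1 : ssym eps S1 by exact: tens_change_sym.
pose g a := \sum_b gamma b * K b a.
have gpar : spar_vec eps g.
  move=> a; apply: spar_sum => b _; apply: (sparM' (gp b) (jac_par b a Uc' Uc)).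
  by case: (eps); case: (ipar a); case: (ipar b).
have hp a : spar X (ipar a) (h a) by exact: dlog_par.
pose bb := tapply S1 h; have bpar : spar_vec eps bb by exact: tapply_par.
pose gh := \sum_a g a * h a; pose bh := \sum_a bb a * h a.
have cpar (F : 'I_(n + m) -> X U) : spar_vec eps F -> spar X eps (\sum_a F a * h a).
  move=> hF; apply: spar_sum => a _; apply: (sparM' (hF a) (hp a)).
  by rewrite -addbA addbb addbF.
exists S1, (fun a => g a - bb a), (theta + bh - gh - gh); split => //.
- by move=> a; apply: sparB.
- by do 2?[apply: sparB; last exact: cpar]; apply: sparD => //; exact: cpar.
move=> w psi; set u := spow c (Ber J) w; set v := spow c (Ber J) (- w).
have ue : spar X false u by exact: spow_par.
have ve : spar X false v by exact: spow_par.
have uv : u * v = 1 by exact: spowNr.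
have dv a : pd c a v = cst X (- w) * h a * v.
  rewrite {1}/v pd_spow // (sabs_pos Uc B0 Jpos) (pd_ber Uc Uc' Jpos).
  have E : spow c (Ber J) (- w - 1) * Ber J = v.
    by rewrite -(even_comm _ Be) -{1}(sabs_pos Uc B0 Jpos) sabs_spow.
  rewrite -[RHS]mulrA -(even_comm (h a) ve) -E.
  move: (Ber J) (spow _ _ _) => B P; nc_ring.
have L := lap_gauge Uc symS1 hp ue ve uv dv psi.
have G := vec_gauge Uc ue ve uv dv g psi.
have dG : sdiv c' eps gamma = sdiv c eps g + gh.
  rewrite -(sdiv_change Uc Uc' gpar); apply: eq_bigr => b _; congr (_ * pd _ _ _).
  by rewrite jac_contrK.
have uS s : u * (s * (v * psi)) = s * psi.
  by rewrite mulrA (even_comm s ue) -mulrA [u * _]mulrA uv mul1r.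
have uc r x : u * (cst X r * x) = cst X r * (u * x).
  by rewrite mulrA -(cst_comm _ u) -mulrA.
rewrite -(even_comm _ ue) /pencilc (lap_change symS) (vec_change gamma) dG -/S1.
rewrite uc; congr (_ * _).
have -> : vec_part c (fun a => g a - bb a) psi = vec_part c g psi - vec_part c bb psi.
  by rewrite -sumrB; apply: eq_bigr => a _; rewrite mulrBl.
have -> : sdiv c eps (fun a => g a - bb a) = sdiv c eps g - sdiv c eps bb.
  by rewrite -sumrB; apply: eq_bigr => a _; rewrite (pdB Uc) mulrBr.
rewrite 2!mulrDr [u * (_ + _ + _)]mulrDr L uc G -[cst X w * _ * (v * psi)]mulrA uc uS.
rewrite -[cst X (w * (w - 1)) * theta * (v * psi)]mulrA uc uS -/gh -/bb -/bh.
rewrite (_ : cst X (2 * w - 1) = cst X w + cst X w - 1); last first.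
  by rewrite -(cst1 X U) -cstD -cstN -cstD; congr cst; ring.
rewrite (_ : cst X (w * (w - 1)) = cst X w * cst X w - cst X w); last first.
  by rewrite -cstM -cstN -cstD; congr cst; ring.
by nc_ring.
Qed.

End Change.

(** * Densities *)

Section AtlasTheory.
Variables (R : realType) (M : topologicalType) (X : superspace R M).
Variables (n m : nat) (A : atlas X n m).
Implicit Types (U V W : opens M) (i j k : aidx A) (w : R).

Lemma opens_eq U V : U `<=` V -> V `<=` U -> U = V.
Proof.
case: U V => [u uo] [v vo] /= uv vu; have E : u = v by apply/seteqP.
by move: uo vo; rewrite {uv vu}E => uo vo; congr Opens; exact: Prop_irrelevance.
Qed.

Lemma jac_pos i j U : U `<=` cdom (A i) -> U `<=` cdom (A j) ->
  spositive (A i) (Ber (jac (A i) (A j) U)).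
Proof.
move=> Ui Uj; have pos := @atlas_pos _ _ _ _ _ A i j.
have sub : U `<=` oI (cdom (A i)) (cdom (A j)) by move=> x Ux; split; [exact: Ui|exact: Uj].
rewrite -(@res_ber _ _ _ _ _ (A i) (A j) _ _ _ pos) //; try by move=> x [].
apply/spositiveP => x Ux; rewrite sbody_res //; try by move=> y [].
  exact: (spositiveP _ _).1 pos _ (sub _ Ux).
Qed.

Section Transition.
Variables (i j : aidx A) (U : opens M).
Hypotheses (Ui : U `<=` cdom (A i)) (Uj : U `<=` cdom (A j)).

Definition trans w : X U := spow (A i) (Ber (jac (A i) (A j) U)) w.

Lemma trans_ber_par : spar X false (Ber (jac (A i) (A j) U)).
Proof. exact: jac_ber_par Ui Uj (jac_pos Ui Uj). Qed.

Lemma trans_nonvanishing : snonvanishing (A i) (Ber (jac (A i) (A j) U)).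
Proof. exact: spositive_nonvanishing (jac_pos Ui Uj). Qed.

Lemma trans_par w : spar X false (trans w).
Proof. exact (spow_par Ui trans_ber_par trans_nonvanishing w). Qed.

Lemma transNr w : trans w * trans (- w) = 1.
Proof. exact (spowNr Ui w trans_ber_par trans_nonvanishing). Qed.

Lemma res_trans V w : V `<=` U ->
  res V (trans w) = spow (A i) (Ber (jac (A i) (A j) V)) w.
Proof.
move=> VU; rewrite /trans (spow_res _ _ VU trans_ber_par trans_nonvanishing) //.
by rewrite res_ber //; exact: jac_pos.
Qed.

End Transition.

(** Powers of the Berezinian inherit the cocycle property, since powers are
    multiplicative and do not depend on the chart in which they are formed. *)
Lemma trans_cocycle i j k U w : U `<=` cdom (A i) -> U `<=` cdom (A j) -> U `<=` cdom (A k) ->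
  trans i k U w = trans j k U w * trans i j U w.
Proof.
move=> Ui Uj Uk; have eij := trans_ber_par Ui Uj; have ejk := trans_ber_par Uj Uk.
have pij := jac_pos Ui Uj; have pjk := jac_pos Uj Uk.
have pjk' := spositive_chart Uj Ui pjk.
have gen (f g : X U) : spar X false f -> spar X false g ->
    spositive (A i) f -> spositive (A i) g ->
    spow (A i) (f * g) w = spow (A i) g w * spow (A i) f w.
  by move=> fe ge fpos gpos; rewrite (even_comm _ fe); exact: spowM.
have E := ber_cocycle Ui Uj Uk pij pjk (jac_pos Ui Uk).
rewrite /trans -(spow_chart w Ui Uj ejk pjk') E.
exact (gen _ _ eij ejk pij pjk').
Qed.

Lemma trans_id i U w : U `<=` cdom (A i) -> trans i i U w = 1.
Proof.
move=> Ui; have := trans_cocycle w Ui Ui Ui => /(congr1 (fun u => u * trans i i U (- w))).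
by rewrite -mulrA transNr // mulr1.
Qed.

Lemma density_eq w W (psi chi : density A w W) : (forall i, psi i = chi i) -> psi = chi.
Proof.
case: psi chi => [f hf] [g hg] /= fg.
have E : f = g by apply: functional_extensionality_dep.
by move: hf hg; rewrite E => hf hg; congr Density; exact: Prop_irrelevance.
Qed.

Lemma density_change_trans w W (psi : density A w W) i j V :
  V `<=` W -> V `<=` cdom (A i) -> V `<=` cdom (A j) ->
  res V (psi j) = trans i j V (- w) * res V (psi i).
Proof.
move=> VW Vi Vj; have := density_change psi i j => /=.
set V0 := oI W _; have V0i : V0 `<=` cdom (A i) by move=> x [_ []].
have V0j : V0 `<=` cdom (A j) by move=> x [_ []].
have VV0 : V `<=` V0 by move=> x Vx; split; [exact: VW|split; [exact: Vi|exact: Vj]].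
have s k : V0 `<=` cdom (A k) -> V0 `<=` oI W (dom k).
  by move=> V0k x V0x; split; [case: V0x|exact: V0k].
move=> /(congr1 (res V)); rewrite resM // !res_comp //; try exact: s.
rewrite -/(trans i j V0 w) res_trans // -/(trans i j V w) => ->.
have e := trans_par Vi Vj w.
by rewrite -(even_comm _ e) mulrA -(even_comm _ e) transNr // mul1r.
Qed.

(** Over an open inside a chart a density may have any coefficient in that
    chart, the coefficients in the others being given by the cocycle. Hence an
    operator on densities determines its local expressions. *)
Lemma density_onto w i V (chi : X (oI V (dom i))) : V `<=` cdom (A i) ->
  exists phi : density A w V, phi i = chi.
Proof.
move=> Vi; set V' := oI V _ in chi *.
have VV' : V `<=` V' by move=> x Vx; split => //; exact: Vi.
have V'V : V' `<=` V by move=> x [].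
pose g := res V chi.
pose f j : X (oI V (dom j)) := res _ g * trans j i (oI V (dom j)) w.
have hf j k : let U := oI V (oI (dom j) (dom k)) in
    res U (f j) = res U (f k) * spow (A j) (Ber (jac (A j) (A k) U)) w.
  move=> U.
  have UV : U `<=` V by move=> x [].
  have Uj : U `<=` cdom (A j) by move=> x [_ []].
  have Uk : U `<=` cdom (A k) by move=> x [_ []].
  have Ui : U `<=` cdom (A i) by move=> x /UV /Vi.
  have s (l : aidx A) : U `<=` cdom (A l) -> U `<=` oI V (dom l).
    by move=> Ul x Ux; split; [exact: UV|exact: Ul].
  have sV (l : aidx A) : oI V (dom l) `<=` V by move=> x [].
  have sl (l : aidx A) : oI V (dom l) `<=` cdom (A l) by move=> x [].
  have si (l : aidx A) : oI V (dom l) `<=` cdom (A i) by move=> x [/Vi].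
  have E l : U `<=` cdom (A l) -> res U (f l) = res U g * trans l i U w.
    move=> Ul; rewrite /f (resM _ _ (s _ Ul)) (res_comp _ (sV l) (s _ Ul)).
    congr (_ * _); exact: (res_trans (sl l) (si l) w (s _ Ul)).
  rewrite (E j Uj) (E k Uk) (trans_cocycle w Uj Uk Ui).
  exact: mulrA.
exists (Density hf) => /=; rewrite /f trans_id; last by move=> x [].
by rewrite mulr1 /g res_comp // res_id.
Qed.

End AtlasTheory.

(** * Pencils through a given operator *)

Section PencilAlgebra.
Variables (R : realType) (M : topologicalType) (X : superspace R M).
Variables (n m : nat) (c : chart X n m) (eps : bool) (U : opens M).
Hypothesis Uc : U `<=` cdom c.
Implicit Types (S : 'I_(n + m) -> 'I_(n + m) -> X U) (T gamma : 'I_(n + m) -> X U).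
Implicit Types (F theta psi : X U) (V : opens M).

Lemma ssym_res S V : V `<=` U -> ssym eps S -> ssym eps (fun a b => res V (S a b)).
Proof.
move=> VU sym a b; have [h e] := sym a b; split; first exact: res_par.
by rewrite e resM // res_sign.
Qed.

Lemma spar_vec_res T V : V `<=` U -> spar_vec eps T -> spar_vec eps (fun a => res V (T a)).
Proof. by move=> VU h a; exact: res_par. Qed.

Lemma sec_part_res S psi V : V `<=` U ->
  res V (sec_part c S psi) = sec_part c (fun a b => res V (S a b)) (res V psi).
Proof.
move=> VU; rewrite res_sum //; apply: eq_bigr => a _; rewrite res_sum //.
by apply: eq_bigr => b _; rewrite resM // !pd_res.
Qed.

Lemma vec_part_res T psi V : V `<=` U ->
  res V (vec_part c T psi) = vec_part c (fun a => res V (T a)) (res V psi).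
Proof.
by move=> VU; rewrite res_sum //; apply: eq_bigr => a _; rewrite resM // pd_res.
Qed.

Lemma tdiv_res S V a : V `<=` U ->
  res V (tdiv c eps S a) = tdiv c eps (fun a b => res V (S a b)) a.
Proof. by move=> VU; rewrite /tdiv -sdiv_res. Qed.

Lemma pencil_res w S gamma theta psi V : V `<=` U ->
  res V (pencilc c eps w S gamma theta psi) =
  pencilc c eps w (fun a b => res V (S a b)) (fun a => res V (gamma a))
    (res V theta) (res V psi).
Proof.
move=> VU; rewrite /pencilc /lap !(resM, resD) // !res_cst // sec_part_res //.
rewrite !vec_part_res // -sdiv_res //; congr (_ * (_ + _ + _ + _ + _)).
by apply: eq_bigr => a _; rewrite tdiv_res.
Qed.

Lemma cst_inj_mul r (f g : X U) : r != 0 -> cst X r * f = cst X r * g -> f = g.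
Proof.
move=> r0 /(congr1 (fun x => cst X r^-1 * x)).
by rewrite !mulrA -cstM mulVf // cst1 !mul1r.
Qed.

(** The first order term contains gamma with the factor 2w - 1, the free term
    contains theta with the factor w(w - 1). *)
Lemma pencil_inj w S S' gamma gamma' theta theta' : w != 0 -> w != 1 -> w != 2^-1 ->
  ssym eps S -> ssym eps S' ->
  (forall psi, pencilc c eps w S gamma theta psi = pencilc c eps w S' gamma' theta' psi) ->
  [/\ S = S', gamma = gamma' & theta = theta'].
Proof.
move=> w0 w1 wh symS symS' H.
have h2 : (2^-1 : R) != 0 by rewrite invr_eq0 pnatr_eq0.
have hw : 2 * w - 1 != 0.
  by apply: contra wh => /eqP E; apply/eqP; lra.
have hww : w * (w - 1) != 0 by rewrite mulf_neq0 // subr_eq0.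
have [SS TT FF] : [/\ forall a b, S a b = S' a b,
    forall a, cst X (2^-1) * (tdiv c eps S a + cst X (2 * w - 1) * gamma a) =
      cst X (2^-1) * (tdiv c eps S' a + cst X (2 * w - 1) * gamma' a) &
    cst X (2^-1) * (cst X w * sdiv c eps gamma + cst X (w * (w - 1)) * theta) =
    cst X (2^-1) * (cst X w * sdiv c eps gamma' + cst X (w * (w - 1)) * theta')].
  apply: (op2_inj Uc symS symS') => psi.
  by rewrite -!pencil_op2.
have ES : S = S' by apply/funext => a; apply/funext => b.
have Eg : gamma = gamma'.
  apply/funext => a; have := cst_inj_mul h2 (TT a); rewrite ES => /addrI.
  exact: cst_inj_mul.
split=> //; have := cst_inj_mul h2 FF; rewrite Eg => /addrI.
exact: cst_inj_mul.
Qed.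

(** Solutions of 2T = (div S) + (2w - 1) gamma and of
    2F = w div gamma + w(w - 1) theta. *)
Definition gamma_of w S T a : X U :=
  cst X (2 * w - 1)^-1 * (cst X 2 * T a - tdiv c eps S a).
Definition theta_of w S T F : X U :=
  cst X (w * (w - 1))^-1 * (cst X 2 * F - cst X w * sdiv c eps (gamma_of w S T)).

Lemma pencil_of w S T F psi : w != 0 -> w != 1 -> w != 2^-1 ->
  pencilc c eps w S (gamma_of w S T) (theta_of w S T F) psi = op2c c S T F psi.
Proof.
move=> w0 w1 wh.
have hw : 2 * w - 1 != 0.
  by apply: contra wh => /eqP E; apply/eqP; lra.
have hww : w * (w - 1) != 0 by rewrite mulf_neq0 // subr_eq0.
rewrite pencil_op2 /op2c; congr (_ + _ + _ * _).
  apply: eq_bigr => a _; congr (_ * _).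
  rewrite /gamma_of mulrA -cstM mulfV // cst1 mul1r addrC subrK mulrA -cstM.
  by rewrite mulVf ?cst1 ?mul1r // pnatr_eq0.
rewrite /theta_of [cst X (w * (w - 1)) * _]mulrA -cstM mulfV // cst1 mul1r addrC subrK mulrA.
by rewrite -cstM mulVf ?cst1 ?mul1r // pnatr_eq0.
Qed.

Lemma gamma_of_par w S T : ssym eps S -> spar_vec eps T -> spar_vec eps (gamma_of w S T).
Proof.
move=> symS hT a; apply: spar_cstM; apply: sparB; first exact: spar_cstM.
apply: spar_sum => b _; apply: spar_sign; have [h _] := symS b a.
rewrite (_ : eps (+) ipar a = (eps (+) ipar b (+) ipar a) (+) ipar b); first exact: pd_par.
by case: (eps); case: (ipar a); case: (ipar b).
Qed.

Lemma theta_of_par w S T F : ssym eps S -> spar_vec eps T -> spar X eps F ->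
  spar X eps (theta_of w S T F).
Proof.
move=> symS hT hF; apply: spar_cstM; apply: sparB; first exact: spar_cstM.
by apply: spar_cstM; apply: sdiv_par => //; exact: gamma_of_par.
Qed.

End PencilAlgebra.

Section CoefficientsRes.
Variables (R : realType) (M : topologicalType) (X : superspace R M).
Variables (n m : nat) (c : chart X n m) (eps : bool) (U V : opens M).
Hypotheses (Uc : U `<=` cdom c) (VU : V `<=` U).
Implicit Types (S : 'I_(n + m) -> 'I_(n + m) -> X U) (T : 'I_(n + m) -> X U).

Lemma gamma_of_res w S T a : res V (gamma_of c eps w S T a) =
  gamma_of c eps w (fun a b => res V (S a b)) (fun a => res V (T a)) a.
Proof. by rewrite /gamma_of resM // resB // resM // !res_cst // tdiv_res. Qed.

Lemma theta_of_res w S T (F : X U) : res V (theta_of c eps w S T F) =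
  theta_of c eps w (fun a b => res V (S a b)) (fun a => res V (T a)) (res V F).
Proof.
rewrite /theta_of resM // resB // !resM // !res_cst // -sdiv_res //.
congr (_ * (_ - _ * sdiv _ _ _)); apply/funext => a; exact: gamma_of_res.
Qed.

End CoefficientsRes.

(** * The Laplace-Beltrami pencil *)

Section LaplaceBeltrami.
Variables (R : realType) (M : topologicalType) (X : superspace R M).
Variables (n m : nat) (c : chart X n m) (eps : bool) (U : opens M).
Hypothesis Uc : U `<=` cdom c.
Variables (S : 'I_(n + m) -> 'I_(n + m) -> X U) (rho : X U).
Hypotheses (symS : ssym eps S) (rhoe : spar X false rho) (rho0 : snonvanishing c rho).

(** The logarithmic derivative of |rho|, with which the Laplace-Beltrami pencil is
    obtained from the operator of weight 0 by conjugation. *)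
Definition vol_log a : X U := spow c rho (- 1) * pd c a (spow c rho 1).
Definition LB_gamma a : X U := - tapply S vol_log a.
Definition LB_theta : X U := \sum_a tapply S vol_log a * vol_log a.

(** At weight 0 the operator is S^{ab} d_b d_a plus the divergence of S plus the
    contraction of S with the logarithmic derivative of rho; at weight w it is
    conjugated by the w-th power of rho, which lap_gauge computes. *)
Lemma LB_pencil w psi :
  cst X (2^-1) * (\sum_a spow c rho (w - 1) *
    pd c a (spow c rho 1 * \sum_b S a b * pd c b (spow c rho (- w) * psi))
    * (-1) ^+ (ipar a && ~~ eps)) =
  pencilc c eps w S LB_gamma LB_theta psi.
Proof.
have P t : spar X false (spow c rho t) by exact: spow_par.
have D s t : spow c rho s * spow c rho t = spow c rho (s + t) by exact: spowD.
have hb a : spar X (ipar a) (vol_log a) by by apply: sparMl (P _) _; rewrite -[ipar a]addFb; exact: pd_par.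
set u := spow c rho w; set v := spow c rho (- w).
have uv : u * v = 1 by exact: spowNr.
have dv a : pd c a v = cst X (- w) * vol_log a * v.
  rewrite /v pd_spow // -(spow1 Uc rhoe rho0) -(D (- w) (- 1)) /vol_log.
  by rewrite -[RHS]mulrA -(even_comm (_ * pd c a _) (P (- w))); nc_ring.
set chi := v * psi.
pose F a := \sum_b S a b * pd c b chi.
have E a : spow c rho (w - 1) * pd c a (spow c rho 1 * F a) * (-1) ^+ (ipar a && ~~ eps) =
    u * ((-1) ^+ (ipar a && ~~ eps) * pd c a (F a) +
     (-1) ^+ (ipar a && ~~ eps) * (vol_log a * F a)).
  rewrite (pdM Uc _ _ (P 1)) andbF expr0 mul1r -signC.
  have -> : pd c a (spow c rho 1) = spow c rho 1 * vol_log a.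
    by rewrite /vol_log mulrA D subrr spow0 // mul1r.
  have -> : u = spow c rho (w - 1) * spow c rho 1 by rewrite D subrK.
  by case: (_ && _); rewrite ?expr0 ?expr1; nc_ring.
rewrite (eq_bigr _ (fun a _ => E a)) -mulr_sumr big_split /=.
have L := lap_gauge Uc symS hb (P w) (P (- w)) uv dv psi.
have -> : \sum_a (-1) ^+ (ipar a && ~~ eps) * pd c a (F a) = lap c eps S chi.
  rewrite /F; under eq_bigr => a _ do rewrite (pd_sum Uc) mulr_sumr.
  rewrite /lap /sec_part /vec_part /tdiv /sdiv [X in _ = X + _]exchange_big.
  rewrite [X in _ = _ + X](eq_bigr _ (fun b _ => mulr_suml _ _ _ _)).
  rewrite [X in _ = _ + X]exchange_big -big_split /=; apply: eq_bigr => a _.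
  rewrite -big_split; apply: eq_bigr => b _ /=.
  have [h _] := symS a b; have [_ ->] := symS b a; rewrite (pdM Uc _ _ h).
  by case: (eps); case: (ipar a); case: (ipar b); signs; nc_ring.
have -> : \sum_a (-1) ^+ (ipar a && ~~ eps) * (vol_log a * F a) =
    vec_part c (tapply S vol_log) chi.
  rewrite /vec_part /tapply /F; under eq_bigr => a _ do rewrite !mulr_sumr.
  rewrite exchange_big; apply: eq_bigr => a _; rewrite mulr_suml.
  apply: eq_bigr => b _; have [h _] := symS b a; have [_ ->] := symS a b.
  rewrite [vol_log b * _]mulrA (supercomm (hb b) h).
  by case: (eps); case: (ipar a); case: (ipar b); signs; nc_ring.
rewrite L /pencilc -/LB_theta; congr (_ * _).
have -> : vec_part c LB_gamma psi = - vec_part c (tapply S vol_log) psi.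
  by rewrite -sumrN; apply: eq_bigr => a _; rewrite mulNr.
have -> : sdiv c eps LB_gamma = - sdiv c eps (tapply S vol_log).
  by rewrite -sumrN; apply: eq_bigr => a _; rewrite (pdN Uc) mulrN.
by rewrite !(mulrN, mulNr) -!mulrA.
Qed.

End LaplaceBeltrami.

(** * Pencils on the supermanifold *)

Section Pencils.
Variables (R : realType) (M : topologicalType) (X : superspace R M).
Variables (n m : nat) (A : atlas X n m) (eps : bool).
Implicit Types (U V W : opens M) (i j : aidx A) (w : R).
Implicit Types (S : tens_coefs A) (gamma T Q : vec_coefs A) (theta F : fun_coefs A).

Lemma pencil_locE w i U (S : 'I_(n + m) -> 'I_(n + m) -> X U)
    (gamma : 'I_(n + m) -> X U) (theta psi : X U) :
  pencil_loc eps w i S gamma theta psi = pencilc (A i) eps w S gamma theta psi.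
Proof.
rewrite /pencil_loc /pencilc /lap -/(sec_part (A i) S psi).
have -> : \sum_a pd (A i) a (gamma a) * sgn X eps a U = sdiv (A i) eps gamma.
  by apply: eq_bigr => a _; rewrite signC.
rewrite -vec_partZ; congr (_ * (_ + _ + _)); rewrite -[RHS]addrA -vec_partD; congr (_ + _).
apply: eq_bigr => a _; congr ((_ + _) * _).
by apply: eq_bigr => b _; rewrite signC.
Qed.

Lemma lie_locE w i U (Q : 'I_(n + m) -> X U) psi : lie_loc eps w i Q psi =
  vec_part (A i) Q psi + cst X w * sdiv (A i) eps Q * psi.
Proof.
congr (_ + _ * _ * _); apply: eq_bigr => a _; rewrite signC //.
Qed.

Lemma density_surj w i V (chi : X V) : V `<=` cdom (A i) ->
  exists phi : density A w V, res V (phi i) = chi.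
Proof.
move=> Vi; have [phi E] := density_onto w (res (oI V (dom i)) chi) Vi.
exists phi; rewrite E res_comp ?res_id //; first by move=> x [].
by move=> x Vx; split => //; exact: Vi.
Qed.

(** A single operator given by the coefficients of a pencil. Nothing is required
    of the behaviour of the coefficients under changes of coordinates: the
    transformation law of the operator takes care of it. *)
Definition pencil_form w (L : operator A w) S gamma theta :=
  forall i W (psi : density A w W), let V := oI W (dom i) in
    L W psi i = pencilc (A i) eps w (fun a b => res V (S i a b))
      (fun a => res V (gamma i a)) (res V (theta i)) (psi i).

Lemma canonical_form (D : forall w, operator A w) S gamma theta :
  (forall w i W (psi : density A w W), let V := oI W (dom i) in
     D w W psi i = pencil_loc eps w i (fun a b => res V (S i a b))
       (fun a => res V (gamma i a)) (res V (theta i)) (psi i)) <->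
  (forall w, pencil_form (D w) S gamma theta).
Proof.
by split=> H w i W psi; have := H w i W psi; rewrite /= pencil_locE.
Qed.

Lemma form_res w (L : operator A w) S gamma theta i V (phi : density A w V) :
  pencil_form L S gamma theta -> V `<=` cdom (A i) ->
  res V (L V phi i) = pencilc (A i) eps w (fun a b => res V (S i a b))
      (fun a => res V (gamma i a)) (res V (theta i)) (res V (phi i)).
Proof.
move=> H Vi; rewrite H.
have s1 : oI V (dom i) `<=` cdom (A i) by move=> x [].
have s2 : V `<=` oI V (dom i) by move=> x Vx; split => //; exact: Vi.
rewrite (pencil_res eps s1) //; congr pencilc.
- by apply/funext => a; apply/funext => b; rewrite res_comp.
- by apply/funext => a; rewrite res_comp.
- by rewrite res_comp.
Qed.

Lemma form_eq w (L L' : operator A w) S gamma theta :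
  pencil_form L S gamma theta -> pencil_form L' S gamma theta -> L = L'.
Proof.
move=> H H'; apply: functional_extensionality_dep => W.
apply/funext => psi; apply: density_eq => i.
by rewrite H H'.
Qed.

Lemma ssym_dom S i V : sym2 eps S -> V `<=` cdom (A i) ->
  ssym eps (fun a b => res V (S i a b)).
Proof. by move=> sym Vi; apply: (ssym_res Vi); exact: sym i. Qed.

Variable w0 : R.
Hypotheses (w0_0 : w0 != 0) (w0_1 : w0 != 1) (w0_h : w0 != 2^-1).

(** Coefficients are compared chart by chart, over the whole domain of the
    chart. *)
Lemma form_inj (L : operator A w0) S S' gamma gamma' theta theta' :
  sym2 eps S -> sym2 eps S' ->
  pencil_form L S gamma theta -> pencil_form L S' gamma' theta' ->
  [/\ S = S', gamma = gamma' & theta = theta'].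
Proof.
move=> sym sym' H H'.
suff E i : [/\ S i = S' i, gamma i = gamma' i & theta i = theta' i].
  by split; apply: functional_extensionality_dep => i; have [] := E i.
have ii : dom i `<=` cdom (A i) by [].
have rid (f : X (dom i)) : res (dom i) f = f by rewrite res_id.
have [E1 E2 E3] : [/\ (fun a b => res (dom i) (S i a b)) = (fun a b => res (dom i) (S' i a b)),
    (fun a => res (dom i) (gamma i a)) = (fun a => res (dom i) (gamma' i a)) &
    res (dom i) (theta i) = res (dom i) (theta' i)].
  apply: (pencil_inj ii w0_0 w0_1 w0_h (ssym_dom sym ii) (ssym_dom sym' ii)) => psi.
  have [phi <-] := density_surj w0 psi ii.
  by rewrite -(form_res _ H ii) -(form_res _ H' ii).
split.
- by apply/funext => a; apply/funext => b; have := congr1 (fun f => f a b) E1; rewrite /= !rid.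
- by apply/funext => a; have := congr1 (fun f => f a) E2; rewrite /= !rid.
- by move: E3; rewrite !rid.
Qed.

Lemma second_order_form (L : operator A w0) S : second_order eps S L ->
  exists gamma theta, [/\ par1 eps gamma, par0 eps theta & pencil_form L S gamma theta].
Proof.
case=> sym [T [F [hT [hF H]]]].
have ii i : dom i `<=` cdom (A i) by [].
exists (fun i => gamma_of (A i) eps w0 (S i) (T i)).
exists (fun i => theta_of (A i) eps w0 (S i) (T i) (F i)); split.
- by move=> i a; apply: (gamma_of_par (ii i)); [exact: sym i|exact: hT i].
- by move=> i; apply: (theta_of_par (ii i)); [exact: sym i|exact: hT i|exact: hF].
move=> i W psi V; have Vi : V `<=` cdom (A i) by move=> x [].
rewrite H -/V -[LHS]/(op2c (A i) _ _ _ _) -(pencil_of (A i) eps _ _ _ _ w0_0 w0_1 w0_h).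
congr pencilc.
- by apply/funext => a; rewrite (gamma_of_res eps (ii i) Vi).
- by rewrite (theta_of_res eps (ii i) Vi).
Qed.

(** By pencil_change, the coefficients in the chart j yield a pencil in the
    coordinates of the chart i, with coefficients independent of the weight. At
    weight w0 both this pencil and the one in the chart i are L, so their
    coefficients agree, and the two pencils agree at all weights. *)
Lemma form_change (L : operator A w0) S gamma theta w W (psi : density A w W) i j :
  sym2 eps S -> par1 eps gamma -> par0 eps theta -> pencil_form L S gamma theta ->
  let V := oI W (oI (dom i) (dom j)) in
  let P k := pencilc (A k) eps w (fun a b => res (oI W (dom k)) (S k a b))
    (fun a => res (oI W (dom k)) (gamma k a)) (res (oI W (dom k)) (theta k)) (psi k) in
  res V (P i) = res V (P j) * spow (A i) (Ber (jac (A i) (A j) V)) w.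
Proof.
move=> sym hg ht H V P.
have VW : V `<=` W by move=> x [].
have Vi : V `<=` cdom (A i) by move=> x [_ []].
have Vj : V `<=` cdom (A j) by move=> x [_ []].
have resP k : V `<=` cdom (A k) -> res V (P k) =
    pencilc (A k) eps w (fun a b => res V (S k a b))
      (fun a => res V (gamma k a)) (res V (theta k)) (res V (psi k)).
  move=> Vk; have s1 : oI W (dom k) `<=` cdom (A k) by move=> x [].
  have s2 : V `<=` oI W (dom k) by move=> x Vx; split; [exact: VW|exact: Vk].
  rewrite (pencil_res eps s1) //; congr pencilc.
  - by apply/funext => a; apply/funext => b; rewrite res_comp.
  - by apply/funext => a; rewrite res_comp.
  - by rewrite res_comp.
rewrite !resP // (density_change_trans psi VW Vi Vj).
have [S1 [g1 [t1 [sym1 _ _ E]]]] := pencil_change Vi Vj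
  (ssym_dom sym Vj) (spar_vec_res Vj (hg j)) (res_par Vj (ht j)) (jac_pos Vi Vj).
rewrite /trans E.
have [-> -> ->] : [/\ (fun a b => res V (S i a b)) = S1,
    (fun a => res V (gamma i a)) = g1 & res V (theta i) = t1].
  apply: (pencil_inj Vi w0_0 w0_1 w0_h (ssym_dom sym Vi) sym1) => chi.
  have [phi <-] := density_surj w0 chi Vi.
  rewrite -(form_res _ H Vi) -E -/(trans i j V _) -/(trans i j V _).
  have VV : V `<=` V by [].
  rewrite -(density_change_trans phi VV Vi Vj) -(form_res _ H Vj).
  rewrite (density_change_trans (L V phi) VV Vi Vj).
  have e := trans_par Vi Vj w0.
  by rewrite -(even_comm _ e) mulrA transNr // mul1r.
by [].
Qed.

Lemma pencil_exists (L : operator A w0) S : second_order eps S L ->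
  exists D : forall w, operator A w, canonical_pencil eps D /\ D w0 = L.
Proof.
move=> hL; have [gamma [theta [hg ht H]]] := second_order_form hL.
have sym : sym2 eps S by case: hL.
pose D w : operator A w := fun W psi =>
  Density (fun i j => form_change psi i j sym hg ht H).
have HD w : pencil_form (D w) S gamma theta by [].
exists D; split; last exact: form_eq (HD w0) H.
exists S, gamma, theta; do 3![split=> //].
exact: (canonical_form D S gamma theta).2 HD.
Qed.

Lemma canonical_pencil_uniq (D D' : forall w, operator A w) :
  canonical_pencil eps D -> canonical_pencil eps D' -> D w0 = D' w0 -> D = D'.
Proof.
move=> [S [g [t [sym [_ [_ /canonical_form H]]]]]] [S' [g' [t' [sym' [_ [_ /canonical_form H']]]]]] E.
have := H w0; rewrite E => H0; have [? ? ?] := form_inj sym sym' H0 (H' w0); subst.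
by apply: functional_extensionality_dep => w; exact: form_eq (H w) (H' w).
Qed.

End Pencils.

(** * The pencil in terms of a volume form *)

Section LaplaceBeltramiLie.
Variables (R : realType) (M : topologicalType) (X : superspace R M).
Variables (n m : nat) (A : atlas X n m) (eps : bool) (w0 : R) (i : aidx A) (U : opens M).
Hypothesis Ui : U `<=` cdom (A i).
Hypotheses (w0_0 : w0 != 0) (w0_1 : w0 != 1) (w0_h : w0 != 2^-1).
Variables (S : 'I_(n + m) -> 'I_(n + m) -> X U) (rho : X U).
Hypotheses (symS : ssym eps S) (rhoe : spar X false rho) (rho0 : snonvanishing (A i) rho).
Variables (Q : 'I_(n + m) -> X U) (f : X U).

(** The Lie derivative with coefficient (2w - 1)/(2w0 - 1) is a pencil with
    gamma = 2Q/(2w0 - 1), up to a multiple of div Q. In it the coefficient of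
    div Q is w(2w - 1)/(2w0 - 1), whereas gamma alone accounts for w/(2w0 - 1);
    the difference is w(w - 1) times 2/(2w0 - 1), and enters theta. *)
Definition LB_lie_gamma a : X U :=
  LB_gamma (A i) S rho a + cst X (2 / (2 * w0 - 1)) * Q a.
Definition LB_lie_theta : X U :=
  LB_theta (A i) S rho + (cst X (4 / (2 * w0 - 1)) * sdiv (A i) eps Q
    + cst X (2 / (w0 * (w0 - 1))) * f).

Lemma LB_lie_pencil w psi :
  LB_loc eps w i S rho psi + cst X ((2 * w - 1) / (2 * w0 - 1)) * lie_loc eps w i Q psi
    + cst X (w * (w - 1) / (w0 * (w0 - 1))) * f * psi =
  pencilc (A i) eps w S LB_lie_gamma LB_lie_theta psi.
Proof.
have k0 : 2 * w0 - 1 != 0 by apply: contra w0_h => /eqP E; apply/eqP; lra.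
have q0 : w0 * (w0 - 1) != 0 by rewrite mulf_neq0 // subr_eq0.
move: k0 q0 => k0 q0.
have -> : LB_loc eps w i S rho psi = pencilc (A i) eps w S (LB_gamma (A i) S rho)
    (LB_theta (A i) S rho) psi by exact (LB_pencil Ui symS rhoe rho0 w psi).
rewrite lie_locE /pencilc /LB_lie_gamma vec_partD vec_partZ (sdivD Ui) (sdivZ Ui) /LB_lie_theta.
move: (2 * w0 - 1) (w0 * (w0 - 1)) k0 q0 => k q k0 q0.
set v := vec_part (A i) Q psi; set d := sdiv (A i) eps Q.
set v1 := vec_part _ _ _; set d1 := sdiv _ _ _; set t1 := LB_theta _ _ _; set l := lap _ _ _ _.
transitivity (cst X 2^-1 * (l + cst X (2 * w - 1) * v1 + cst X w * d1 * psi
    + cst X (w * (w - 1)) * t1 * psi) + (cst X ((2 * w - 1) / k) * v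
    + (cst X (w / k) + cst X (2 * (w * (w - 1)) / k)) * (d * psi)
    + cst X (w * (w - 1) / q) * (f * psi))).
  rewrite -cstD (_ : w / k + 2 * (w * (w - 1)) / k = (2 * w - 1) / k * w); last by field.
  rewrite [cst X (_ * w)]cstM.
  by nc_ring.
rewrite (_ : (2 * w - 1) / k = 2^-1 * ((2 * w - 1) * (2 / k))); last by field.
rewrite (_ : w / k = 2^-1 * (w * (2 / k))); last by field.
rewrite (_ : 2 * (w * (w - 1)) / k = 2^-1 * (w * (w - 1) * (4 / k))); last by field.
rewrite (_ : w * (w - 1) / q = 2^-1 * (w * (w - 1) * (2 / q))); last by field.
rewrite ![cst X (2^-1 * _)]cstM ![cst X (_ * (_ / _))]cstM.
by nc_ring.
Qed.

End LaplaceBeltramiLie.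

Lemma snonvanishing_res (R : realType) (M : topologicalType) (X : superspace R M)
    (n m : nat) (c : chart X n m) (U V : opens M) (f : X U) :
  U `<=` cdom c -> V `<=` U -> snonvanishing c f -> snonvanishing c (res V f).
Proof.
move=> Uc VU f0 y Vy; rewrite crep_res //; apply: f0.
by case: Vy => x Vx <-; exists x => //; exact: VU.
Qed.

Theorem LB_lie_fun_pencil (R : realType) (M : topologicalType) (X : superspace R M)
    (n m : nat) (A : atlas X n m) (eps : bool) (w0 : R) (S : tens_coefs A)
    (rho : density A 1 (oT M)) (Q : vec_coefs A) (f : X (oT M))
    (D : forall w, operator A w) :
  w0 != 0 -> w0 != 1 -> w0 != 2^-1 -> sym2 eps S -> volume_form rho ->
  is_LB_lie_fun eps 1 1 S rho Q f (D w0) -> canonical_pencil eps D ->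
  forall w, is_LB_lie_fun eps ((2 * w - 1) / (2 * w0 - 1))
    ((w * (w - 1)) / (w0 * (w0 - 1))) S rho Q f (D w).
Proof.
move=> w0_0 w0_1 w0_h sym hrho HL [S2 [g2 [t2 [sym2' [_ [_ /canonical_form H]]]]]] w i W psi V.
have k0 : 2 * w0 - 1 != 0 by apply: contra w0_h => /eqP E; apply/eqP; lra.
have q0 : w0 * (w0 - 1) != 0 by rewrite mulf_neq0 // subr_eq0.
pose ok (U : opens M) := [/\ (fun a b => res U (S2 i a b)) = (fun a b => res U (S i a b)),
  (fun a => res U (g2 i a)) = LB_lie_gamma w0 i (fun a b => res U (S i a b))
     (res U (rho i)) (fun a => res U (Q i a)) &
  res U (t2 i) = LB_lie_theta eps w0 i (fun a b => res U (S i a b))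
     (res U (rho i)) (fun a => res U (Q i a)) (res U f)].
have rhoU (U : opens M) : U `<=` cdom (A i) ->
    spar X false (res U (rho i)) /\ snonvanishing (A i) (res U (rho i)).
  move=> Ui; have [h1 h2] := hrho i.
  have s1 : U `<=` oI (oT M) (dom i) by move=> x Ux; split => //; exact: Ui.
  by split; [exact: res_par|apply: (snonvanishing_res _ s1 h2) => x []].
have Vi : V `<=` cdom (A i) by move=> x [].
(* Densities over V have their coefficients over the intersection of V with the
   domain of the chart, which is V itself, although not by definition. *)
have [E1 E2 E3] : ok V.
  have -> : V = oI V (dom i).
    by apply: opens_eq => [x Vx|x []//]; split=> //; exact: Vi.
  set U := oI V (dom i); have Ui : U `<=` cdom (A i) by move=> x [].
  have [re r0] := rhoU U Ui.
  apply: (pencil_inj Ui w0_0 w0_1 w0_h (ssym_dom sym2' Ui) (ssym_dom sym Ui)) => chi.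
  have [phi <-] := density_onto w0 chi Vi.
  rewrite -(LB_lie_pencil Ui w0_0 w0_1 w0_h (ssym_dom sym Ui) re r0).
  by rewrite !divff // -HL H.
have [re r0] := rhoU V Vi.
rewrite (LB_lie_pencil Vi w0_0 w0_1 w0_h (ssym_dom sym Vi) re r0) H -/V.
by rewrite E1 E2 E3.
Qed.

Theorem theorem2p5 (R : realType) (M : topologicalType)
  (M_hausdorff : hausdorff_space M) (M_second_countable : @second_countable M)
  (X : superspace R M) (n m : nat) (A : atlas X n m)
  (eps : bool) (w0 : R) (S : tens_coefs A) (L : operator A w0)
  (L_second_order : second_order eps S L)
  (w0_neq0 : w0 <> 0) (w0_neq1 : w0 <> 1) (w0_neq_half : w0 <> 2^-1) :
  (exists! D : forall w, operator A w, canonical_pencil eps D /\ D w0 = L) /\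
  (forall (rho : density A 1 (oT M)) (Q : vec_coefs A) (f : X (oT M)),
     volume_form rho -> vector_field eps Q -> spar X eps f ->
     is_LB_lie_fun eps 1 1 S rho Q f L ->
     forall D : forall w, operator A w,
       canonical_pencil eps D -> D w0 = L ->
       forall w : R,
         is_LB_lie_fun eps ((2 * w - 1) / (2 * w0 - 1))
           ((w * (w - 1)) / (w0 * (w0 - 1))) S rho Q f (D w)).
Proof.
move: w0_neq0 w0_neq1 w0_neq_half => /eqP w0_0 /eqP w0_1 /eqP w0_h; split.
  have [D [HD DL]] := pencil_exists w0_0 w0_1 w0_h L_second_order.
  exists D; split=> // D' [HD' D'L].
  by apply: (canonical_pencil_uniq w0_0 w0_1 w0_h HD HD'); rewrite DL D'L.
move=> rho Q f hrho _ _ HL D HD DL.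
case: L_second_order => sym _; rewrite -DL in HL.
exact: LB_lie_fun_pencil w0_0 w0_1 w0_h sym hrho HL HD.
Qed.
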